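(* The following properties are equivalent. (i) The evolution operator $G(t,s)$ is supercontractive. (ii) The function $\varphi_\lambda(x):=e^{\lambda|x|^2}$ belongs to $L^1(\mathbb R^d,\mu_s)$ for every $\lambda>0$ and $s\in I$, and moreover $$\sup_{s\in I}\|\varphi_\lambda\|_{1,\mu_s}<+\infty,\qquad\lambda>0.$$
   Context: Setting. $I$ is an open right halfline, and for $t\in I$, $(\mathcal A(t)\zeta)(x)=\mathrm{Tr}(Q(t)D^2\zeta(x))+\langle b(t,x),\nabla\zeta(x)\rangle$, $x\in\mathbb R^d$, where $Q=[q_{ij}]$ and $b=(b_1,\dots,b_d)$. Standing assumptions: (i) for some $\theta\in(0,1)$, $q_{ij}\in C^{\theta/2}_{\rm loc}(I)$ and $b_i\in C^{\theta/2,\theta}_{\rm loc}(I\times\mathbb R^d)$ (locally parabolic H\''older); (ii) $Q(t)$ is symmetric and there are $0<\eta_0<\Lambda$ with $\eta_0|\xi|^2\le\langle Q(t)\xi,\xi\rangle\le\Lambda|\xi|^2$ for all $t\in I$, $\xi\in\mathbb R^d$; (iii) there are a positive $\varphi\in C^2(\mathbb R^d)$ with $\varphi(x)\to+\infty$ as $|x|\to+\infty$ and constants $a,\gamma>0$ with $(\mathcal A(t)\varphi)(x)\le a-\gamma\varphi(x)$ for all $(t,x)\in I\times\mathbb R^d$; (iv) the first order spatial derivatives of $b_i$ exist and belong to $C^{\theta/2,\theta}_{\rm loc}(I\times\mathbb R^d)$, and there is $r_0<0$ with $\langle\nabla_xb(t,x)\xi,\xi\rangle\le r_0|\xi|^2$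 for all $(t,x)\in I\times\mathbb R^d$, $\xi\in\mathbb R^d$. For $s\in I$ and $f\in C_b(\mathbb R^d)$, $G(\cdot,s)f\in C_b([s,+\infty)\times\mathbb R^d)\cap C^{1+\theta/2,2+\theta}_{\rm loc}((s,+\infty)\times\mathbb R^d)$ denotes the unique bounded classical solution of $D_tu=\mathcal A(t)u$ in $(s,+\infty)\times\mathbb R^d$, $u(s,\cdot)=f$. Under these assumptions there is a unique family $\{\mu_t:t\in I\}$ of Borel probability measures which is tight (for every $\varepsilon>0$ there is $R>0$ with $\mu_t(B(0,R))\ge1-\varepsilon$ for all $t\in I$) and satisfies $\int G(t,s)f\,d\mu_t=\int f\,d\mu_s$ for all $t>s$ in $I$, $f\in C_b(\mathbb R^d)$ (the tight evolution system of measures). $G(t,s)$ extends to a contraction from $L^p(\mathbb R^d,\mu_s)$ to $L^p(\mathbb R^d,\mu_t)$ for every $p\in[1,+\infty)$, still denoted $G(t,s)$. $\|\cdot\|_{p,\mu}$ is the norm of $L^p(\mathbb R^d,\mu)$; $\|G(t,s)\|_{p\to q}$ is the operator norm from $L^p(\mathbb R^d,\mu_s)$ to $L^q(\mathbb R^d,\mu_t)$. $G(t,s)$ is called supercontractive if it maps $L^p(\mathbb R^d,\mu_s)$ into $L^q(\mathbb R^d,\mu_t)$ for any $1<p<q<+\infty$ and $t>s$ in $I$, and (for each such $p,q$) there is a positive decreasing function $C_{p,q}:(0,+\infty)\to(0,+\infty)$ with $\lim_{r\to0^+}C_{p,q}(r)=+\infty$ and $\|G(t,s)\|_{p\to q}\le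 C_{p,q}(t-s)$ for all $s<t$ in $I$. *)

(* Defs.v *)
From HB Require Import structures.
From mathcomp Require Import all_boot all_order all_algebra.
From mathcomp Require Import all_classical all_reals all_analysis.

Set Implicit Arguments.
Unset Strict Implicit.
Unset Printing Implicit Defensive.

Import Order.TTheory GRing.Theory Num.Theory.
Import numFieldNormedType.Exports.

Local Open Scope classical_set_scope.
Local Open Scope ring_scope.

Section Euclidean.
Variables (R : realType) (d : nat).
Local Notation V := 'rV[R]_d.

(* The canonical norm `|x| on 'rV[R]_d is the sup norm, hence the explicit
   Euclidean structure. The topologies agree. *)
Definition dotv (x y : V) : R := \sum_i x 0 i * y 0 i.
Definition enorm (x : V) : R := Num.sqrt (dotv x x).

(* B(0, r) *)
Definition eball (r : R) : set V := [set x | enorm x < r].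

(* The vector A x, for x stored as a row. *)
Definition mxapp (A : 'M[R]_d) (x : V) : V := x *m A^T.

(* R^d with its Borel sigma-algebra. *)
Definition borelV := g_sigma_algebraType (@open V).

Definition Cb (f : V -> R) : Prop :=
  continuous f /\ exists M : R, forall x, `|f x| <= M.

Definition Dx (i : 'I_d) (f : V -> R) (x : V) : R := 'D_(delta_mx 0 i) f x.
Definition Dxx (i j : 'I_d) (f : V -> R) : V -> R := Dx i (Dx j f).
Definition Dt (u : R -> V -> R) (t : R) (x : V) : R := derive1 (u^~ x) t.

Definition grad (f : V -> R) (x : V) : V := \row_i Dx i f x.
Definition hess (f : V -> R) (x : V) : 'M[R]_d := \matrix_(i, j) Dxx i j f x.
Definition jac (f : V -> V) (x : V) : 'M[R]_d :=
  \matrix_(i, j) Dx j (fun y => f y 0 i) x.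

Definition derivable_x (f : V -> R) : Prop :=
  forall i x, derivable f x (delta_mx 0 i).

Record C2 (f : V -> R) : Prop := {
  C2_derivable1 : derivable_x f;
  C2_derivable2 : forall i, derivable_x (Dx i f);
  C2_cont : continuous f;
  C2_cont1 : forall i, continuous (Dx i f);
  C2_cont2 : forall i j, continuous (Dxx i j f) }.

Definition continuous_on (J : set R) (u : R -> V -> R) : Prop :=
  {within J `*` setT, continuous (fun z : R * V => u z.1 z.2)}.

Record C12 (J : set R) (u : R -> V -> R) : Prop := {
  C12_derivable_t : forall t x, J t -> derivable (u^~ x) t 1;
  C12_derivable_x : forall t, J t -> derivable_x (u t);
  C12_derivable_xx : forall t i, J t -> derivable_x (Dx i (u t));
  C12_cont : continuous_on J u;
  C12_cont_t : continuous_on J (Dt u);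
  C12_cont_x : forall i, continuous_on J (fun t => Dx i (u t));
  C12_cont_xx : forall i j, continuous_on J (fun t => Dxx i j (u t)) }.

Definition holder_loc (alpha : R) (J : set R) (q : R -> R) : Prop :=
  forall K : set R, compact K -> K `<=` J ->
  exists C : R, forall t r, K t -> K r -> `|q t - q r| <= C * `|t - r| `^ alpha.

(* C^{theta/2, theta}_loc (J x R^d) *)
Definition parabolic_holder_loc (theta : R) (J : set R) (u : R -> V -> R)
    : Prop :=
  forall K : set (R * V), compact K -> K `<=` J `*` setT ->
  exists C : R, forall z w, K z -> K w ->
    `|u z.1 z.2 - u w.1 w.2| <=
      C * (`|z.1 - w.1| `^ (theta / 2) + enorm (z.2 - w.2) `^ theta).

(* C^{1 + theta/2, 2 + theta}_loc (J x R^d) *)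
Record parabolic_holder2_loc (theta : R) (J : set R) (u : R -> V -> R)
    : Prop := {
  ph2_C12 : C12 J u;
  ph2_u : parabolic_holder_loc theta J u;
  ph2_t : parabolic_holder_loc theta J (Dt u);
  ph2_x : forall i, parabolic_holder_loc theta J (fun t => Dx i (u t));
  ph2_xx : forall i j, parabolic_holder_loc theta J (fun t => Dxx i j (u t)) }.

End Euclidean.

Section EvolutionOperator.
Variables (R : realType) (d : nat).
Local Notation V := 'rV[R]_d.
Variables (I : set R) (Q : R -> 'M[R]_d) (b : R -> V -> V).

Definition elliptic_op (t : R) (f : V -> R) (x : V) : R :=
  \tr (Q t *m hess f x) + dotv (b t x) (grad f x).

Definition uniformly_elliptic : Prop :=
  exists eta0 Lambda : R, 0 < eta0 < Lambda /\
    forall t xi, I t ->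
      eta0 * enorm xi ^+ 2 <= dotv (mxapp (Q t) xi) xi
                           <= Lambda * enorm xi ^+ 2.

Definition lyapunov_condition : Prop :=
  exists (phi : V -> R) (a gamma : R),
    [/\ C2 phi,
        forall x, 0 < phi x,
        forall M : R, exists r : R, forall x, r <= enorm x -> M <= phi x,
        0 < a /\ 0 < gamma &
        forall t x, I t -> elliptic_op t phi x <= a - gamma * phi x].

Definition dissipative_drift : Prop :=
  exists r0 : R, r0 < 0 /\
    forall t x xi, I t ->
      dotv (mxapp (jac (b t) x) xi) xi <= r0 * enorm xi ^+ 2.

Record standing_assumptions (theta : R) : Prop := {
  sa_theta : 0 < theta < 1;
  sa_Q_holder : forall i j, holder_loc (theta / 2) I (fun t => Q t i j);
  sa_b_holder : forall i,
    parabolic_holder_loc theta I (fun t x => b t x 0 i);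
  sa_Q_sym : forall t, I t -> (Q t)^T = Q t;
  sa_Q_elliptic : uniformly_elliptic;
  sa_lyapunov : lyapunov_condition;
  sa_b_derivable : forall t i, I t -> derivable_x (fun x => b t x 0 i);
  sa_Db_holder : forall i j,
    parabolic_holder_loc theta I (fun t => Dx j (fun x => b t x 0 i));
  sa_dissipative : dissipative_drift }.

Record bounded_classical_solution (s : R) (f : V -> R) (u : R -> V -> R)
    : Prop := {
  bcs_cont : continuous_on `[s, +oo[ u;
  bcs_bounded : exists M : R, forall t x, s <= t -> `|u t x| <= M;
  bcs_C12 : C12 `]s, +oo[ u;
  bcs_eq : forall t x, s < t -> Dt u t x = elliptic_op t (u t) x;
  bcs_init : u s = f }.

(* Under the standing assumptions the bounded classical solution is unique, so
   this determines G t s f for s in I, t >= s and f bounded and continuous.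
   The values of G elsewhere are irrelevant. *)
Definition evolution_operator (theta : R) (G : R -> R -> (V -> R) -> V -> R)
    : Prop :=
  forall s f, I s -> Cb f ->
    bounded_classical_solution s f (fun t => G t s f) /\
    parabolic_holder2_loc theta `]s, +oo[ (fun t => G t s f).

Variables (G : R -> R -> (V -> R) -> V -> R).
Variable mu : R -> probability (borelV R d) R.

Definition tight_family : Prop :=
  forall eps : R, 0 < eps -> exists r : R, 0 < r /\
    forall t, I t -> ((1 - eps)%:E <= mu t (@eball R d r))%E.

Definition evolution_system_of_measures : Prop :=
  forall t s f, I s -> I t -> s < t -> Cb f ->
    (\int[mu t]_x (G t s f x)%:E = \int[mu s]_x (f x)%:E)%E.

Definition Lp (p t : R) (f : V -> R) : Prop :=
  (f : borelV R d -> R) \in Lfun (mu t) p%:E.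

Definition Lpnorm (p t : R) (f : V -> R) : \bar R :=
  'N[mu t]_p%:E[EFin \o (f : borelV R d -> R)].

(* g represents the image of the class of f under the continuous extension of
   G t s from bounded continuous functions to an operator from L^p(mu_s) to
   L^p(mu_t). *)
Definition Lp_extension (p t s : R) (f g : V -> R) : Prop :=
  [/\ Lp p s f, Lp p t g &
      exists h : nat -> V -> R,
        [/\ forall n, Cb (h n),
            Lpnorm p s (h n \- f) @[n --> \oo] --> 0%E &
            Lpnorm p t (G t s (h n) \- g) @[n --> \oo] --> 0%E]].

(* Supremum of ||G(t,s) f||_{q, mu_t} over ||f||_{p, mu_s} <= 1; it is +oo if
   G(t,s) is unbounded from L^p(mu_s) to L^q(mu_t). *)
Definition opnorm (p q t s : R) : \bar R :=
  ereal_sup [set Lpnorm q t g | g in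
    [set g | exists2 f, (Lpnorm p s f <= 1)%E & Lp_extension p t s f g]].

Definition supercontractive : Prop :=
  forall p q : R, 1 < p -> p < q ->
    (forall t s, I s -> I t -> s < t -> forall f, Lp p s f ->
       exists2 g, Lp_extension p t s f g & Lp q t g) /\
    exists C : R -> R,
      [/\ forall r : R, 0 < r -> 0 < C r,
          forall r r' : R, 0 < r -> r < r' -> C r' < C r,
          C r @[r --> 0^'+] --> +oo &
          forall t s, I s -> I t -> s < t ->
            (opnorm p q t s <= (C (t - s))%:E)%E].

Definition gauss_weight (lambda : R) (x : V) : R :=
  expR (lambda * enorm x ^+ 2).

End EvolutionOperator.

(* Main.v *)
Require Import Defs.
From HB Require Import structures.
From mathcomp Require Import all_boot all_order all_algebra.
From mathcomp Require Import all_classical all_reals all_analysis.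
From mathcomp Require Import measurable_realfun ring lra.
Import Order.TTheory GRing.Theory Num.Theory.
Import numFieldNormedType.Exports.
Local Open Scope classical_set_scope.
Local Open Scope ring_scope.

Set Implicit Arguments.
Unset Strict Implicit.
Unset Printing Implicit Defensive.

(** Both implications rest on two estimates for [G t s], obtained by doubling
    the variables in the maximum principle.

    Doubling.  Let [U] be a subsolution of [D_t u = A u] and let [W] be a
    supersolution of [D_t w = A w + <Q grad w, grad w>], the equation solved by
    the logarithm of a positive solution.  Then the inequality
    [U t x <= exp (rho * (W t y + c t * |x - y|^2) + eta)] propagates in time as
    soon as [0 < rho <= 1] and [c' = - al * c^2] with
    [al <= 4 * eta0 * (1 - rho)].  At a point of violation the second
    derivatives are tested in the diagonal directions [(v, v)] only.  There
    [|x - y|^2] is constant, and since [Q t] does not depend on the space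
    variable the two diffusion terms can be compared.  The drift contributes
    [<b t x - b t y, x - y> <= 0], and the decrease of [c] is paid by the term
    [(1 - rho) * <Q grad w, grad w>], in which [grad w = 2 * c * (x - y)]
    ([doubling_core], [doubling_penalized]).

    With [rho = 1 / p] and [c] infinite at the initial time this is Wang's
    Harnack inequality ([harnack]),
    [(G e^h x)^p <= G e^(p h) y * exp (|x - y|^2 / (4 eta0 (1 - 1/p) (t - s)))].
    With [rho = 1] and [c] constant it says that [ln (G t s e^h)] is
    [L]-Lipschitz when [h] is ([G_exp_lipschitz]); the quadratic term of its
    equation is then at most [Lambda * L^2], whence the reverse Jensen inequality
    [ln (G e^h) <= G h + Lambda * L^2 * (t - s)] ([G_exp_upper]).

    From Gaussian integrability to supercontractivity.  Integrating the Harnack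
    inequality in [y] over a ball whose [mu t]-measure is at least [1/2], which
    tightness provides uniformly in [t], gives
    [|G t s f x| <= ||f||_p * exp (K * (1 + |x|^2) / (t - s))]
    ([pointwise_bound]), and the weight on the right has finite [L^q (mu t)]
    norm for every [q], uniformly in [t].  The same bound, applied to
    differences, shows that [G t s] extends to [L^p] ([extension_exists],
    [opnorm_bound]).

    From supercontractivity to Gaussian integrability.  Only the bound [C] of
    [G t s] from [L^2] to [L^4] is used.  For an [L]-Lipschitz [h] the two
    Jensen inequalities bound [G e^h] by
    [exp (Lambda * L^2 * tau) * (G e^(h/4))^4], [tau = t - s]; integrating
    against [mu t] gives
    [mu s (e^h) <= exp (Lambda * L^2 * tau) * C(tau)^4 * mu s (e^(h/2))^2]
    ([exp_step]).  Applied to truncations of [lambda * |x|] and iterated over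
    dyadic values of [lambda], this yields
    [ln (mu s (e^(lambda |x|))) <= 2 * Lambda * tau * lambda^2 + D * lambda]
    ([mgf_bound]), uniformly in [s].  As [tau] is arbitrarily small the
    quadratic coefficient is arbitrarily small too, and such a bound on the
    exponential moments gives [exp (alpha * |x|^2)] integrable for every
    [alpha] ([gauss_integral_bound]). *)

(** * Differentiability along lines *)

Section Calculus.
Variables (R : realType) (d : nat).
Local Notation V := 'rV[R]_d.

Lemma is_derive_shift (f : V -> R) (x v : V) (r df : R) :
  is_derive (x + r *: v) v f df -> is_derive r 1 (fun t => f (x + t *: v)) df.
Proof.
move=> [dfv <-].
have E : (fun h : R => h^-1 *: (((fun t => f (x + t *: v)) \o shift r) (h *: 1) - f (x + r *: v)))
   = (fun h : R => h^-1 *: ((f \o shift (x + r *: v)) (h *: v) - f (x + r *: v))).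
  apply/funext => h /=; congr (_ *: (f _ - _)).
  by rewrite [_%:A]mulr1 scalerDl addrCA.
apply: DeriveDef; first by rewrite /derivable E.
by rewrite /derive E.
Qed.

Lemma partial_mean_value (f : V -> R) (i : 'I_d) (a : V) (c g e : R) :
  derivable_x f ->
  (forall r : R, `|r| <= `|c| -> `|Dx i f (a + r *: delta_mx 0 i) - g| <= e) ->
  `|f (a + c *: delta_mx 0 i) - f a - c * g| <= `|c| * e.
Proof.
move=> fd He.
have Hd (r : R) : is_derive r (1 : R) (fun t => f (a + t *: delta_mx 0 i))
    (Dx i f (a + r *: delta_mx 0 i)).
  by apply: is_derive_shift; apply: DeriveDef.
have Hc A : {within A, continuous (fun t => f (a + t *: delta_mx 0 i))}.
  apply: continuous_subspaceT => r; apply: differentiable_continuous.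
  by apply/derivable1_diffP; case: (Hd r).
have [r rc ->] : exists2 r, `|r| <= `|c| & f (a + c *: delta_mx 0 i) - f a =
    c * Dx i f (a + r *: delta_mx 0 i).
  have [c0|c0] := leP 0 c.
    have [r rc] := MVT_segment c0 (fun x _ => Hd x) (Hc _).
    rewrite scale0r addr0 subr0 => ->; exists r; last by rewrite mulrC.
    by move: rc; rewrite in_itv/= => /andP[r0 rc]; rewrite !ger0_norm.
  have [r rc] := MVT_segment (ltW c0) (fun x _ => Hd x) (Hc _).
  rewrite scale0r addr0 sub0r => E; exists r; last first.
    by rewrite -[LHS]opprB E mulrN opprK mulrC.
  by move: rc; rewrite in_itv/= => /andP[r0 rc]; rewrite !ler0_norm ?lerN2// ltW.
by rewrite -mulrBr normrM ler_wpM2l// He.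
Qed.

Lemma ler_rV_norm (x : V) i : `|x 0 i| <= `|x|.
Proof.
rewrite [leRHS]/Num.norm /= mx_normrE.
by apply/bigmax_geP; right => /=; exists (0, i).
Qed.

Lemma rV_normP (x : V) (e : R) : 0 <= e -> (forall i, `|x 0 i| <= e) -> `|x| <= e.
Proof.
move=> e0 H; rewrite [leLHS]/Num.norm /= mx_normrE.
by apply/bigmax_leP; split => //= -[i j] _ /=; rewrite (ord1 i).
Qed.

(** The increment [v] is decomposed into one step along each coordinate axis, so
    that only partial derivatives enter. *)
Lemma C1_increment (f : V -> R) (x : V) (e : R) : 0 < e -> derivable_x f ->
  (forall i, {for x, continuous (Dx i f)}) ->
  exists2 del, 0 < del & forall v : V, `|v| < del ->
    `|f (x + v) - f x - dotv (grad f x) v| <= e * \sum_i `|v 0 i|.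
Proof.
move=> e0 fd fc.
have [del del0 Hdel] : exists2 del, 0 < del &
    forall i (y : V), `|y| < del -> `|Dx i f (x + y) - Dx i f x| <= e.
  have : \forall y \near x, forall i, `|Dx i f y - Dx i f x| <= e.
    have H i : \forall y \near x, `|Dx i f y - Dx i f x| <= e.
      have /cvgrPdist_le /(_ e e0) := fc i.
      by apply: filterS => y; rewrite distrC.
    exact: (filter_forall (nbhs_filter x) H).
  move=> /nbhs_ballP[del /= del0 Hdel]; exists del => // i y ydel.
  by apply: Hdel; rewrite -ball_normE /= opprD addNKr normrN.
exists del => // v vdel.
pose w k : V := \row_j (if (j < k)%N then v 0 j else 0).
have wS (k : 'I_d) : w k.+1 = w k + v 0 k *: delta_mx 0 k.
  apply/rowP => j; rewrite !mxE eqxx /= ltnS leq_eqVlt.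
  have [/val_inj ->|jk] := eqVneq (nat_of_ord j) k; first by rewrite eqxx ltnn mulr1 add0r.
  rewrite (_ : (j == k) = false) ?mulr0 ?addr0//.
  by apply/negbTE; apply: contra jk => /eqP ->.
have w0 : w 0%N = 0 by apply/rowP => j; rewrite !mxE.
have wd : w d = v by apply/rowP => j; rewrite !mxE ltn_ord.
have -> : f (x + v) - f x - dotv (grad f x) v =
   \sum_(k < d) (f (x + w k.+1) - f (x + w k) - v 0 k * Dx k f x).
  rewrite sumrB -(big_mkord xpredT (fun k => f (x + w k.+1) - f (x + w k))) telescope_sumr//.
  rewrite w0 wd addr0; congr (_ - _).
  by apply: eq_bigr => k _; rewrite mxE mulrC.
apply: le_trans (ler_norm_sum _ _ _) _; rewrite mulr_sumr; apply: ler_sum => k _.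
rewrite wS addrA [e * _]mulrC; apply: partial_mean_value => // r rk.
rewrite -addrA; apply: Hdel; apply: le_lt_trans vdel.
apply: rV_normP => // j; rewrite !mxE eqxx /=.
have [->|jk] := eqVneq j k.
  by rewrite ltnn add0r mulr1 (le_trans rk)// ler_rV_norm.
rewrite mulr0 addr0; case: ifP => _; first exact: ler_rV_norm.
by rewrite normr0.
Qed.

(** Regularity is given in terms of partial derivatives, whereas the maximum
    principle differentiates in arbitrary directions: this is the usual fact that
    continuous partial derivatives imply differentiability. *)
Lemma line_derivative (f : V -> R) (x v : V) : derivable_x f ->
  (forall i, {for x, continuous (Dx i f)}) ->
  is_derive (0 : R) 1 (fun r => f (x + r *: v)) (dotv (grad f x) v).
Proof.
move=> fd fc.
suff H : h^-1 *: (f (x + h *: v) - f x) @[h --> (0:R)^'] --> dotv (grad f x) v.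
  have E : (fun h : R => h^-1 *: (((fun t => f (x + t *: v)) \o shift 0) (h *: 1) - f (x + 0 *: v)))
   = (fun h : R => h^-1 *: (f (x + h *: v) - f x)).
    apply/funext => h /=; congr (_ *: (f _ - f _)); last by rewrite scale0r addr0.
    by rewrite [_%:A]mulr1 addr0.
  apply: DeriveDef; first by rewrite /derivable E; apply/cvg_ex; eexists; exact: H.
  by rewrite /derive E; apply/cvg_lim.
pose S := \sum_i `|v 0 i|.
have S0 : 0 <= S by apply: sumr_ge0.
apply/cvgrPdist_le => e e0.
have e'0 : 0 < e / (S + 1) by rewrite divr_gt0// ltr_wpDl.
have [del del0 Hdel] := C1_increment e'0 fd fc.
have del'0 : 0 < del / (`|v| + 1) by rewrite divr_gt0// ltr_wpDl.
near=> h.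
have h0 : h != 0 by near: h; exact: nbhs_dnbhs_neq.
have hdel : `|h| < del / (`|v| + 1).
  by near: h; apply: dnbhs0_lt.
have := Hdel (h *: v).
have -> : dotv (grad f x) (h *: v) = h * dotv (grad f x) v.
  by rewrite /dotv mulr_sumr; apply: eq_bigr => i _; rewrite [(h *: v) _ _]mxE mulrCA.
have -> : \sum_i `|(h *: v) 0 i| = `|h| * S.
  by rewrite /S mulr_sumr; apply: eq_bigr => i _; rewrite [(h *: v) _ _]mxE normrM.
have hv : `|h *: v| < del.
  rewrite normrZ; apply: (@le_lt_trans _ _ (`|h| * (`|v| + 1))).
    by rewrite ler_wpM2l// lerDl.
  by rewrite -ltr_pdivlMr// ltr_wpDl.
move=> /(_ hv) H.
rewrite distrC.
have -> : h^-1 *: (f (x + h *: v) - f x) - dotv (grad f x) v =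
   h^-1 * (f (x + h *: v) - f x - h * dotv (grad f x) v).
  by rewrite mulrBr mulKf.
rewrite normrM normfV ler_pdivrMl ?normr_gt0//; apply: le_trans H _.
rewrite mulrCA ler_wpM2l// mulrAC ler_pdivrMr ?ltr_wpDl// ler_wpM2l ?lerDl ?ltW//.
Unshelve. all: by end_near. Qed.

End Calculus.

(** * Second-order expansions along lines *)

Section SecondOrder.
Variables (R : realType) (d : nat).
Local Notation V := 'rV[R]_d.
Implicit Types (f : V -> R) (g : V -> V) (H : V -> 'M[R]_d).

Definition quad (A : 'M[R]_d) (v : V) : R := (v *m A *m v^T) 0 0.

(** Only derivatives along lines are recorded: this is all that the maximum
    principle needs, and it is closed under composition without any continuity
    requirement. *)
Record line2 f g H : Prop := {
  line2_fst : forall x v,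
    is_derive (0 : R) 1 (fun r => f (x + r *: v)) (dotv (g x) v);
  line2_snd : forall x v,
    is_derive (0 : R) 1 (fun r => dotv (g (x + r *: v)) v) (quad (H x) v) }.

Lemma dotvE (x y : V) : dotv x y = (x *m y^T) 0 0.
Proof. by rewrite mxE; apply: eq_bigr => i _; rewrite [in RHS]mxE. Qed.

Lemma dotvC (x y : V) : dotv x y = dotv y x.
Proof. by apply: eq_bigr => i _; rewrite mulrC. Qed.

Lemma dotvDl (x y z : V) : dotv (x + y) z = dotv x z + dotv y z.
Proof. by rewrite !dotvE mulmxDl mxE. Qed.

Lemma dotvZl (c : R) (x z : V) : dotv (c *: x) z = c * dotv x z.
Proof. by rewrite !dotvE -scalemxAl mxE. Qed.

Lemma dotvDr (x y z : V) : dotv z (x + y) = dotv z x + dotv z y.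
Proof. by rewrite dotvC dotvDl !(dotvC z). Qed.

Lemma dotvZr (c : R) (x z : V) : dotv z (c *: x) = c * dotv z x.
Proof. by rewrite dotvC dotvZl (dotvC z). Qed.

Lemma dotvNl (x z : V) : dotv (- x) z = - dotv x z.
Proof. by rewrite -scaleN1r dotvZl mulN1r. Qed.

Lemma dotvNr (x z : V) : dotv z (- x) = - dotv z x.
Proof. by rewrite dotvC dotvNl dotvC. Qed.

Lemma dotv0l (z : V) : dotv 0 z = 0.
Proof. by rewrite -(scale0r (0 : V)) dotvZl mul0r. Qed.

Lemma dotv0r (z : V) : dotv z 0 = 0.
Proof. by rewrite dotvC dotv0l. Qed.

Lemma dotvv_ge0 (x : V) : 0 <= dotv x x.
Proof. by apply: sumr_ge0 => i _; rewrite -expr2 sqr_ge0. Qed.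

Lemma dotvv_gt0 (x : V) : x != 0 -> 0 < dotv x x.
Proof.
move=> x0; rewrite lt_neqAle dotvv_ge0 andbT eq_sym; apply: contra x0.
rewrite psumr_eq0 => [/allP H|i _]; last by rewrite -expr2 sqr_ge0.
apply/eqP/rowP => i; rewrite mxE; apply/eqP.
by have := H i (mem_index_enum _); rewrite -expr2 sqrf_eq0.
Qed.

Lemma enorm_sqr (x : V) : enorm x ^+ 2 = dotv x x.
Proof. by rewrite sqr_sqrtr// dotvv_ge0. Qed.

Lemma dotv_inj (x y : V) : (forall v, dotv x v = dotv y v) -> x = y.
Proof.
move=> H; apply/eqP; rewrite -subr_eq0; apply/negPn/negP => /dotvv_gt0.
by rewrite {1}dotvDl dotvNl H subrr ltxx.
Qed.

Lemma quadD A B v : quad (A + B) v = quad A v + quad B v.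
Proof. by rewrite /quad mulmxDr mulmxDl mxE. Qed.

Lemma quadZ c A v : quad (c *: A) v = c * quad A v.
Proof. by rewrite /quad -scalemxAr -scalemxAl mxE. Qed.

Lemma quad0 v : quad 0 v = 0.
Proof. by rewrite /quad mulmx0 mul0mx mxE. Qed.

Lemma quadN A v : quad (- A) v = - quad A v.
Proof. by rewrite -scaleN1r quadZ mulN1r. Qed.

Lemma quad_rank1 (g v : V) : quad (g^T *m g) v = dotv g v ^+ 2.
Proof.
rewrite /quad mulmxA -mulmxA mxE big_ord1 -dotvE expr2 -dotvE.
by rewrite dotvC.
Qed.

Lemma quad_sum A v : quad A v = \sum_j \sum_i v 0 i * A i j * v 0 j.
Proof.
rewrite /quad mxE; apply: eq_bigr => j _; rewrite !mxE mulr_suml.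
by apply: eq_bigr => i _.
Qed.

Lemma line2_cst (c : R) : line2 (fun=> c) (fun=> 0) (fun=> 0).
Proof.
split=> x v; first by rewrite dotv0l; exact: is_derive_cst.
by rewrite quad0 dotv0l; exact: is_derive_cst.
Qed.

Lemma line2D f1 g1 H1 f2 g2 H2 : line2 f1 g1 H1 -> line2 f2 g2 H2 ->
  line2 (fun x => f1 x + f2 x) (fun x => g1 x + g2 x) (fun x => H1 x + H2 x).
Proof.
move=> [a1 b1] [a2 b2]; split=> x v.
  by rewrite dotvDl; apply: is_deriveD.
rewrite quadD; under eq_fun do rewrite dotvDl.
exact: is_deriveD.
Qed.

Lemma line2Z (c : R) f g H : line2 f g H ->
  line2 (fun x => c * f x) (fun x => c *: g x) (fun x => c *: H x).
Proof.
move=> [a b]; split=> x v.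
  by rewrite dotvZl; apply: is_deriveZ.
rewrite quadZ; under eq_fun do rewrite dotvZl.
exact: is_deriveZ.
Qed.

Lemma line2_translate (a : V) f g H : line2 f g H ->
  line2 (fun x => f (a + x)) (fun x => g (a + x)) (fun x => H (a + x)).
Proof.
by move=> [a1 b1]; split=> x v; under eq_fun do rewrite addrA.
Qed.

Lemma line2_comp (F F1 F2 : R -> R) f g H : line2 f g H ->
  (forall x, is_derive (f x) 1 F (F1 (f x))) ->
  (forall x, is_derive (f x) 1 F1 (F2 (f x))) ->
  line2 (fun x => F (f x)) (fun x => F1 (f x) *: g x)
    (fun x => F1 (f x) *: H x + F2 (f x) *: ((g x)^T *m g x)).
Proof.
move=> [a b] dF dF1.
have comp (G G' : R -> R) x v : (forall x, is_derive (f x) 1 G (G' (f x))) ->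
    is_derive (0 : R) 1 (fun r => G (f (x + r *: v))) (G' (f x) * dotv (g x) v).
  move=> dG; apply: (@is_derive1_comp _ G (fun r => f (x + r *: v))).
  by have := dG x; rewrite scale0r addr0.
split=> x v; first by rewrite dotvZl; exact: comp.
rewrite quadD !quadZ quad_rank1; under eq_fun do rewrite dotvZl.
have := is_deriveM (comp _ _ x v dF1) (b x v).
rewrite scale0r addr0 => h; apply: is_derive_eq h _.
by rewrite /GRing.scale /=; ring.
Qed.

Lemma line2_line f g H (x v : V) (r : R) : line2 f g H ->
  is_derive r 1 (fun t => f (x + t *: v)) (dotv (g (x + r *: v)) v).
Proof.
move=> [a _]; have := a (x + r *: v) v.
under eq_fun do rewrite -addrA -scalerDl.
move=> h.
suff -> : (fun t => f (x + t *: v)) =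
    (fun t => f (x + (r + t) *: v)) \o (fun s => s - r).
  have h' : is_derive (r - r) 1 (fun r0 => f (x + (r + r0) *: v)) (dotv (g (x + r *: v)) v).
    by rewrite subrr.
  apply: is_derive_eq (is_derive1_comp _ _) _; last by rewrite subr0 mulr1.
by apply/funext => t /=; rewrite subrKC.
Qed.

(** If the second derivative along some [v] were positive, the first one, which
    vanishes at [x0], would be positive on a short interval to its right, and
    the mean value theorem would contradict maximality. *)
Lemma line2_max f g H x0 : line2 f g H -> (forall x, f x <= f x0) ->
  g x0 = 0 /\ forall v, quad (H x0) v <= 0.
Proof.
move=> l2 mx.
have d1 v : dotv (g x0) v = 0.
  have h := line2_fst l2 x0 v.
  have [_ <-] := h.
  suff [_ ->] : is_derive (0:R) 1 (fun r => f (x0 + r *: v)) 0 by [].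
  apply: (@derive1_at_max _ _ (-1) 1); first by lra.
  - by move=> t _; case: (line2_line x0 v t l2).
  - by rewrite in_itv/= ltrN10 ltr01.
  - by move=> t _; rewrite scale0r addr0.
split; first by apply: dotv_inj => v; rewrite d1 dotv0l.
move=> v; rewrite leNgt; apply/negP => q0.
pose m1 (r : R) := dotv (g (x0 + r *: v)) v.
have [dm em] := line2_snd l2 x0 v.
have : h^-1 *: (m1 (h *: 1 + 0) - m1 0) @[h --> (0:R)^'] --> quad (H x0) v.
  by rewrite -em; exact: dm.
move=> /cvgrPdist_lt /(_ _ q0).
rewrite /dnbhs /= /within /= => /nbhs_ballP[e /= e0 He].
have m1_gt0 r : 0 < r -> r < e -> 0 < m1 r.
  move=> r0 re.
  have := He r; rewrite /ball /= sub0r normrN gtr0_norm// => /(_ re).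
  move=> /(_ (lt0r_neq0 r0)); rewrite [_%:A]mulr1 addr0 {2}/m1 scale0r addr0 d1 subr0.
  rewrite ltr_distlC subrr => /andP[+ _]; rewrite [_ *: _]mulrC pmulr_lgt0//.
  by rewrite invr_gt0.
have e2 : 0 < e / 2 by rewrite divr_gt0.
have [r /andP[r0 re] E] := @MVT _ (fun t => f (x0 + t *: v)) m1 0 (e / 2) e2
   (fun r _ => line2_line x0 v r l2)
   (continuous_subspaceT (fun r => differentiable_continuous
      ((derivable1_diffP _ _).1 (@ex_derive _ _ _ _ _ _ _ (line2_line x0 v r l2))))).
have := mx (x0 + (e / 2) *: v).
rewrite -subr_le0; move: E; rewrite scale0r addr0 => ->; rewrite subr0.
apply/negP; rewrite -ltNge mulr_gt0// m1_gt0//.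
by apply: lt_trans re _; rewrite ltr_pdivrMr// ltr_pMr// ltr1n.
Qed.

End SecondOrder.

(** * Regularity of the solutions and of the coefficients *)

Section Coefficients.
Variables (R : realType) (d : nat).
Local Notation V := 'rV[R]_d.

Lemma continuous_on_comp (T : topologicalType) (J : set R) (w : R -> V -> R)
    (h : T -> R * V) :
  continuous_on J w -> continuous h -> (forall y, J (h y).1) ->
  continuous (fun y => w (h y).1 (h y).2).
Proof.
move=> /subspace_continuousP cw ch hJ y A /= nA.
have /cw : (J `*` setT) (h y) by split.
move=> /(_ A nA); rewrite nbhs_filterE /= /within /= => H.
have := ch y _ H; rewrite nbhs_filterE /=; apply: filterS => z /=.
by apply; split => //; exact: hJ.
Qed.

Lemma continuous_on_slice (J : set R) (w : R -> V -> R) t :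
  continuous_on J w -> J t -> continuous (w t).
Proof.
move=> cw Jt; apply: (@continuous_on_comp _ J w (fun x => (t, x))) => //.
by move=> x; exact: cvg_pair (@cst_continuous _ _ t x) (@cvg_id _ (nbhs x)).
Qed.

Lemma C2_line2 (f : V -> R) : derivable_x f ->
  (forall i, derivable_x (Dx i f)) -> (forall i, continuous (Dx i f)) ->
  (forall i j, continuous (Dxx i j f)) -> line2 f (grad f) (hess f).
Proof.
move=> d1 d2 c1 c2; split=> x v.
  by apply: line_derivative => // i; exact: c1.
have h j : is_derive (0 : R) 1 (fun r => v 0 j * Dx j f (x + r *: v))
    (v 0 j * dotv (grad (Dx j f) x) v).
  apply: is_deriveZ; apply: line_derivative; first exact: d2.
  by move=> i; exact: c2.
have E : (fun r : R => dotv (grad f (x + r *: v)) v) =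
    \sum_(j < d) (fun r => v 0 j * Dx j f (x + r *: v)).
  apply/funext => r; rewrite fct_sumE; apply: eq_bigr => j _.
  by rewrite mxE mulrC.
rewrite E; have hs := is_derive_sum h; apply: is_derive_eq hs _.
rewrite quad_sum; apply: eq_bigr => j _.
rewrite /dotv mulr_sumr; apply: eq_bigr => i _.
by rewrite !mxE /Dxx; ring.
Qed.

Lemma C12_line2 (J : set R) (u : R -> V -> R) t : C12 J u -> J t ->
  line2 (u t) (grad (u t)) (hess (u t)).
Proof.
move=> [_ d1 d2 _ _ c1 c2] Jt; apply: C2_line2.
- exact: d1.
- by move=> i; exact: d2.
- by move=> i; exact: (continuous_on_slice (c1 i) Jt).
- by move=> i j; exact: (continuous_on_slice (c2 i j) Jt).
Qed.

Lemma quad_bilinear (A : 'M[R]_d) (x e : V) (c : R) : A^T = A ->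
  quad A (x + c *: e) =
  quad A x + 2 * c * dotv (e *m A) x + c ^+ 2 * quad A e.
Proof.
move=> As.
have E (y z : V) : (y *m A *m z^T) 0 0 = dotv (y *m A) z by rewrite dotvE.
have sym (y z : V) : dotv (y *m A) z = dotv (z *m A) y.
  rewrite !dotvE -[in LHS](trmxK (y *m A *m z^T)) mxE !trmx_mul trmxK As mulmxA.
  by [].
rewrite /quad !E mulmxDl -scalemxAl !(dotvDl, dotvDr, dotvZl, dotvZr) (sym x e).
by ring.
Qed.

(** Writing [Q t] as a sum of squares turns the trace of [Q t *m H] into a sum of
    second derivatives along lines. The squares come from Gaussian elimination:
    at each step the rank-one matrix built from the pivot row is subtracted,
    and the remainder stays positive on the remaining coordinates because it is
    the minimum of the form over the pivot direction. *)
Lemma posdef_sum_rank1 (A : 'M[R]_d) : A^T = A ->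
  (forall v, v != 0 -> 0 < quad A v) ->
  exists s : seq V, A = \sum_(v <- s) v^T *m v.
Proof.
move=> As Ap.
(* Induction on the number [n] of remaining coordinates, the last ones. *)
suff H : forall n (B : 'M[R]_d), B^T = B ->
    (forall i j : 'I_d, (i < d - n)%N -> B i j = 0) ->
    (forall v : V, v != 0 -> (forall i : 'I_d, (i < d - n)%N -> v 0 i = 0) ->
       0 < quad B v) ->
    exists s : seq V, B = \sum_(v <- s) v^T *m v.
  apply: (H d A As) => [i j|v v0 _]; last exact: Ap.
  by rewrite subnn.
elim => [|n IHn] B Bs B0 Bp.
  exists [::]; rewrite big_nil; apply/matrixP => i j; rewrite B0 ?mxE//.
  by rewrite subn0.
have [nd|dn] := leqP d n.
  apply: IHn => // [i j|v v0 _]; first by rewrite (eqP nd).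
  apply: Bp => // i; have -> : (d - n.+1 = 0)%N by apply/eqP; rewrite subn_eq0 leqW.
  by [].
have kd : (d - n.+1 < d)%N by rewrite ltn_subrL /= (leq_ltn_trans _ dn).
pose k := Ordinal kd; pose e : V := delta_mx 0 k.
have kn : (d - n = k.+1)%N by rewrite /= subnSK.
have eB : e *m B = row k B by rewrite -rowE.
have qe : quad B e = B k k.
  rewrite /quad eB mxE (bigD1 k)//= big1 ?addr0 => [|j jk]; rewrite !mxE ?eqxx ?mulr1//.
  by rewrite (negbTE jk) mulr0.
have q0 : 0 < B k k.
  rewrite -qe; apply: Bp => [|i ik].
    by apply/eqP => /rowP/(_ k); rewrite !mxE !eqxx /= => /eqP; rewrite oner_eq0.
  rewrite mxE eqxx /=; case: eqP => // ik'; move: ik.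
  by rewrite ik' ltnn.
pose w : V := (Num.sqrt (B k k))^-1 *: row k B.
have sq : (Num.sqrt (B k k))^-1 * (Num.sqrt (B k k))^-1 = (B k k)^-1.
  by rewrite -invfM -expr2 sqr_sqrtr// ltW.
have wwE i j : (w^T *m w) i j = B k i * B k j / B k k.
  rewrite mxE big_ord1 !mxE mulrACA sq mulrC.
  by [].
have Bsym i j : B i j = B j i by rewrite -{1}Bs mxE.
have [s Es] : exists s : seq V, B - w^T *m w = \sum_(v <- s) v^T *m v.
  apply: IHn.
  - by rewrite linearB /= Bs trmx_mul trmxK.
  - move=> i j; rewrite kn ltnS leq_eqVlt => /orP[/eqP/val_inj ->|ik].
      by rewrite mxE [X in _ + X]mxE wwE mulrC mulrA mulVf ?gt_eqF// mul1r subrr.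
    rewrite mxE [X in _ + X]mxE wwE (B0 _ _ ik) (Bsym k i) (B0 _ _ ik).
    by rewrite !mul0r subrr.
  - move=> v v0 vk.
    (* [v + c *: e] minimises the form along the pivot direction [e]. *)
    pose c := - dotv (row k B) v / B k k.
    have E : quad (B - w^T *m w) v = quad B (v + c *: e).
      rewrite quad_bilinear// qe eB quadD quadN quad_rank1 /w dotvZl exprMn.
      rewrite expr2 sq /c; have := q0; move: (dotv _ _) => z; move: (quad B v) => y.
      by move=> ?; field; rewrite gt_eqF.
    rewrite E; apply: Bp => [|i ik].
      apply: contra v0 => /eqP ve; apply/eqP/rowP => i; rewrite mxE.
      have [ik|ki] := ltnP i (d - n)%N; first exact: vk.
      have /rowP/(_ i) := ve; rewrite !mxE eqxx /=.
      have -> : (i == k) = false by apply: contraTF ki => /eqP ->; rewrite kn ltnn.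
      by rewrite mulr0 addr0.
    rewrite !mxE eqxx /= vk; last by rewrite kn ltnW// ltnS ltnW.
    have -> : (i == k) = false by apply: contraTF ik => /eqP ->; rewrite ltnn.
    by rewrite mulr0 addr0.
exists (w :: s); rewrite big_cons -Es addrC subrK; done.
Qed.

Lemma trace_sum_rank1 (s : seq V) (H : 'M[R]_d) :
  \tr ((\sum_(v <- s) v^T *m v) *m H) = \sum_(v <- s) quad H v.
Proof.
rewrite mulmx_suml raddf_sum /=; apply: eq_bigr => v _.
by rewrite -mulmxA mxtrace_mulC /mxtrace big_ord1.
Qed.

Lemma quad_sum_rank1 (s : seq V) (g : V) :
  quad (\sum_(v <- s) v^T *m v) g = \sum_(v <- s) dotv g v ^+ 2.
Proof.
elim: s => [|v s IHs]; first by rewrite !big_nil quad0.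
by rewrite !big_cons quadD IHs quad_rank1 dotvC.
Qed.

Lemma mxapp_quad (A : 'M[R]_d) (v : V) : A^T = A -> dotv (mxapp A v) v = quad A v.
Proof. by move=> As; rewrite /mxapp As dotvE. Qed.

Lemma enorm_ge0 (x : V) : 0 <= enorm x.
Proof. exact: sqrtr_ge0. Qed.

Lemma ler_norm_enorm (x : V) : `|x| <= enorm x.
Proof.
apply: rV_normP => [|i]; first exact: enorm_ge0.
rewrite -sqrtr_sqr ler_sqrt ?dotvv_ge0// /dotv (bigD1 i)//= -expr2 lerDl.
by apply: sumr_ge0 => j _; rewrite -expr2 sqr_ge0.
Qed.

Lemma ler_enorm_norm (x : V) : enorm x <= Num.sqrt d%:R * `|x|.
Proof.
rewrite -[`|x|]normr_id -sqrtr_sqr -sqrtrM ?ler0n// ler_sqrt ?mulr_ge0 ?ler0n ?sqr_ge0//.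
rewrite mulr_natl -[X in _ *+ X]card_ord -sumr_const; apply: ler_sum => i _.
by rewrite -expr2 -real_normK ?num_real// lerXn2r ?nnegrE// ler_rV_norm.
Qed.

Lemma compact_ball (x : V) (r : R) : compact [set y : V | `|y - x| <= r].
Proof.
apply: bounded_closed_compact.
  exists (`|x| + r); split; first exact: num_real.
  move=> M xM y /= yx; apply/ltW; apply: le_lt_trans xM.
  by rewrite -{1}(subrK x y) addrC (le_trans (ler_normD _ _))// lerD2l.
have -> : [set y : V | `|y - x| <= r] = (fun y : V => `|y - x|) @^-1` [set t | t <= r] by [].
apply: closed_comp; last exact: closed_le.
move=> y _; apply: (@continuous_comp _ _ _ (fun y : V => y - x) Num.norm).
  exact: (cvgB (@cvg_id _ (nbhs y)) (@cst_continuous _ _ x y)).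
exact: norm_continuous.
Qed.

(** Gives the continuity of the Jacobian of [b t], hence the differentiability of
    the drift along segments. *)
Lemma parabolic_holder_slice (theta : R) (J : set R) (u : R -> V -> R) t :
  0 < theta -> parabolic_holder_loc theta J u -> J t -> continuous (u t).
Proof.
move=> th0 hu Jt x.
pose K : set (R * V) := [set t] `*` [set y : V | `|y - x| <= 1].
have cK : compact K := compact_setX (@compact_set1 R t) (@compact_ball x 1).
have [|C HC] := hu K cK; first by move=> -[r y] [/= -> _]; split.
have Cx y : `|y - x| <= 1 -> `|u t x - u t y| <= C * enorm (x - y) `^ theta.
  move=> yx; have := HC (t, x) (t, y); rewrite /= subrr normr0 powR0 ?add0r; last first.
    by rewrite mulf_neq0// ?gt_eqF// invr_gt0.
  by apply; split => //=; rewrite subrr normr0 ler01.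
apply: (proj2 (@cvgrPdist_le _ _ _ _ (nbhs_filter x) (u t) (u t x))) => e e0.
pose m := (e / (`|C| + 1)) `^ theta^-1 / (Num.sqrt d%:R + 1).
have C1 : 0 < `|C| + 1 by rewrite ltr_wpDl.
have S1 : 0 < Num.sqrt d%:R + 1 :> R by rewrite ltr_wpDl// sqrtr_ge0.
have m0 : 0 < m by rewrite divr_gt0// powR_gt0// divr_gt0.
have m1 : 0 < Num.min 1 m by rewrite lt_min ltr01.
apply: filterS (nbhsx_ballx x _ m1) => y; rewrite -ball_normE /= lt_min => /andP[xy1 /ltW yxm].
have yx1 : `|y - x| <= 1 by rewrite distrC ltW.
apply: le_trans (Cx y yx1) _.
have P : enorm (x - y) `^ theta <= e / (`|C| + 1).
  have -> : e / (`|C| + 1) = ((e / (`|C| + 1)) `^ theta^-1) `^ theta.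
    by rewrite -powRrM mulVf ?gt_eqF// powRr1// divr_ge0 ?ltW.
  apply: ge0_ler_powR; rewrite ?nnegrE ?enorm_ge0 ?powR_ge0//; first exact: ltW.
  apply: le_trans (ler_enorm_norm _) _.
  apply: (@le_trans _ _ ((Num.sqrt d%:R + 1) * m)); last by rewrite mulrC divfK ?gt_eqF.
  by rewrite ler_pM ?sqrtr_ge0// lerDl.
apply: (@le_trans _ _ (`|C| * (e / (`|C| + 1)))).
  by apply: le_trans (ler_wpM2r (powR_ge0 _ _) (ler_norm C)) _; rewrite ler_wpM2l.
by rewrite mulrCA ler_piMr ?ltW// ltr_pdivrMr// mul1r ltrDl.
Qed.

End Coefficients.

(** * Maximum points *)

Section MaximumPoints.
Variables (R : realType) (d : nat).
Local Notation V := 'rV[R]_d.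

(** The space [X] is kept abstract because the lemma is applied both to points
    and, for the doubled function, to pairs of points. *)
Lemma parabolic_max (X : topologicalType) (F : R -> X -> R) (s T : R)
    (K : set X) : compact K -> continuous (fun z : R * X => F z.1 z.2) ->
  (forall t x, s <= t <= T -> ~ K x -> F t x <= 0) ->
  (exists t x, s <= t <= T /\ 0 < F t x) ->
  exists t0 x0, [/\ s <= t0 <= T, 0 < F t0 x0 &
    forall t x, s <= t <= T -> F t x <= F t0 x0].
Proof.
move=> cK cF out [t1 [x1 [sT1 F1]]].
pose A : set (R * X) := `[s, T]%classic `*` K.
have K1 : K x1 by apply: contrapT => /(out _ _ sT1); rewrite leNgt F1.
have A1 : A (t1, x1) by split; rewrite //= in_itv.
have cA : compact A by apply: compact_setX => //; exact (@segment_compact _ s T).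
have [||[t0 x0] A0 mx] := @compact_EVT_max _ _ (fun z : R * X => F z.1 z.2) A _ cA.
- by exists (t1, x1).
- exact: continuous_subspaceT.
have F10 : F t1 x1 <= F t0 x0 by apply: (mx (t1, x1)); rewrite inE.
exists t0, x0; split.
- by move: A0; rewrite inE => -[/=]; rewrite in_itv.
- exact: lt_le_trans F10.
- move=> t x st; have [Kx|/(out _ _ st)] := pselect (K x).
    by apply: (mx (t, x)); rewrite inE; split; rewrite //= in_itv.
  by move=> h; apply: le_trans h _; apply: le_trans F10; exact: ltW.
Qed.

(** The maximum in time may sit at the final time, hence the one-sided
    conclusion. *)
Lemma left_max_derive (f : R -> R) (s t0 df : R) : s < t0 ->
  is_derive t0 1 f df -> (forall t, s <= t <= t0 -> f t <= f t0) -> 0 <= df.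
Proof.
move=> st [fd fe] mx; rewrite leNgt; apply/negP => df0.
have : h^-1 *: (f (h *: 1 + t0) - f t0) @[h --> (0:R)^'] --> df.
  by rewrite -fe; exact: fd.
move=> /cvgrPdist_lt /(_ (- df)); rewrite oppr_gt0 => /(_ df0).
rewrite /dnbhs /= /within /= => /nbhs_ballP[e /= e0 He].
pose h := Num.min (e / 2) (t0 - s).
have h0 : 0 < h by rewrite lt_min divr_gt0//= subr_gt0.
have he : h < e.
  by rewrite gt_min ltr_pdivrMr// ltr_pMr// ltr1n.
have := He (- h); rewrite /ball /= sub0r opprK gtr0_norm// => /(_ he).
rewrite oppr_eq0 gt_eqF// => /(_ isT); rewrite [_%:A]mulr1.
rewrite ltr_distl opprK gtrDr => /andP[+ _].
rewrite [_ *: _]mulrC invrN mulrN oppr_lt0 pmulr_lgt0 ?invr_gt0// subr_gt0.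
apply/negP; rewrite -leNgt; apply: mx; apply/andP; split.
  by rewrite addrC lerBrDr addrC -lerBrDr; by rewrite ge_min lexx orbT.
by rewrite addrC gerBl ltW.
Qed.

Lemma line2_sqdist (a : V) :
  line2 (fun x => dotv (x - a) (x - a)) (fun x => 2 *: (x - a)) (fun=> 2%:M).
Proof.
split=> x v.
  have -> : (fun r : R => dotv (x + r *: v - a) (x + r *: v - a)) =
      (fun r => dotv (x - a) (x - a) + r * (2 * dotv (x - a) v) + r ^+ 2 * dotv v v).
    apply/funext => r; rewrite addrAC; move: (x - a) => z.
    by rewrite dotvDl !dotvDr !dotvZl !dotvZr (dotvC v); ring.
  by apply: is_derive_eq; rewrite /GRing.scale /= dotvZl; ring.
have -> : (fun r : R => dotv (2 *: (x + r *: v - a)) v) =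
    (fun r => 2 * dotv (x - a) v + r * (2 * dotv v v)).
  by apply/funext => r; rewrite addrAC; move: (x - a) => z; rewrite dotvZl dotvDl dotvZl; ring.
apply: is_derive_eq; rewrite /GRing.scale /= /quad mul_mx_scalar -scalemxAl mxE -dotvE; ring.
Qed.

End MaximumPoints.

(** * The comparison principle *)

Section MaximumPrinciple.
Variables (R : realType) (d : nat).
Local Notation V := 'rV[R]_d.
Variables (I : set R) (Q : R -> 'M[R]_d) (b : R -> V -> V).

(** The gradient and the Hessian are free arguments, so that the operator also
    applies to functions, such as logarithms of solutions, that are known only
    through [line2]. *)
Definition secop (t : R) (x g : V) (H : 'M[R]_d) : R :=
  \tr (Q t *m H) + dotv (b t x) g.

(** Derivatives are carried as data, so that sums, multiples and logarithms of
    solutions are handled without computing partial derivatives. *)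
Record evol (J : set R) (u ut : R -> V -> R) (g : R -> V -> V)
    (H : R -> V -> 'M[R]_d) : Prop := {
  evol_t : forall t x, J t -> is_derive t (1 : R) (u^~ x) (ut t x);
  evol_x : forall t, J t -> line2 (u t) (g t) (H t) }.

(** The consequences of the standing assumptions that the estimates use: the
    negativity of the Jacobian of [b] enters through the monotonicity of [b],
    the Lyapunov condition through the upper bound [a]. *)
Record dissipative_setting (eta0 Lambda a : R) (phi : V -> R) (gphi : V -> V)
    (Hphi : V -> 'M[R]_d) : Prop := {
  ds_eta0 : 0 < eta0;
  ds_Lambda : 0 < Lambda;
  ds_a : 0 < a;
  ds_up : forall s t, I s -> s <= t -> I t;
  ds_Q : forall t, I t -> exists s : seq V, Q t = \sum_(v <- s) v^T *m v;
  ds_ell : forall t v, I t ->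
    eta0 * dotv v v <= quad (Q t) v <= Lambda * dotv v v;
  ds_mono : forall t x y, I t -> dotv (b t x - b t y) (x - y) <= 0;
  ds_phi2 : line2 phi gphi Hphi;
  ds_phi_cont : continuous phi;
  ds_phi_gt0 : forall x, 0 < phi x;
  ds_phi_coercive : forall M, exists r, forall x, ~ (`|x - 0| <= r) -> M <= phi x;
  ds_phi_sup : forall t x, I t -> secop t x (gphi x) (Hphi x) <= a }.

Lemma secopD t x g1 g2 H1 H2 :
  secop t x (g1 + g2) (H1 + H2) = secop t x g1 H1 + secop t x g2 H2.
Proof. by rewrite /secop mulmxDr linearD /= dotvDr; ring. Qed.

Lemma secopZ t x c g H : secop t x (c *: g) (c *: H) = c * secop t x g H.
Proof. by rewrite /secop -scalemxAr linearZ /= dotvZr; ring. Qed.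

Variables (eta0 Lambda a : R) (phi : V -> R) (gphi : V -> V)
  (Hphi : V -> 'M[R]_d).
Hypothesis DS : dissipative_setting eta0 Lambda a phi gphi Hphi.

Lemma trace_le t (H1 H2 : 'M[R]_d) : I t ->
  (forall v, quad H1 v <= quad H2 v) -> \tr (Q t *m H1) <= \tr (Q t *m H2).
Proof.
move=> It H12; have [s ->] := ds_Q DS It.
by rewrite !trace_sum_rank1; apply: ler_sum => v _.
Qed.

(** Identifies the term that the chain rule produces when a function is composed
    with the logarithm or the exponential. *)
Lemma trace_rank1 t (g : V) : I t -> \tr (Q t *m (g^T *m g)) = quad (Q t) g.
Proof.
move=> It; have [s ->] := ds_Q DS It.
by rewrite trace_sum_rank1 quad_sum_rank1; apply: eq_bigr => v _; rewrite quad_rank1.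
Qed.

(** Freezing a function at times before [s] makes it continuous on the whole
    space, where compactness can be used directly. *)
Lemma continuous_extend (s : R) (u : R -> V -> R) :
  continuous_on `[s, +oo[ u ->
  continuous (fun z : R * V => u (Num.max s z.1) z.2).
Proof.
move=> cu; apply: (@continuous_on_comp _ _ _ _ _ (fun z => (Num.max s z.1, z.2)) cu).
  move=> z; apply: (@cvg_pair _ _ _ (nbhs z) (nbhs (Num.max s z.1)) (nbhs z.2)).
    apply: (@continuous_max _ _ (cst s) fst z); first exact: cvg_cst.
    exact: cvg_fst.
  exact: cvg_snd.
by move=> z; rewrite /= in_itv /= andbT le_max lexx.
Qed.

(** Subtracting [e * (phi + (a + 1) * (t - s))] makes the subsolution strict, since
    [A phi <= a], and negative outside of a compact set, since [phi] is
    coercive and [u] is bounded above: a positive maximum would then be attained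
    and contradict the equation. The result follows by letting [e] tend to 0. *)
Lemma comparison (s M : R) (u ut : R -> V -> R) (g : R -> V -> V)
    (H : R -> V -> 'M[R]_d) : I s ->
  evol `]s, +oo[ u ut g H -> continuous_on `[s, +oo[ u ->
  (forall t x, s <= t -> u t x <= M) ->
  (forall t x, s < t -> ut t x <= secop t x (g t x) (H t x)) ->
  (forall x, u s x <= 0) -> forall t x, s <= t -> u t x <= 0.
Proof.
move=> Is ev cu uM sub u0 T x1 sT.
suff main (e : R) : 0 < e -> u T x1 <= e * (phi x1 + (a + 1) * (T - s)).
  rewrite leNgt; apply/negP => u_gt0.
  pose c := phi x1 + (a + 1) * (T - s).
  have c0 : 0 < c.
    rewrite ltr_pwDl ?(ds_phi_gt0 DS)// mulr_ge0 ?subr_ge0// ltW// ltr_wpDl// ltW//.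
    exact: ds_a DS.
  have := main (u T x1 / (2 * c)); rewrite divr_gt0 ?mulr_gt0// => /(_ isT).
  rewrite -/c invfM mulrA divfK ?gt_eqF// leNgt => /negP; apply.
  by rewrite ltr_pdivrMr// ltr_pMr// ltr1n.
move=> e0.
pose F t x := u (Num.max s t) x - e * (phi x + (a + 1) * (t - s)).
rewrite -subr_le0 leNgt; apply/negP => F1.
have [r Hr] := ds_phi_coercive DS (M / e).
have [|||t0 [x0 [/andP[st0 t0T] F0 mx]]] :=
    @parabolic_max R V F s T [set y | `|y - 0| <= r] (@compact_ball R d 0 r).
- move=> z; apply: cvgB; first exact: (continuous_extend cu).
  apply: cvgMr; apply: cvgD.
    by apply: (@continuous_comp _ _ _ snd phi); [exact: cvg_snd|exact: (ds_phi_cont DS)].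
  by apply: cvgMr; apply: cvgB; [exact: cvg_fst|exact: cvg_cst].
- move=> t x /andP[st tT] /Hr; rewrite ler_pdivrMr// mulrC => Mphi.
  rewrite subr_le0 max_r//; apply: le_trans (uM _ _ st) _.
  apply: le_trans Mphi _; rewrite ler_pM2l// lerDl mulr_ge0 ?subr_ge0//.
  by rewrite addr_ge0// ltW// (ds_a DS).
- by exists T, x1; rewrite lexx sT /F max_r.
have {}st0 : s < t0.
  rewrite lt_neqAle st0 andbT; apply/eqP => E; move: F0.
  rewrite /F -E max_l// subrr mulr0 addr0; apply/negP; rewrite -leNgt subr_le0.
  by apply: le_trans (u0 _) _; rewrite mulr_ge0 ?ltW// (ds_phi_gt0 DS).
have It0 : I t0 by apply: (ds_up DS Is); exact: ltW.
have Jt0 : `]s, +oo[%classic t0 by rewrite /= in_itv /= st0.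
have l2 := line2D (evol_x ev Jt0)
   (line2D (line2Z (- e) (ds_phi2 DS)) (line2_cst d (- e * ((a + 1) * (t0 - s))))).
have [] := @line2_max _ _ _ _ _ x0 l2.
  move=> x; have := mx t0 x; rewrite /F max_r ?(ltW st0)// t0T => /(_ isT).
  by rewrite -!mulrDr !mulNr.
move=> /= g0 H0.
have ut0 : 0 <= ut t0 x0 - e * (a + 1).
  apply: (@left_max_derive R (fun t => u t x0 - e * (phi x0 + (a + 1) * (t - s))) s t0 _ st0).
    apply: is_deriveB; first exact: (evol_t ev x0 Jt0).
    by apply: is_derive_eq; rewrite /GRing.scale /=; ring.
  move=> t /andP[st tt0]; have := mx t x0; rewrite /F !max_r ?(ltW st0)//; apply.
  by rewrite st (le_trans tt0).
have : ut t0 x0 <= e * a.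
  apply: le_trans (sub _ _ st0) _.
  apply: (@le_trans _ _ (e * secop t0 x0 (gphi x0) (Hphi x0))); last first.
    by rewrite ler_pM2l// (ds_phi_sup DS).
  rewrite -secopZ /secop; apply: lerD.
    apply: trace_le => // v; have := H0 v.
    by rewrite addr0 quadD quadZ quadZ mulNr subr_le0.
  by move/eqP: g0; rewrite addr0 scaleNr subr_eq0 => /eqP ->.
move: ut0; rewrite subr_ge0 => h1 /(le_trans h1).
by rewrite ler_pM2l// gerDl ler10.
Qed.

End MaximumPrinciple.

(** * Doubling of variables *)

Section Doubling.
Variables (R : realType) (d : nat).
Local Notation V := 'rV[R]_d.
Variables (I : set R) (Q : R -> 'M[R]_d) (b : R -> V -> V).
Variables (eta0 Lambda a : R) (phi : V -> R) (gphi : V -> V)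
  (Hphi : V -> 'M[R]_d).
Hypothesis DS : dissipative_setting I Q b eta0 Lambda a phi gphi Hphi.

Lemma continuous_dotvv : continuous (fun z : V * V => dotv (z.1 - z.2) (z.1 - z.2)).
Proof.
pose F (i : 'I_d) (z : V * V) : R := (z.1 - z.2) 0 i * (z.1 - z.2) 0 i.
have cF i : continuous (F i).
  move=> z.
  have h : (fun y : V * V => (y.1 - y.2) 0 i) @ z --> (z.1 - z.2) 0 i.
    apply: (@continuous_comp _ _ _ (fun y : V * V => y.1 - y.2) (fun x : V => x 0 i)).
      by apply: cvgB; [exact: cvg_fst|exact: cvg_snd].
    exact: coord_continuous.
  exact: (cvgM h h).
have addc : continuous (fun x : R * R => x.1 + x.2).
  exact (@pseudometric_normed_Zmodule.add_continuous R R).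
exact (@continuous_big R 'I_d (fun x y : R => x + y) 0 xpredT addc (V * V)%type
  (index_enum 'I_d) F (fun i _ => cF i)).
Qed.

Lemma line2_expR (k m l : R) (f : V -> R) g H : line2 f g H ->
  line2 (fun x => k * expR (m * f x + l))
    (fun x => (k * m * expR (m * f x + l)) *: g x)
    (fun x => (k * m * expR (m * f x + l)) *: H x +
      (k * m ^+ 2 * expR (m * f x + l)) *: ((g x)^T *m g x)).
Proof.
have dF (n r : R) : is_derive r (1 : R) (fun r => n * expR (m * r + l))
    (n * m * expR (m * r + l)).
  apply: is_derive_eq; rewrite /GRing.scale /=; ring.
move=> lf; apply: (@line2_comp _ _ (fun r => k * expR (m * r + l))
  (fun r => k * m * expR (m * r + l)) (fun r => k * m ^+ 2 * expR (m * r + l)) _ _ _ lf) => x.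
by apply: is_derive_eq (dF (k * m) (f x)) _; ring.
Qed.

Variables (s : R) (U Ut : R -> V -> R) (gU : R -> V -> V) (HU : R -> V -> 'M[R]_d).
Variables (W Wt : R -> V -> R) (gW : R -> V -> V) (HW : R -> V -> 'M[R]_d).
Variables (K : set V) (rho al be eta : R).
Hypotheses (Is : I s) (rho0 : 0 < rho) (al0 : 0 <= al) (be0 : 0 < be)
  (al_le : al <= 4 * eta0 * (1 - rho)) (rho1 : rho <= 1).

(** The solution of [c' = - al * c ^ 2] with [c s = be^-1]. *)
Let c t := (al * (t - s) + be)^-1.
Let E t x y := expR (rho * (W t y + c t * dotv (x - y) (x - y)) + eta).

Let den_gt0 t : s <= t -> 0 < al * (t - s) + be.
Proof. by move=> st; rewrite ltr_wpDl// mulr_ge0// subr_ge0. Qed.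

Let c_gt0 t : s <= t -> 0 < c t.
Proof. by move=> st; rewrite invr_gt0 den_gt0. Qed.

Let dc t : s < t -> is_derive t (1 : R) c (- al * c t ^+ 2).
Proof.
move=> st; have dn0 : al * (t - s) + be != 0 by rewrite gt_eqF// den_gt0// ltW.
have h : is_derive t (1 : R) (fun t => al * (t - s) + be) al.
  by apply: is_derive_eq; rewrite /GRing.scale /=; ring.
have h2 := @is_deriveV _ (fun t => al * (t - s) + be) _ _ _ dn0 h.
by apply: is_derive_eq h2 _; rewrite /c /GRing.scale /= exprVn; ring.
Qed.

(** At a positive maximum [(t0, x0, y0)] of [U t x - E t x y] the gradients of
    [U] and [W] are both proportional to [z = x0 - y0], and the second order
    condition in the diagonal directions [(v, v)] compares the Hessians of [U]
    and [W], because [x - y] does not vary along them. In the equations, the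
    drifts then contribute [dotv (b t x0 - b t y0) z <= 0], and the time
    derivative [- al * c ^ 2 * |z|^2] of the penalty is compensated by
    [(1 - rho) * quad Q gW >= (1 - rho) * 4 * c ^ 2 * eta0 * |z|^2], which
    contradicts the strict inequality for [U]. *)
Lemma doubling_core :
  evol `]s, +oo[ U Ut gU HU -> evol `]s, +oo[ W Wt gW HW ->
  continuous_on `[s, +oo[ U -> continuous_on `[s, +oo[ W ->
  (forall t x, s < t -> Ut t x < secop Q b t x (gU t x) (HU t x)) ->
  (forall t x, s < t ->
     secop Q b t x (gW t x) (HW t x) + quad (Q t) (gW t x) <= Wt t x) ->
  compact K ->
  (forall t x, s <= t -> ~ K x -> U t x <= 0) ->
  (forall t x y, s <= t -> ~ K y -> U t x <= expR (rho * W t y + eta)) ->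
  (forall x y, U s x <= E s x y) ->
  forall t x y, s <= t -> U t x <= E t x y.
Proof.
move=> eU eW cU cW subU supW cK outx outy init T x1 y1 sT.
pose F t (z : V * V) := U (Num.max s t) z.1 - E (Num.max s t) z.1 z.2.
rewrite -subr_le0 leNgt; apply/negP => F1.
have [|||t0 [[x0 y0] [/andP[st0 t0T] F0 mx]]] :=
    @parabolic_max R (V * V)%type F s T (K `*` K) (compact_setX cK cK).
- have f1 (z : R * (V * V)) : (fun y : R * (V * V) => y.1) @ z --> z.1 by exact: cvg_fst.
  have f2 (z : R * (V * V)) : (fun y : R * (V * V) => y.2) @ z --> z.2 by exact: cvg_snd.
  have f21 (z : R * (V * V)) : (fun y : R * (V * V) => y.2.1) @ z --> z.2.1.
    by apply: (@continuous_comp _ _ _ (fun y : R * (V * V) => y.2) fst); [exact: f2|exact: cvg_fst].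
  have f22 (z : R * (V * V)) : (fun y : R * (V * V) => y.2.2) @ z --> z.2.2.
    by apply: (@continuous_comp _ _ _ (fun y : R * (V * V) => y.2) snd); [exact: f2|exact: cvg_snd].
  have fx : continuous (fun z : R * (V * V) => (z.1, z.2.1)).
    by move=> z; exact: cvg_pair (f1 z) (f21 z).
  have fy : continuous (fun z : R * (V * V) => (z.1, z.2.2)).
    by move=> z; exact: cvg_pair (f1 z) (f22 z).
  have cU' : continuous (fun z : R * (V * V) => U (Num.max s z.1) z.2.1).
    move=> z; apply: (@continuous_comp _ _ _ _ (fun z : R * V => U (Num.max s z.1) z.2) z (fx z)).
    exact: (continuous_extend cU).
  have cW' : continuous (fun z : R * (V * V) => W (Num.max s z.1) z.2.2).
    move=> z; apply: (@continuous_comp _ _ _ _ (fun z : R * V => W (Num.max s z.1) z.2) z (fy z)).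
    exact: (continuous_extend cW).
  have cm : continuous (fun z : R * (V * V) => Num.max s z.1).
    move=> z; apply: (@continuous_max _ _ (cst s) fst z); first exact: cvg_cst.
    exact: cvg_fst.
  have cc : continuous (fun z : R * (V * V) => c (Num.max s z.1)).
    move=> z; apply: cvgV; first by rewrite gt_eqF// den_gt0// le_max lexx.
    apply: cvgD; last exact: cvg_cst.
    apply: cvgMr; apply: cvgB; last exact: cvg_cst.
    exact: cm.
  have cd : continuous (fun z : R * (V * V) => dotv (z.2.1 - z.2.2) (z.2.1 - z.2.2)).
    move=> z; apply: (@continuous_comp _ _ _ snd (fun z : V * V => dotv (z.1 - z.2) (z.1 - z.2))).
      exact: cvg_snd.
    exact: continuous_dotvv.
  have cE : continuous (fun z : R * (V * V) => E (Num.max s z.1) z.2.1 z.2.2).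
    move=> z; apply: (@continuous_comp _ _ _ (fun z : R * (V * V) =>
        rho * (W (Num.max s z.1) z.2.2 +
          c (Num.max s z.1) * dotv (z.2.1 - z.2.2) (z.2.1 - z.2.2)) + eta) (@expR R)).
      apply: cvgD; last exact: cvg_cst.
      apply: cvgMr; apply: cvgD; first exact: cW'.
      by apply: cvgM; [exact: cc|exact: cd].
    exact: continuous_expR.
  by move=> z; exact: (cvgB (cU' z) (cE z)).
- move=> t [x y] /andP[st tT] nK; rewrite /F max_r//= subr_le0.
  have [Kx|Kx] := pselect (K x); last first.
    by apply: le_trans (outx _ _ st Kx) _; exact: expR_ge0.
  have [Ky|Ky] := pselect (K y); first by case: nK.
  apply: le_trans (outy _ x _ st Ky) _; rewrite ler_expR lerD2r ler_pM2l// lerDl.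
  by rewrite mulr_ge0 ?dotvv_ge0// ltW// c_gt0.
- by exists T, (x1, y1); rewrite lexx sT /F max_r.
have {}st0 : s < t0.
  rewrite lt_neqAle st0 andbT; apply/eqP => e; move: F0.
  by rewrite /F -e max_l//= subr_gt0; apply/negP; rewrite -leNgt.
have It0 : I t0 by apply: (ds_up DS Is); exact: ltW.
have Jt0 : `]s, +oo[%classic t0 by rewrite /= in_itv /= st0.
have mx0 x y : U t0 x - E t0 x y <= U t0 x0 - E t0 x0 y0.
  have := mx t0 (x, y); rewrite /F /= max_r ?(ltW st0)//; apply.
  by rewrite t0T.
have lU := evol_x eU Jt0; have lW := evol_x eW Jt0.
set E0 := E t0 x0 y0 in mx0; have E0_gt0 : 0 < E0 by exact: expR_gt0.
set z := x0 - y0; set c0 := c t0.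
have c0_gt0 : 0 < c0 by apply: c_gt0; exact: ltW.
(* [x0] maximises [x |-> U t0 x - E t0 x y0]. *)
have gx : gU t0 x0 = (2 * rho * c0 * E0) *: z.
  pose k := rho * W t0 y0 + eta.
  have := line2D lU (line2_expR (-1) (rho * c0) k (line2_sqdist y0)).
  move=> /(@line2_max _ _ _ _ _ x0)[|+ _] /=.
    move=> x; rewrite !mulN1r.
    have Ee y : E t0 y y0 = expR (rho * c0 * dotv (y - y0) (y - y0) + k).
      by rewrite /E /k -/c0; congr expR; ring.
    by rewrite -!Ee; exact: mx0.
  move=> /eqP; rewrite addr_eq0 => /eqP ->; rewrite scalerA -scaleNr.
  congr (_ *: _); rewrite /E0 /E -/c0 -/z /k.
  have -> : rho * (W t0 y0 + c0 * dotv z z) + eta = rho * c0 * dotv z z + (rho * W t0 y0 + eta) by ring.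
  ring.
(* [y0] minimises [y |-> E t0 x0 y]. *)
have gy : gW t0 y0 = (2 * c0) *: z.
  have := line2_expR (-1) rho eta (line2D lW (line2Z c0 (line2_sqdist x0))).
  have Ee y : E t0 x0 y = expR (rho * (W t0 y + c0 * dotv (y - x0) (y - x0)) + eta).
    by rewrite -(opprB x0 y) dotvNl dotvNr opprK.
  move=> /(@line2_max _ _ _ _ _ y0)[|+ _] /=.
    by move=> y; rewrite !mulN1r -!Ee lerN2; have := mx0 x0 y; rewrite lerD2l lerN2.
  move=> /eqP; rewrite scaler_eq0 => /orP[|].
    by rewrite mulN1r mulNr oppr_eq0 mulf_eq0 !gt_eqF ?expR_gt0.
  rewrite scalerA addr_eq0 => /eqP ->.
  by rewrite -scalerN opprB mulrC.
(* The function [U t0 (x0 + v) - E t0 (x0 + v) (y0 + v)] is maximal at [v = 0],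
   and the distance between the two points does not depend on [v]. *)
have h2 v : quad (HU t0 x0) v <= E0 * (rho * quad (HW t0 y0) v + rho ^+ 2 * dotv (gW t0 y0) v ^+ 2).
  pose k := rho * c0 * dotv z z + eta.
  have := line2D (line2_translate x0 lU) (line2_expR (-1) rho k (line2_translate y0 lW)).
  move=> /(@line2_max _ _ _ _ _ 0)[|_ /(_ v)] /=.
    move=> x; rewrite !mulN1r.
    have Ee : expR (rho * W t0 (y0 + x) + k) = E t0 (x0 + x) (y0 + x).
      rewrite /E -/c0 opprD addrACA subrr addr0 -/z /k; congr expR; ring.
    have Ee0 : expR (rho * W t0 (y0 + 0) + k) = E0.
      by rewrite addr0 /E0 /E -/c0 -/z /k; congr expR; ring.
    by rewrite Ee Ee0 addr0; exact: mx0.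
  rewrite !addr0 !quadD !quadZ quad_rank1.
  have -> : expR (rho * W t0 y0 + k) = E0.
    by rewrite /E0 /E -/c0 -/z /k; congr expR; ring.
  by move=> h; rewrite -subr_le0; apply: le_trans h; rewrite le_eqVlt; apply/orP; left; apply/eqP; ring.
(* Maximality in time; the term in [al] is the derivative of [c]. *)
have ht : E0 * rho * (Wt t0 y0 - al * c0 ^+ 2 * dotv z z) <= Ut t0 x0.
  rewrite -subr_ge0.
  apply: (@left_max_derive R (fun t => U t x0 - E t x0 y0) s t0 _ st0).
    apply: is_deriveB; first exact: (evol_t eU x0 Jt0).
    have dW := evol_t eW y0 Jt0; have dct := dc st0.
    rewrite /E -/z.
    have dI : is_derive t0 (1 : R) (fun t => rho * (W t y0 + c t * dotv z z) + eta)
      (rho * (Wt t0 y0 - al * c0 ^+ 2 * dotv z z)).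
      apply: is_derive_eq; rewrite /GRing.scale /= -/c0; ring.
    have h2' := @is_derive1_comp _ (@expR R) (fun t => rho * (W t y0 + c t * dotv z z) + eta) _ _ _ (is_derive_expR _) dI.
    by apply: is_derive_eq h2' _; rewrite /E0 /E -/c0 -/z; ring.
  move=> t /andP[st tt0]; have := mx t (x0, y0); rewrite /F /= !max_r ?(ltW st0)//; apply.
  by rewrite st (le_trans tt0).
have trU : \tr (Q t0 *m HU t0 x0) <=
    E0 * (rho * \tr (Q t0 *m HW t0 y0) + rho ^+ 2 * quad (Q t0) (gW t0 y0)).
  have -> : E0 * (rho * \tr (Q t0 *m HW t0 y0) + rho ^+ 2 * quad (Q t0) (gW t0 y0)) =
      \tr (Q t0 *m (E0 *: (rho *: HW t0 y0 + rho ^+ 2 *: ((gW t0 y0)^T *m gW t0 y0)))).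
    by rewrite -scalemxAr linearZ /= mulmxDr -!scalemxAr linearD /= !linearZ /= (trace_rank1 DS).
  apply: (trace_le DS) => // v.
  by rewrite quadZ quadD !quadZ quad_rank1.
have := subU t0 x0 st0; rewrite /secop gx dotvZr => hU.
have := supW t0 y0 st0; rewrite /secop {1}gy dotvZr => hW.
have qz : 4 * c0 ^+ 2 * (eta0 * dotv z z) <= quad (Q t0) (gW t0 y0).
  have /andP[+ _] := ds_ell DS (gW t0 y0) It0.
  by apply: le_trans; rewrite gy dotvZl dotvZr; rewrite le_eqVlt; apply/orP; left; apply/eqP; ring.
have mono := ds_mono DS x0 y0 It0; rewrite -/z dotvDl dotvNl in mono.
move: hU hW qz trU ht mono.
move: (quad (Q t0) _) (\tr (Q t0 *m HU _ _)) (\tr (Q t0 *m HW _ _)) (Wt t0 y0) (Ut t0 x0) => q tu tw wt ut.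
have zz0 : 0 <= dotv z z by exact: dotvv_ge0.
move: (dotv (b _ x0) z) (dotv (b _ y0) z) (dotv z z) zz0 => bx byy zz zz0 hU hW qz trU ht mono.
have h1 : E0 * rho * (tw + 2 * c0 * byy + q - al * c0 ^+ 2 * zz) <= ut.
  by apply: le_trans ht; rewrite ler_pM2l ?mulr_gt0// lerB.
have h3 : E0 * rho * (tw + 2 * c0 * byy + q - al * c0 ^+ 2 * zz) <
   E0 * rho * (tw + rho * q + 2 * c0 * bx).
  apply: le_lt_trans h1 _; apply: lt_le_trans hU _.
  apply: le_trans (lerD trU (lexx _)) _; rewrite le_eqVlt; apply/orP; left; apply/eqP; ring.
move: h3; rewrite ltr_pM2l ?mulr_gt0//.
have h4 : 2 * c0 * (bx - byy) <= 0 by rewrite mulr_ge0_le0// mulr_ge0// ltW.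
have h5 : (1 - rho) * (4 * c0 ^+ 2 * (eta0 * zz)) <= (1 - rho) * q.
  by rewrite ler_wpM2l// subr_ge0.
have h6 : al * (c0 ^+ 2 * zz) <= 4 * eta0 * (1 - rho) * (c0 ^+ 2 * zz).
  by rewrite ler_wpM2r// mulr_ge0// sqr_ge0.
lra.
Qed.

End Doubling.

(** * Closure properties of parabolic data *)

Section Solutions.
Variables (R : realType) (d : nat).
Local Notation V := 'rV[R]_d.

(** The second point ranges over the whole space, which uniform continuity on
    [K] alone would not allow. *)
Lemma uniform_continuity_compact (K : set V) (h : V -> R) (e : R) :
  compact K -> continuous h -> 0 < e ->
  exists2 del, 0 < del & forall x y, K x -> `|x - y| < del -> `|h x - h y| <= e.
Proof.
move=> cK ch e0.
pose P (r : R) (x : V) := forall y, `|x - y| < r -> `|h x - h y| <= e.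
have H : forall x, K x -> \forall x' \near x & i \near (0:R)^'+, P i x'.
  move=> x _.
  have e20 : 0 < e / 2 by rewrite divr_gt0.
  have [r /= r0 Hr] : exists2 r, 0 < r & forall y, `|x - y| < r -> `|h x - h y| <= e / 2.
    have := (@cvgrPdist_le _ _ _ _ (nbhs_filter x) h (h x)).1 (ch x) _ e20.
    by move=> /nbhs_ballP[r /= r0 Hr]; exists r => // y xy; apply: Hr; rewrite -ball_normE.
  have r20 : 0 < r / 2 by rewrite divr_gt0.
  exists ([set x' | `|x - x'| < r / 2], [set i : R | i < r / 2]).
    split; first by apply/nbhs_ballP; exists (r / 2) => //= y; rewrite -ball_normE.
    exact: nbhs_right_lt.
  move=> [x' i] [] /= xx' ir y x'y.
  have -> : h x' - h y = (h x - h y) - (h x - h x') by ring.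
  apply: le_trans (ler_normB _ _) _; rewrite [leRHS]splitr; apply: lerD; apply: Hr.
    have -> : x - y = (x - x') + (x' - y) by rewrite addrA subrK.
    apply: le_lt_trans (ler_normD _ _) _; rewrite [ltRHS]splitr ltrD//.
    exact: lt_trans x'y ir.
  by apply: lt_trans xx' _; rewrite ltr_pdivrMr// ltr_pMr// ltr1n.
have FF : Filter (0 : R)^'+ by exact: at_right_proper_filter.
have := (compact_near_coveringP K).1 cK R (0 : R)^'+ P FF H.
move=> /nbhs_ballP[r /= r0 Hr].
exists (r / 2) => [|x y Kx]; first by rewrite divr_gt0.
apply: (Hr (r / 2)) => //=; last by rewrite divr_gt0.
rewrite /ball /= sub0r normrN gtr0_norm ?divr_gt0//.
by rewrite ltr_pdivrMr// ltr_pMr// ltr1n.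
Qed.

Lemma line2_ln f g (H : V -> 'M[R]_d) : line2 f g H -> (forall x, 0 < f x) ->
  line2 (fun x => ln (f x)) (fun x => (f x)^-1 *: g x)
    (fun x => (f x)^-1 *: H x + (- (f x) ^- 2) *: ((g x)^T *m g x)).
Proof.
move=> lf f0.
apply: (@line2_comp _ _ (@ln R) (fun r => r^-1) (fun r => - r ^- 2) _ _ _ lf) => x.
  exact: is_derive1_ln.
have dV := @is_deriveV _ id (f x) 1 1 (lt0r_neq0 (f0 x)) (is_derive_id _ _).
by apply: is_derive_eq dV _; rewrite /GRing.scale /= mulr1.
Qed.

(** The Lipschitz inequality is tested along the gradient itself. *)
Lemma line2_lip f g (H : V -> 'M[R]_d) (L : R) : line2 f g H -> 0 <= L ->
  (forall x y, f x - f y <= L * enorm (x - y)) ->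
  forall x, dotv (g x) (g x) <= L ^+ 2.
Proof.
move=> lf L0 lip x.
have : 0 <= - (dotv (g x) (g x) - L * enorm (g x)).
  apply: (@left_max_derive R (fun r => - (f (x + r *: g x) - L * enorm (g x) * r)) (-1) 0); first by lra.
    have d1 := line2_fst lf x (g x).
    have d2 : is_derive (0 : R) 1 (fun r : R => L * enorm (g x) * r) (L * enorm (g x)).
      by apply: is_derive_eq; rewrite /GRing.scale /=; ring.
    exact: (is_deriveN (is_deriveB d1 d2)).
  move=> r /andP[_ r0]; rewrite scale0r addr0 mulr0 subr0 lerN2.
  have := lip x (x + r *: g x).
  have -> : enorm (x - (x + r *: g x)) = - r * enorm (g x).
    rewrite opprD addNKr /enorm -scaleNr dotvZl dotvZr mulrA -expr2.
    by rewrite sqrtrM ?sqr_ge0// sqrtr_sqr ger0_norm// oppr_ge0.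
  lra.
rewrite oppr_ge0 -enorm_sqr => h.
have [g0|g0] := eqVneq (enorm (g x)) 0; first by rewrite g0 expr0n sqr_ge0.
have gp : 0 < enorm (g x) by rewrite lt_neqAle eq_sym g0 enorm_ge0.
by rewrite lerXn2r ?nnegrE ?enorm_ge0//; move: h; rewrite subr_le0 expr2 ler_pM2r.
Qed.

Lemma continuous_onD (J : set R) (u w : R -> V -> R) : continuous_on J u ->
  continuous_on J w -> continuous_on J (fun t x => u t x + w t x).
Proof. by move=> cu cw; exact: within_continuousD. Qed.

Lemma continuous_onZ (J : set R) (c : R) (u : R -> V -> R) : continuous_on J u ->
  continuous_on J (fun t x => c * u t x).
Proof. by move=> cu z; apply: cvgMr; exact: cu. Qed.

Lemma continuous_on_ln (J : set R) (u : R -> V -> R) : continuous_on J u ->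
  (forall t x, J t -> 0 < u t x) -> continuous_on J (fun t x => ln (u t x)).
Proof.
move=> /subspace_continuousP cu u0; apply/subspace_continuousP => -[t x] Jt.
apply: (cvg_comp _ _ (cu _ Jt)); apply: continuous_ln; apply: u0.
by case: Jt.
Qed.

Lemma continuous_on_T (J : set R) (u : R -> V -> R) :
  continuous (fun z : R * V => u z.1 z.2) -> continuous_on J u.
Proof. exact: continuous_subspaceT. Qed.

Lemma evolD (J : set R) u ut g (H : R -> V -> 'M[R]_d) u' ut' g' H' :
  evol J u ut g H -> evol J u' ut' g' H' ->
  evol J (fun t x => u t x + u' t x) (fun t x => ut t x + ut' t x)
    (fun t x => g t x + g' t x) (fun t x => H t x + H' t x).
Proof.
move=> [a b] [a' b']; split=> [t x Jt|t Jt].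
  exact: (is_deriveD (a t x Jt) (a' t x Jt)).
exact: (line2D (b t Jt) (b' t Jt)).
Qed.

Lemma evolZ (J : set R) (c : R) u ut g (H : R -> V -> 'M[R]_d) :
  evol J u ut g H ->
  evol J (fun t x => c * u t x) (fun t x => c * ut t x)
    (fun t x => c *: g t x) (fun t x => c *: H t x).
Proof.
move=> [a b]; split=> [t x Jt|t Jt].
  exact: (is_deriveZ c (a t x Jt)).
exact: (line2Z c (b t Jt)).
Qed.

Lemma evol_affine (J : set R) (p : V -> R) (gp : V -> V) Hp (c k s : R) :
  line2 p gp Hp ->
  evol J (fun t x => p x + (c * (t - s) + k)) (fun t x => c) (fun t x => gp x)
    (fun t x => Hp x).
Proof.
move=> lp; split=> [t x _|t _].
  by apply: is_derive_eq; rewrite /GRing.scale /=; ring.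
have Eg : (fun x => gp x) = (fun x => gp x + 0) by apply/funext => x; rewrite addr0.
have EH : (fun x => Hp x) = (fun x => Hp x + 0) by apply/funext => x; rewrite addr0.
by rewrite Eg EH; exact: (line2D lp (line2_cst d (c * (t - s) + k))).
Qed.

Lemma evol_ln (J : set R) u ut g (H : R -> V -> 'M[R]_d) : evol J u ut g H ->
  (forall t x, J t -> 0 < u t x) ->
  evol J (fun t x => ln (u t x)) (fun t x => (u t x)^-1 * ut t x)
   (fun t x => (u t x)^-1 *: g t x)
   (fun t x => (u t x)^-1 *: H t x + (- (u t x) ^- 2) *: ((g t x)^T *m g t x)).
Proof.
move=> [a b] u0; split=> [t x Jt|t Jt].
  exact: (@is_derive1_comp _ (@ln R) (u^~ x) _ _ _ (is_derive1_ln (u0 t x Jt)) (a t x Jt)).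
by apply: line2_ln; [exact: b|move=> x; exact: u0].
Qed.

End Solutions.

(** * Order properties of the evolution operator *)

Section Estimates.
Variables (R : realType) (d : nat).
Local Notation V := 'rV[R]_d.
Variables (I : set R) (Q : R -> 'M[R]_d) (b : R -> V -> V).
Variables (eta0 Lambda a : R) (phi : V -> R) (gphi : V -> V)
  (Hphi : V -> 'M[R]_d).
Hypothesis DS : dissipative_setting I Q b eta0 Lambda a phi gphi Hphi.
Variables (theta : R) (G : R -> R -> (V -> R) -> V -> R).
Hypothesis G_evol : evolution_operator I Q b theta G.

Lemma sol_evol s f : I s -> Cb f ->
  evol `]s, +oo[ (fun t => G t s f) (Dt (fun t => G t s f))
    (fun t => grad (G t s f)) (fun t => hess (G t s f)).
Proof.
move=> Is Cf; have [[_ _ c12 _ _] _] := G_evol Is Cf; split=> [t x Jt|t Jt].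
  apply: DeriveDef; first exact: (C12_derivable_t c12).
  by rewrite /Dt derive1E.
exact: (C12_line2 c12 Jt).
Qed.

Lemma sol_cont s f : I s -> Cb f -> continuous_on `[s, +oo[ (fun t => G t s f).
Proof. by move=> Is Cf; have [[]] := G_evol Is Cf. Qed.

Lemma sol_bounded s f : I s -> Cb f ->
  exists M, forall t x, s <= t -> `|G t s f x| <= M.
Proof. by move=> Is Cf; have [[]] := G_evol Is Cf. Qed.

Lemma sol_eq s f t x : I s -> Cb f -> s < t ->
  Dt (fun t => G t s f) t x = secop Q b t x (grad (G t s f) x) (hess (G t s f) x).
Proof. by move=> Is Cf st; have [[_ _ _ e _] _] := G_evol Is Cf; exact: e. Qed.

Lemma sol_init s f : I s -> Cb f -> G s s f = f.
Proof. by move=> Is Cf; have [[_ _ _ _ e] _] := G_evol Is Cf; exact: e. Qed.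

Lemma sol_continuous s t f : I s -> Cb f -> s <= t -> continuous (G t s f).
Proof.
move=> Is Cf st; apply: (continuous_on_slice (sol_cont Is Cf)).
by rewrite /= in_itv/= andbT.
Qed.

Lemma sol_Cb s t f : I s -> Cb f -> s <= t -> Cb (G t s f).
Proof.
move=> Is Cf st; split; first exact: sol_continuous.
by have [M HM] := sol_bounded Is Cf; exists M => x; exact: HM.
Qed.

(** Linearity, positivity and conservation of constants in one statement: each
    is the case of suitable [c1], [c2] and [k]. *)
Lemma G_combo s t f1 f2 h c1 c2 k : I s -> Cb f1 -> Cb f2 -> Cb h ->
  (forall x, c1 * f1 x + c2 * f2 x <= h x + k) -> s <= t ->
  forall x, c1 * G t s f1 x + c2 * G t s f2 x <= G t s h x + k.
Proof.
move=> Is Cf1 Cf2 Ch le st x.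
have [M1 H1] := sol_bounded Is Cf1; have [M2 H2] := sol_bounded Is Cf2.
have [M3 H3] := sol_bounded Is Ch.
have ev := evolD (evolZ c1 (sol_evol Is Cf1)) (evolD (evolZ c2 (sol_evol Is Cf2))
   (evolD (evolZ (-1) (sol_evol Is Ch)) (evol_affine `]s, +oo[%classic 0 (- k) s (line2_cst d 0)))).
suff : c1 * G t s f1 x + (c2 * G t s f2 x + (-1 * G t s h x + (0 + (0 * (t - s) + - k)))) <= 0.
  by lra.
apply: (comparison DS (M := `|c1| * M1 + (`|c2| * M2 + (M3 + `|k|))) Is ev) => //.
- apply: continuous_onD; first exact/continuous_onZ/sol_cont.
  apply: continuous_onD; first exact/continuous_onZ/sol_cont.
  apply: continuous_onD; first exact/continuous_onZ/sol_cont.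
  apply: continuous_on_T => z; apply: cvgD; first exact: cvg_cst.
  apply: cvgD; last exact: cvg_cst.
  by apply: cvgMr; apply: cvgB; [exact: cvg_fst|exact: cvg_cst].
- move=> r y sr; rewrite mul0r !add0r.
  have n1 : c1 * G r s f1 y <= `|c1| * M1.
    by apply: le_trans (ler_norm _) _; rewrite normrM ler_wpM2l// H1.
  have n2 : c2 * G r s f2 y <= `|c2| * M2.
    by apply: le_trans (ler_norm _) _; rewrite normrM ler_wpM2l// H2.
  have n3 : -1 * G r s h y <= M3.
    by rewrite mulN1r; apply: le_trans (ler_norm _) _; rewrite normrN H3.
  have n4 : - k <= `|k| by rewrite -normrN ler_norm.
  by rewrite !lerD.
- move=> r y sr; rewrite (sol_eq _ Is Cf1 sr) (sol_eq _ Is Cf2 sr) (sol_eq _ Is Ch sr).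
  rewrite !secopD 3!secopZ [secop _ _ r y 0 0](_ : _ = 0); first exact: lexx.
  by rewrite /secop mulmx0 linear0 dotv0r addr0.
- move=> y; rewrite !sol_init// subrr mulr0 !add0r; have := le y; lra.
Qed.

Lemma G_mono s t f h k : I s -> Cb f -> Cb h ->
  (forall x, f x <= h x + k) -> s <= t -> forall x, G t s f x <= G t s h x + k.
Proof.
move=> Is Cf Ch le st x.
have := @G_combo s t f f h 1 0 k Is Cf Cf Ch _ st x; rewrite mul1r mul0r addr0.
by apply=> y; rewrite mul1r mul0r addr0.
Qed.

Lemma G_lower s t f m : I s -> Cb f -> (forall x, m <= f x) -> s <= t ->
  forall x, m <= G t s f x.
Proof.
move=> Is Cf le st x.
have := @G_combo s t f f f 0 0 (- m) Is Cf Cf Cf _ st x; rewrite !mul0r addr0 subr_ge0.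
by apply=> y; rewrite !mul0r addr0 subr_ge0.
Qed.

Lemma G_abs s t f : I s -> Cb f -> Cb (fun x => `|f x|) -> s <= t ->
  forall x, `|G t s f x| <= G t s (fun x => `|f x|) x.
Proof.
move=> Is Cf Ca st x; rewrite ler_norml lerNl; apply/andP; split.
  have := @G_combo s t f f _ (-1) 0 0 Is Cf Cf Ca _ st x; rewrite mulN1r mul0r !addr0.
  by apply=> y; rewrite mulN1r mul0r !addr0 -normrN ler_norm.
have := @G_combo s t f f _ 1 0 0 Is Cf Cf Ca _ st x; rewrite mul1r mul0r !addr0.
by apply=> y; rewrite mul1r mul0r !addr0 ler_norm.
Qed.

Lemma Cb_exp (h : V -> R) : Cb h -> Cb (fun x => expR (h x)).
Proof.
move=> [ch [M HM]]; split.
  by move=> x; apply: (@continuous_comp _ _ _ h (@expR R)); [exact: ch|exact: continuous_expR].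
exists (expR M) => x; rewrite ger0_norm ?expR_ge0// ler_expR.
by apply: le_trans (ler_norm _) _.
Qed.

Lemma Cb_affine (h : V -> R) (c k : R) : Cb h -> Cb (fun x => c * h x + k).
Proof.
move=> [ch [M HM]]; split.
  move=> x; apply: (@continuous_comp _ _ _ h (fun r => c * r + k)); first exact: ch.
  by apply: cvgD; [apply: cvgMr; exact: cvg_id|exact: cvg_cst].
exists (`|c| * M + `|k|) => x; apply: le_trans (ler_normD _ _) _.
by rewrite lerD2r normrM ler_wpM2l.
Qed.

Lemma G_exp_lower s (h : V -> R) : I s -> Cb h ->
  exists2 m, 0 < m & forall t x, s <= t -> m <= G t s (fun x => expR (h x)) x.
Proof.
move=> Is Ch; have [ch [M HM]] := Ch.
exists (expR (- M)); first exact: expR_gt0.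
move=> t x st; apply: (G_lower Is (Cb_exp Ch) _ st) => y.
by rewrite ler_expR; have := HM y; rewrite ler_norml => /andP[].
Qed.

Lemma G_exp_gt0 s t (h : V -> R) x : I s -> Cb h -> s <= t ->
  0 < G t s (fun x => expR (h x)) x.
Proof.
by move=> Is Ch st; have [m m0 Hm] := G_exp_lower Is Ch; exact: lt_le_trans m0 (Hm _ _ st).
Qed.

(** The Hopf-Cole transformation: the logarithm of a positive solution solves the
    equation with the extra term [quad (Q t)] of its gradient. *)
Lemma secop_ln t x (u : R) (g : V) (H : 'M[R]_d) : I t -> 0 < u ->
  secop Q b t x (u^-1 *: g) (u^-1 *: H + (- u ^- 2) *: (g^T *m g)) +
  quad (Q t) (u^-1 *: g) = u^-1 * secop Q b t x g H.
Proof.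
move=> It u0; rewrite /secop mulmxDr -!scalemxAr linearD /= !linearZ /=.
rewrite (trace_rank1 DS)// dotvZr.
rewrite [X in _ + X](_ : _ = u ^- 2 * quad (Q t) g); first by ring.
by rewrite /quad linearZ /= -!scalemxAr -!scalemxAl !mxE mulrA -expr2 exprVn.
Qed.

Lemma quad_Q_ge0 t g : I t -> 0 <= quad (Q t) g.
Proof.
move=> It; have /andP[+ _] := ds_ell DS g It; apply: le_trans.
by rewrite mulr_ge0 ?dotvv_ge0// ltW// (ds_eta0 DS).
Qed.

Lemma exp_sol_cont s h : I s -> Cb h ->
  continuous_on `[s, +oo[ (fun t x => ln (G t s (fun x => expR (h x)) x)).
Proof.
move=> Is Ch; apply: continuous_on_ln; first exact: (sol_cont Is (Cb_exp Ch)).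
by move=> t x /=; rewrite in_itv /= andbT => st; exact: G_exp_gt0.
Qed.

Lemma exp_sol_evol s h : I s -> Cb h ->
  let u t := G t s (fun x => expR (h x)) in
  evol `]s, +oo[ (fun t x => ln (u t x)) (fun t x => (u t x)^-1 * Dt u t x)
   (fun t x => (u t x)^-1 *: grad (u t) x)
   (fun t x => (u t x)^-1 *: hess (u t) x +
     (- (u t x) ^- 2) *: ((grad (u t) x)^T *m grad (u t) x)).
Proof.
move=> Is Ch u; apply: evol_ln; first exact: (sol_evol Is (Cb_exp Ch)).
by move=> t x /=; rewrite in_itv /= andbT => st; apply: G_exp_gt0 => //; exact: ltW.
Qed.

Lemma exp_sol_ln_bound s h : I s -> Cb h ->
  exists M, forall t x, s <= t -> `|ln (G t s (fun x => expR (h x)) x)| <= M.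
Proof.
move=> Is Ch; have [m m0 Hm] := G_exp_lower Is Ch.
have [M HM] := sol_bounded Is (Cb_exp Ch).
exists (`|ln m| + `|ln M|) => t x st.
have u0 := G_exp_gt0 x Is Ch st.
have uM : G t s (fun x => expR (h x)) x <= M by apply: le_trans (ler_norm _) (HM _ _ st).
have l1 : ln m <= ln (G t s (fun x => expR (h x)) x) by rewrite ler_ln ?posrE// Hm.
have l2 : ln (G t s (fun x => expR (h x)) x) <= ln M.
  by rewrite ler_ln ?posrE// (lt_le_trans u0).
have l3 := ler_norm (ln M); have l4 := ler_norm (- ln m); rewrite normrN in l4.
have l5 := normr_ge0 (ln M); have l6 := normr_ge0 (ln m).
by rewrite ler_norml; apply/andP; split; lra.
Qed.

(** Jensen's inequality, without any representation of [G t s] by kernels: the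
    extra term in the equation for [ln (G t s e^h)] is nonnegative, so this
    logarithm is a supersolution of the linear equation. A minorant [c * f + k] of
    [h] replaces [h] itself, so that [h] may be an affine image of the function
    [f] of interest. *)
Lemma G_exp_jensen s t (f h : V -> R) (c k : R) : I s -> Cb f -> Cb h ->
  (forall x, c * f x + k <= h x) -> s <= t ->
  forall x, c * G t s f x + k <= ln (G t s (fun x => expR (h x)) x).
Proof.
move=> Is Cf Ch fh st x.
have [M1 H1] := sol_bounded Is Cf; have [M2 H2] := exp_sol_ln_bound Is Ch.
have ev := evolD (evolZ c (sol_evol Is Cf)) (evolD (evolZ (-1) (exp_sol_evol Is Ch))
   (evol_affine `]s, +oo[%classic 0 k s (line2_cst d 0))).
rewrite -subr_le0.
suff : c * G t s f x + (-1 * ln (G t s (fun x => expR (h x)) x) + (0 + (0 * (t - s) + k))) <= 0.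
  by lra.
apply: (comparison DS (M := `|c| * M1 + (M2 + `|k|)) Is ev) => //.
- apply: continuous_onD; first exact/continuous_onZ/sol_cont.
  apply: continuous_onD; first exact/continuous_onZ/exp_sol_cont.
  apply: continuous_on_T => z; apply: cvgD; first exact: cvg_cst.
  apply: cvgD; last exact: cvg_cst.
  by apply: cvgMr; apply: cvgB; [exact: cvg_fst|exact: cvg_cst].
- move=> r y sr; rewrite mul0r !add0r.
  have n1 : c * G r s f y <= `|c| * M1.
    by apply: le_trans (ler_norm _) _; rewrite normrM ler_wpM2l// H1.
  have n3 : -1 * ln (G r s (fun x => expR (h x)) y) <= M2.
    by rewrite mulN1r; apply: le_trans (ler_norm _) _; rewrite normrN H2.
  by rewrite !lerD// ler_norm.
- move=> r y sr.
  have Ir : I r by apply: (ds_up DS Is); exact: ltW.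
  have u0 : 0 < G r s (fun x => expR (h x)) y by apply: G_exp_gt0 => //; exact: ltW.
  rewrite !secopD !secopZ (sol_eq _ Is Cf sr) lerD2l.
  rewrite (sol_eq _ Is (Cb_exp Ch) sr) -(secop_ln y _ _ Ir u0).
  rewrite [secop _ _ r y 0 0](_ : _ = 0) ?addr0; last first.
    by rewrite /secop mulmx0 linear0 dotv0r addr0.
  have := quad_Q_ge0 ((G r s (fun x => expR (h x)) y)^-1 *: grad (G r s (fun x => expR (h x))) y) Ir.
  lra.
- move=> y; rewrite !sol_init//; last exact: Cb_exp.
  by rewrite expRK subrr mulr0 !add0r; have := fh y; lra.
Qed.

End Estimates.

(** * The doubled inequality for solutions *)

Section Harnack.
Variables (R : realType) (d : nat).
Local Notation V := 'rV[R]_d.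
Variables (I : set R) (Q : R -> 'M[R]_d) (b : R -> V -> V).
Variables (eta0 Lambda a : R) (phi : V -> R) (gphi : V -> V)
  (Hphi : V -> 'M[R]_d).
Hypothesis DS : dissipative_setting I Q b eta0 Lambda a phi gphi Hphi.
Variables (theta : R) (G : R -> R -> (V -> R) -> V -> R).
Hypothesis G_evol : evolution_operator I Q b theta G.

(** Removes the penalisation: [e] multiplies the Lyapunov terms on both sides of
    the doubled inequality, and the error allowed in its exponent. *)
Lemma penalty_limit (A p B q C rho eta l : R) : 0 < B ->
  (forall e, 0 < e ->
    A - e * p <= expR (rho * (ln (B + e * q) + C) + eta + e * l)) ->
  A <= expR (rho * (ln B + C) + eta).
Proof.
move=> B0 H.
pose k (e : R) := expR (rho * (ln (B + e * q) + C) + eta + e * l) - (A - e * p).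
have ck : {for 0, continuous k}.
  have cm (r : R) : (fun e : R => e * r) @ (0 : R) --> (0 : R) * r.
    by apply: cvgMl; exact: cvg_id.
  apply: cvgB; last by apply: cvgB; [exact: cvg_cst|exact: cm].
  apply: (@continuous_comp _ _ _ (fun e : R => rho * (ln (B + e * q) + C) + eta + e * l) (@expR R)); last exact: continuous_expR.
  apply: cvgD; last exact: cm.
  apply: cvgD; last exact: cvg_cst.
  apply: cvgMr; apply: cvgD; last exact: cvg_cst.
  apply: (@continuous_comp _ _ _ (fun e : R => B + e * q) (@ln R)).
    by apply: cvgD; [exact: cvg_cst|exact: cm].
  by apply: continuous_ln; rewrite mul0r addr0.
rewrite -subr_ge0; have -> : expR (rho * (ln B + C) + eta) - A = k 0.
  by rewrite /k !mul0r !addr0 subr0.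
rewrite leNgt; apply/negP => k0.
have k0' : 0 < - k 0 by rewrite oppr_gt0.
have /cvgrPdist_lt /(_ _ k0') /nbhs_ballP[r /= r0 Hr] := ck.
have r20 : 0 < r / 2 by rewrite divr_gt0.
have := Hr (r / 2); rewrite /ball /= sub0r normrN gtr0_norm//.
have rr : r / 2 < r by rewrite ltr_pdivrMr// ltr_pMr// ltr1n.
move=> /(_ rr).
rewrite ltr_distlC subrr => /andP[_]; apply/negP; rewrite -leNgt.
by rewrite subr_ge0; exact: H.
Qed.

(** Solutions are only bounded, so the doubled function need not attain its
    supremum. Subtracting [e] times the growing Lyapunov function from the first
    solution and adding it to the second makes the former a strict subsolution
    that is negative far away, and the logarithm of the latter a supersolution
    that is large far away. *)
Lemma doubling_penalized s f1 f2 rho al be eta e : I s -> Cb f1 -> Cb f2 ->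
  (forall y, 0 <= f2 y) -> 0 < e ->
  0 < rho -> 0 <= al -> 0 < be -> al <= 4 * eta0 * (1 - rho) -> rho <= 1 ->
  (forall x y, f1 x - e * phi x <=
    expR (rho * (ln (f2 y + e * phi y) + be^-1 * dotv (x - y) (x - y)) + eta)) ->
  forall t x y, s <= t -> G t s f1 x - e * (phi x + (a + 1) * (t - s)) <=
    expR (rho * (ln (G t s f2 y + e * (phi y + (a + 1) * (t - s))) +
      (al * (t - s) + be)^-1 * dotv (x - y) (x - y)) + eta).
Proof.
move=> Is C1 C2 f20 e0 rho0 al0 be0 alrho rho1 init.
have a0 := ds_a DS; have phi0 := ds_phi_gt0 DS.
have a10 : 0 <= a + 1 by rewrite addr_ge0// ltW.
have [M HM] := sol_bounded G_evol Is C1.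
have pen0 t x : s <= t -> phi x <= phi x + ((a + 1) * (t - s) + 0).
  by move=> st; rewrite addr0 lerDl mulr_ge0// subr_ge0.
have Gf20 t y : s <= t -> 0 <= G t s f2 y by move=> st; exact: (G_lower DS G_evol).
pose v t y := G t s f2 y + e * (phi y + ((a + 1) * (t - s) + 0)).
have v0 t y : s <= t -> 0 < v t y.
  by move=> st; rewrite ltr_wpDl ?Gf20// mulr_gt0// (lt_le_trans (phi0 y))// pen0.
have v_ge t y : s <= t -> e * phi y <= v t y.
  by move=> st; rewrite -[leLHS]add0r lerD ?Gf20// ler_pM2l// pen0.
have cpen : continuous_on `[s, +oo[ (fun t x => phi x + ((a + 1) * (t - s) + 0)).
  apply: continuous_on_T => z; apply: cvgD.
    by apply: (@continuous_comp _ _ _ snd phi); [exact: cvg_snd|exact: (ds_phi_cont DS)].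
  apply: cvgD; last exact: cvg_cst.
  by apply: cvgMr; apply: cvgB; [exact: cvg_fst|exact: cvg_cst].
have epen := evol_affine `]s, +oo[%classic (a + 1) 0 s (ds_phi2 DS).
have eU := evolD (sol_evol G_evol Is C1) (evolZ (- e) epen).
have ev := evolD (sol_evol G_evol Is C2) (evolZ e epen).
have v0' t y : `]s, +oo[%classic t -> 0 < v t y.
  by rewrite /= in_itv /= andbT => st; apply: v0; exact: ltW.
have eW := evol_ln ev v0'.
have cU := continuous_onD (sol_cont G_evol Is C1) (continuous_onZ (c := - e) cpen).
have cv := continuous_onD (sol_cont G_evol Is C2) (continuous_onZ (c := e) cpen).
have cW : continuous_on `[s, +oo[ (fun t x => ln (v t x)).
  apply: continuous_on_ln; first exact: cv.
  by move=> t y; rewrite /= in_itv /= andbT; exact: v0.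
have M1 : 0 < `|M| + 1 by rewrite ltr_wpDl.
(* Beyond radius [r] the penalty dominates [M] in the first variable, and in the
   second one makes the exponential exceed [|M| + 1]. *)
have [r Hr] := ds_phi_coercive DS
   (Num.max (M / e) (expR ((ln (`|M| + 1) - eta) / rho) / e)).
move=> t x y st.
suff : G t s f1 x + - e * (phi x + ((a + 1) * (t - s) + 0)) <=
    expR (rho * (ln (v t y) + (al * (t - s) + be)^-1 * dotv (x - y) (x - y)) + eta).
  by rewrite /v !addr0 mulNr.
have dphi r0 z : s < r0 -> secop Q b r0 z (gphi z) (Hphi z) < a + 1.
  move=> sr; apply: (@le_lt_trans _ _ a); last by rewrite ltrDl.
  by apply: (ds_phi_sup DS); apply: (ds_up DS Is); exact: ltW.
apply: (doubling_core DS Is rho0 al0 be0 alrho rho1 eU eW cU cW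
    (K := [set y | `|y - 0| <= r])) => //.
- move=> r0 z sr; rewrite secopD secopZ (sol_eq G_evol _ Is C1 sr) ltrD2l.
  by rewrite ltr_nM2l ?oppr_lt0// dphi.
- move=> r0 z sr.
  have Ir : I r0 by apply: (ds_up DS Is); exact: ltW.
  have vr := v0 r0 z (ltW sr).
  rewrite (secop_ln DS z _ _ Ir vr) secopD secopZ (sol_eq G_evol _ Is C2 sr).
  by rewrite ler_pM2l ?invr_gt0// lerD2l ler_pM2l// ltW// dphi.
- exact: (@compact_ball R d 0 r).
- move=> r0 z sr /Hr; rewrite ge_max => /andP[+ _]; rewrite ler_pdivrMr// => Mz.
  rewrite mulNr subr_le0; apply: le_trans (ler_norm _) _; apply: le_trans (HM _ _ sr) _.
  by apply: le_trans Mz _; rewrite mulrC ler_pM2l// pen0.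
- move=> r0 z w sr /Hr; rewrite ge_max => /andP[_]; rewrite ler_pdivrMr// [_ * e]mulrC => Mw.
  apply: (@le_trans _ _ (`|M| + 1)).
    apply: (@le_trans _ _ `|M|); last by rewrite lerDl.
    apply: le_trans (_ : G r0 s f1 z <= _).
      rewrite gerDl mulNr oppr_le0 mulr_ge0 ?(ltW e0)//.
      by apply: le_trans (pen0 r0 z sr); exact: ltW.
    by apply: le_trans (ler_norm _) _; apply: le_trans (HM _ _ sr) (ler_norm _).
  have : (ln (`|M| + 1) - eta) / rho <= ln (v r0 w).
    by rewrite -ler_expR [leRHS]lnK ?posrE ?v0//; exact: le_trans Mw (v_ge _ _ sr).
  rewrite ler_pdivrMr// -{2}[`|M| + 1]lnK ?posrE// ler_expR mulrC.
  by rewrite lerBlDr.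
- move=> z w; rewrite /v /= !subrr !mulr0 !addr0 !add0r mulNr.
  by rewrite (sol_init G_evol Is C1) (sol_init G_evol Is C2); exact: init.
Qed.

End Harnack.

(** * Harnack inequality and Lipschitz estimates *)

Section HarnackLipschitz.
Variables (R : realType) (d : nat).
Local Notation V := 'rV[R]_d.
Variables (I : set R) (Q : R -> 'M[R]_d) (b : R -> V -> V).
Variables (eta0 Lambda a : R) (phi : V -> R) (gphi : V -> V)
  (Hphi : V -> 'M[R]_d).
Hypothesis DS : dissipative_setting I Q b eta0 Lambda a phi gphi Hphi.
Variables (theta : R) (G : R -> R -> (V -> R) -> V -> R).
Hypothesis G_evol : evolution_operator I Q b theta G.

(** The initial condition of the doubled inequality. Closer than the modulus of
    continuity of [h] on [K] the error [e] suffices; farther away a small [be]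
    makes the quadratic term exceed the oscillation [2 * M] of [h]. *)
Lemma exp_modulus (K : set V) (h : V -> R) (e rho : R) : compact K -> Cb h ->
  0 < e -> 0 < rho -> exists2 be, 0 < be & forall x y, K x ->
    h x <= h y + rho * (be^-1 * dotv (x - y) (x - y)) + e.
Proof.
move=> cK [ch [M HM]] e0 rho0.
have M0 : 0 <= M by apply: le_trans (normr_ge0 _) (HM 0).
have [del del0 Hdel] := uniform_continuity_compact cK ch e0.
pose be := rho * del ^+ 2 / (2 * M + 1).
have den : 0 < 2 * M + 1 by rewrite ltr_wpDl// mulr_ge0.
have be0 : 0 < be by rewrite divr_gt0// mulr_gt0// exprn_gt0.
exists be => // x y Kx.
have sq0 : 0 <= rho * (be^-1 * dotv (x - y) (x - y)).
  by rewrite mulr_ge0 ?(ltW rho0)// mulr_ge0 ?dotvv_ge0// invr_ge0 ltW.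
have [xy|xy] := ltP `|x - y| del.
  have := Hdel x y Kx xy; rewrite ler_distl => /andP[_].
  by move=> h1; apply: le_trans h1 _; rewrite lerD2r lerDl.
have hM : h x - h y <= 2 * M.
  have := HM x; have := HM y; rewrite !ler_norml => /andP[? ?] /andP[? ?]; lra.
suff : 2 * M + 1 <= rho * (be^-1 * dotv (x - y) (x - y)) by lra.
have -> : 2 * M + 1 = rho * (be^-1 * del ^+ 2).
  by rewrite /be; field; rewrite !gt_eqF// ?exprn_gt0.
rewrite ler_pM2l// ler_pM2l ?invr_gt0// -enorm_sqr lerXn2r ?nnegrE ?enorm_ge0//.
  exact: ltW.
exact: le_trans xy (ler_norm_enorm _).
Qed.

(** Wang's Harnack inequality, in logarithmic form. The exponent [rho = p^-1]
    leaves the largest rate [al = 4 * eta0 * (1 - p^-1)] for the decrease of the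
    penalty. The initial value [be^-1] of the penalty depends on [e] and is
    discarded by monotonicity before [e] tends to 0. *)
Lemma harnack s t (h : V -> R) (p : R) x y : I s -> Cb h -> s < t -> 1 < p ->
  G t s (fun x => expR (h x)) x <=
  expR (p^-1 * (ln (G t s (fun x => expR (p * h x)) y) +
     (4 * eta0 * (1 - p^-1) * (t - s))^-1 * dotv (x - y) (x - y)) + 0).
Proof.
move=> Is Ch st p1.
have p0 : 0 < p by exact: lt_trans p1.
have rho0 : 0 < p^-1 by rewrite invr_gt0.
have rho1 : p^-1 < 1 by rewrite invf_lt1.
have Cph : Cb (fun x => p * h x).
  by have := Cb_affine p 0 Ch; under eq_fun do rewrite addr0.
have al0 : 0 < 4 * eta0 * (1 - p^-1).
  by rewrite mulr_gt0 ?subr_gt0// mulr_gt0// (ds_eta0 DS).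
have phi0 := ds_phi_gt0 DS.
have B0 := G_exp_gt0 DS G_evol y Is Cph (ltW st).
apply: (@penalty_limit _ _ (phi x + (a + 1) * (t - s)) _ (phi y + (a + 1) * (t - s)) _ _ _ 1 B0) => e e0.
rewrite addr0 mulr1.
have [ch [M HM]] := Ch.
have [r Hr] := ds_phi_coercive DS (expR M / e).
have [be be0 Hbe] := exp_modulus (@compact_ball R d 0 r) Ch e0 rho0.
have main := @doubling_penalized _ _ _ _ _ _ _ _ _ _ _ DS _ _ G_evol s
  _ _ p^-1 (4 * eta0 * (1 - p^-1)) be e e Is (Cb_exp Ch) (Cb_exp Cph)
  (fun y => expR_ge0 _) e0 rho0 (ltW al0) be0 (lexx _) (ltW rho1) _ t x y (ltW st).
apply: le_trans (main _) _ => [z w|].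
  have [zr|/Hr] := pselect (`|z - 0| <= r); last first.
    rewrite ler_pdivrMr// mulrC => h1; apply: (@le_trans _ _ 0); last exact: expR_ge0.
    rewrite subr_le0; apply: le_trans h1; rewrite ler_expR.
    exact: le_trans (ler_norm _) (HM _).
  apply: (@le_trans _ _ (expR (h z))).
    by rewrite gerBl mulr_ge0// ltW.
  rewrite ler_expR; apply: le_trans (Hbe z w zr) _.
  rewrite mulrDr lerD2r lerD2r.
  apply: (@le_trans _ _ (p^-1 * ln (expR (p * h w)))); first by rewrite expRK mulKf ?gt_eqF.
  rewrite ler_pM2l// ler_ln ?posrE ?expR_gt0//; last by rewrite addr_gt0 ?expR_gt0// mulr_gt0.
  by rewrite lerDl mulr_ge0// ltW.
rewrite ler_expR lerD2r ler_pM2l// lerD2l ler_wpM2r ?dotvv_ge0//.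
have ts : 0 < 4 * eta0 * (1 - p^-1) * (t - s) by rewrite mulr_gt0// subr_gt0.
by rewrite lef_pV2 ?posrE// ?addr_gt0// lerDl ltW.
Qed.

(** Doubling with [rho = 1] and a constant penalty: the initial condition is
    [L * n <= n ^ 2 / be + L ^ 2 * be / 4], and at [n = |x - y|] this is an
    equality for [be = 2 * n / L], which is the choice made. *)
Lemma G_exp_lipschitz s t (h : V -> R) (L : R) x y : I s -> Cb h -> s <= t ->
  0 < L -> (forall x y, h x - h y <= L * enorm (x - y)) ->
  ln (G t s (fun x => expR (h x)) x) - ln (G t s (fun x => expR (h x)) y) <=
    L * enorm (x - y).
Proof.
move=> Is Ch st L0 lip.
have phi0 := ds_phi_gt0 DS.
have [->|xy] := eqVneq x y.
  by rewrite subrr mulr_ge0 ?enorm_ge0// ltW.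
have z0 : 0 < enorm (x - y).
  by rewrite sqrtr_gt0 dotvv_gt0// subr_eq0.
have Bx := G_exp_gt0 DS G_evol x Is Ch st.
have By := G_exp_gt0 DS G_evol y Is Ch st.
pose be := 2 * enorm (x - y) / L.
have be0 : 0 < be by rewrite divr_gt0// mulr_gt0.
suff : G t s (fun x => expR (h x)) x <= expR (1 * (ln (G t s (fun x => expR (h x)) y) +
    be^-1 * dotv (x - y) (x - y)) + L ^+ 2 * be / 4).
  rewrite -[leLHS]lnK ?posrE// ler_expR mul1r => h1.
  rewrite lerBlDl; apply: le_trans h1 _; rewrite -addrA lerD2l.
  rewrite -enorm_sqr /be le_eqVlt; apply/orP; left; apply/eqP.
  by field; rewrite !gt_eqF.
apply: (@penalty_limit _ _ (phi x + (a + 1) * (t - s)) _ (phi y + (a + 1) * (t - s)) _ _ _ 0 By) => e e0.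
rewrite mulr0 addr0.
have al_le : 0 <= 4 * eta0 * (1 - 1) by rewrite subrr mulr0.
have main := @doubling_penalized _ _ _ _ _ _ _ _ _ _ _ DS _ _ G_evol s
  _ _ 1 0 be (L ^+ 2 * be / 4) e Is (Cb_exp Ch) (Cb_exp Ch)
  (fun y => expR_ge0 _) e0 ltr01 (lexx _) be0 al_le (lexx _) _ t x y st.
apply: le_trans (main _) _ => [z w|]; last by rewrite mul0r add0r.
apply: (@le_trans _ _ (expR (h z))).
  by rewrite gerBl mulr_ge0// ltW.
rewrite ler_expR mul1r.
apply: (@le_trans _ _ (h w + L * enorm (z - w))); first by rewrite -lerBlDl.
rewrite -addrA; apply: lerD.
  rewrite -{1}(expRK (h w)) ler_ln ?posrE ?expR_gt0//; last by rewrite addr_gt0 ?expR_gt0// mulr_gt0.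
  by rewrite lerDl mulr_ge0// ltW.
rewrite -enorm_sqr; move: (enorm (z - w)) => n.
have : 0 <= be^-1 * (n - L * be / 2) ^+ 2 by rewrite mulr_ge0 ?sqr_ge0// invr_ge0 ltW.
have -> : be^-1 * (n - L * be / 2) ^+ 2 = be^-1 * n ^+ 2 - L * n + L ^+ 2 * be / 4.
  by field; rewrite gt_eqF.
lra.
Qed.

(** A reverse Jensen inequality: as [ln (G t s e^h)] is [L]-Lipschitz, the
    quadratic term of its equation is at most [Lambda * L ^ 2]. *)
Lemma G_exp_upper s t (h : V -> R) (L : R) x : I s -> Cb h -> s <= t ->
  0 < L -> (forall x y, h x - h y <= L * enorm (x - y)) ->
  ln (G t s (fun x => expR (h x)) x) <= G t s h x + Lambda * L ^+ 2 * (t - s).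
Proof.
move=> Is Ch st L0 lip.
have [M1 H1] := sol_bounded G_evol Is Ch; have [M2 H2] := exp_sol_ln_bound DS G_evol Is Ch.
have ev := evolD (exp_sol_evol DS G_evol Is Ch) (evolD (evolZ (-1) (sol_evol G_evol Is Ch))
   (evol_affine `]s, +oo[%classic (- (Lambda * L ^+ 2)) 0 s (line2_cst d 0))).
suff : ln (G t s (fun x => expR (h x)) x) + (-1 * G t s h x +
    (0 + (- (Lambda * L ^+ 2) * (t - s) + 0))) <= 0.
  by lra.
apply: (comparison DS (M := M2 + M1) Is ev) => //.
- apply: continuous_onD; first exact: (exp_sol_cont DS G_evol).
  apply: continuous_onD; first exact/continuous_onZ/(sol_cont G_evol).
  apply: continuous_on_T => z; apply: cvgD; first exact: cvg_cst.
  apply: cvgD; last exact: cvg_cst.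
  by apply: cvgMr; apply: cvgB; [exact: cvg_fst|exact: cvg_cst].
- move=> r y sr; rewrite add0r addr0; apply: lerD.
    exact: le_trans (ler_norm _) (H2 _ _ sr).
  rewrite -[leRHS]addr0; apply: lerD.
    by rewrite mulN1r; apply: le_trans (ler_norm _) _; rewrite normrN H1.
  rewrite mulNr oppr_le0 mulr_ge0 ?subr_ge0// mulr_ge0 ?sqr_ge0// ltW//.
  exact: ds_Lambda DS.
- move=> r y sr.
  have Ir : I r by apply: (ds_up DS Is); exact: ltW.
  have u0 := G_exp_gt0 DS G_evol y Is Ch (ltW sr).
  rewrite !secopD !secopZ (sol_eq G_evol _ Is Ch sr).
  rewrite (sol_eq G_evol _ Is (Cb_exp Ch) sr) -(secop_ln DS y _ _ Ir u0).
  rewrite [secop _ _ r y 0 0](_ : _ = 0); last first.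
    by rewrite /secop mulmx0 linear0 dotv0r addr0.
  have Jr : `]s, +oo[%classic r by rewrite /= in_itv /= sr.
  have := line2_lip (evol_x (exp_sol_evol DS G_evol Is Ch) Jr) (ltW L0)
    (fun x y => G_exp_lipschitz x y Is Ch (ltW sr) L0 lip) y.
  move=> /=; set g := (X in dotv X X) => hg.
  have /andP[_ hq] := ds_ell DS g Ir.
  have hL : Lambda * dotv g g <= Lambda * L ^+ 2 by rewrite ler_pM2l// (ds_Lambda DS).
  lra.
- move=> y; rewrite (sol_init G_evol)//; last exact: Cb_exp.
  by rewrite (sol_init G_evol)// expRK subrr mulr0 !addr0 mulN1r subrr.
Qed.

End HarnackLipschitz.

(** * Consequences of the standing assumptions *)

Section Setting.
Variables (R : realType) (d : nat).
Local Notation V := 'rV[R]_d.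

(** The mean value theorem on the segment from [y] to [x]. *)
Lemma dissipative_monotone (f : V -> V) (r0 : R) : r0 < 0 ->
  (forall i, derivable_x (fun x => f x 0 i)) ->
  (forall i j, continuous (Dx j (fun x => f x 0 i))) ->
  (forall x xi, dotv (mxapp (jac f x) xi) xi <= r0 * enorm xi ^+ 2) ->
  forall x y, dotv (f x - f y) (x - y) <= 0.
Proof.
move=> r00 df cf dis x y; set z := x - y.
pose m (r : R) := dotv (f (y + r *: z)) z.
have dm (r : R) : is_derive r (1 : R) m (dotv (mxapp (jac f (y + r *: z)) z) z).
  have h i : is_derive r (1 : R) (fun t => z 0 i * f (y + t *: z) 0 i)
      (z 0 i * dotv (grad (fun w => f w 0 i) (y + r *: z)) z).
    apply: is_deriveZ.
    have := line_derivative z (df i) (fun j => cf i j (y + r *: z)).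
    move=> h0; have h' : is_derive (r - r) (1 : R) (fun t => f (y + r *: z + t *: z) 0 i)
        (dotv (grad (fun w => f w 0 i) (y + r *: z)) z) by rewrite subrr.
    have -> : (fun t => f (y + t *: z) 0 i) =
       (fun t => f (y + r *: z + t *: z) 0 i) \o (fun u => u - r).
      by apply/funext => t /=; rewrite -addrA -scalerDl subrKC.
    by apply: is_derive_eq (is_derive1_comp _ _) _; last by rewrite subr0 mulr1.
  have E : m = \sum_(i < d) (fun t => z 0 i * f (y + t *: z) 0 i).
    by apply/funext => t; rewrite fct_sumE; apply: eq_bigr => i _; rewrite mulrC.
  rewrite E; have hs := is_derive_sum h; apply: is_derive_eq hs _.
  apply: eq_bigr => i _; rewrite mulrC; congr (_ * _).
  by rewrite /mxapp mxE; apply: eq_bigr => j _; rewrite !mxE mulrC.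
have cm A : {within A, continuous m}.
  apply: continuous_subspaceT => r; apply: differentiable_continuous.
  by apply/derivable1_diffP; case: (dm r).
have [r _ E] := MVT_segment ler01 (fun r _ => dm r) (cm _).
have -> : dotv (f x - f y) z = m 1 - m 0.
  by rewrite /m scale1r scale0r addr0 /z subrKC dotvDl dotvNl.
rewrite E subr0 mulr1; apply: le_trans (dis _ _) _.
by rewrite mulr_le0_ge0 ?sqr_ge0// ltW.
Qed.

Lemma standing_setting (I : set R) Q (b : R -> V -> V) theta :
  (forall s t, I s -> s <= t -> I t) -> standing_assumptions I Q b theta ->
  exists eta0 Lambda a phi gphi Hphi,
    dissipative_setting I Q b eta0 Lambda a phi gphi Hphi.
Proof.
move=> Iup [/andP[th0 _] _ _ Qsym [eta0 [Lambda [/andP[e0 eL] ell]]]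
  [phi [a [gamma [[d1 d2 c0 c1 c2] phi0 phiI [a0 g0] phiA]]]] db hDb [r0 [r00 dis]]].
exists eta0, Lambda, a, phi, (grad phi), (hess phi).
have ell' t v : I t -> eta0 * dotv v v <= quad (Q t) v <= Lambda * dotv v v.
  by move=> It; have := ell t v It; rewrite enorm_sqr mxapp_quad ?Qsym.
split => //.
- exact: lt_trans eL.
- move=> t It; apply: posdef_sum_rank1; first exact: Qsym.
  move=> v v0; have /andP[+ _] := ell' t v It; apply: lt_le_trans.
  by rewrite mulr_gt0// dotvv_gt0.
- move=> t x y It; apply: (@dissipative_monotone (b t) r0 r00).
  + by move=> i; exact: db.
  + by move=> i j; exact: (parabolic_holder_slice th0 (hDb i j) It).
  + by move=> z xi; exact: dis.
- by apply: C2_line2.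
- move=> M; have [r Hr] := phiI M; exists r => x /negP; rewrite -ltNge subr0 => rx.
  by apply: Hr; apply: le_trans (ltW rx) (ler_norm_enorm _).
- move=> t x It; apply: le_trans (phiA t x It) _.
  by rewrite gerBl mulr_ge0// ltW.
Qed.

End Setting.

(** * Density of bounded continuous functions in L^1 *)

Section ContinuousReal.
Variables (R : realType) (X : topologicalType).
Implicit Types f g : X -> R.

Lemma cont_add f g : continuous f -> continuous g -> continuous (fun x => f x + g x).
Proof. by move=> cf cg x; exact: (continuousD (cf x) (cg x)). Qed.

Lemma cont_mul f g : continuous f -> continuous g -> continuous (fun x => f x * g x).
Proof. by move=> cf cg x; exact: (continuousM (cf x) (cg x)). Qed.

Lemma cont_cst (c : R) : continuous (fun _ : X => c).
Proof. by move=> x; exact: cst_continuous. Qed.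

Lemma cont_map (F : R -> R) f : continuous F -> continuous f ->
  continuous (fun x => F (f x)).
Proof. by move=> cF cf x; exact: (continuous_comp (cf x) (cF (f x))). Qed.

End ContinuousReal.

Section Density.
Variables (R : realType) (d : nat).
Local Notation V := 'rV[R]_d.
Local Notation T := (borelV R d).
Local Open Scope ereal_scope.

Lemma borel_open (U : set V) : open U -> measurable (U : set T).
Proof. by move=> oU; exact: sub_sigma_algebra. Qed.

Lemma borel_continuous (f : V -> R) : continuous f ->
  measurable_fun [set: T] (f : T -> R).
Proof.
move=> /continuousP cf.
apply: (measurability _ (measurable_realfun.RGenOInfty.measurableE R)) => // _ [_ [x ->] <-].
by rewrite setTI; apply: borel_open; apply: cf; exact: interval_open.
Qed.

Variable P : probability T R.

Lemma Cb_integrable (f : V -> R) : Cb f -> P.-integrable [set: T] (EFin \o (f : T -> R)).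
Proof.
move=> [cf [M HM]]; apply: measurable_bounded_integrable => //.
- exact: fin_num_fun_lty.
- exact: borel_continuous.
- exists M; split; first exact: num_real.
  by move=> N MN x _; apply: le_trans (HM x) (ltW MN).
Qed.

Definition L1_approx (f : T -> R) := forall e : R, (0 < e)%R ->
  exists2 h : V -> R, Cb h & \int[P]_x `|h x - f x|%:E <= e%:E.

Lemma integral_norm_triangle (f g h : T -> R) :
  measurable_fun [set: T] f -> measurable_fun [set: T] g ->
  measurable_fun [set: T] h ->
  \int[P]_x `|f x - h x|%:E <=
  \int[P]_x `|f x - g x|%:E + \int[P]_x `|g x - h x|%:E.
Proof.
move=> mf mg mh; rewrite -ge0_integralD//; last 2 first.
- by apply/measurable_EFinP; apply: measurableT_comp => //; exact: measurable_funB.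
- by apply/measurable_EFinP; apply: measurableT_comp => //; exact: measurable_funB.
apply: ge0_le_integral => //.
- by apply/measurable_EFinP; apply: measurableT_comp => //; exact: measurable_funB.
- by apply: emeasurable_funD; apply/measurable_EFinP; apply: measurableT_comp => //; exact: measurable_funB.
by move=> x _; rewrite -EFinD lee_fin ler_distD.
Qed.

Lemma L1_approx_trans (f : T -> R) : measurable_fun [set: T] f ->
  (forall e : R, (0 < e)%R -> exists g : T -> R, [/\ measurable_fun [set: T] g,
     L1_approx g & \int[P]_x `|g x - f x|%:E <= e%:E]) -> L1_approx f.
Proof.
move=> mf H e e0; have e20 : (0 < e / 2)%R by rewrite divr_gt0.
have [g [mg ag gf]] := H _ e20; have [h Ch hg] := ag _ e20.
exists h => //; apply: le_trans (integral_norm_triangle _ mg mf) _.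
  by apply: borel_continuous; case: Ch.
by rewrite [e]splitr EFinD leeD.
Qed.

Lemma Cb_lin (f g : V -> R) (c : R) : Cb f -> Cb g -> Cb (fun x => f x + c * g x)%R.
Proof.
move=> [cf [M HM]] [cg [N HN]]; split.
  by apply: cont_add => //; apply: cont_mul => //; exact: cont_cst.
exists (M + `|c| * N)%R => x; apply: le_trans (ler_normD _ _) _.
by rewrite lerD// normrM ler_wpM2l.
Qed.

Lemma L1_approx_lin (f g : T -> R) (c : R) :
  measurable_fun [set: T] f -> measurable_fun [set: T] g ->
  L1_approx f -> L1_approx g -> L1_approx (fun x => f x + c * g x)%R.
Proof.
move=> mf mg af ag e e0.
have e20 : (0 < e / 2)%R by rewrite divr_gt0.
have e2c : (0 < e / 2 / (`|c| + 1))%R by rewrite divr_gt0// ltr_wpDl.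
have [h1 C1 H1] := af _ e20; have [h2 C2 H2] := ag _ e2c.
exists (fun x => h1 x + c * h2 x)%R; first exact: Cb_lin.
have m1 : measurable_fun [set: T] (h1 : T -> R) by apply: borel_continuous; case: C1.
have m2 : measurable_fun [set: T] (h2 : T -> R) by apply: borel_continuous; case: C2.
have M1 : measurable_fun [set: T] (fun x => `|h1 x - f x|%:E).
  by apply/measurable_EFinP; apply: measurableT_comp => //; exact: measurable_funB.
have M2 : measurable_fun [set: T] (fun x => `|h2 x - g x|%:E).
  by apply/measurable_EFinP; apply: measurableT_comp => //; exact: measurable_funB.
apply: (@le_trans _ _ (\int[P]_x (`|h1 x - f x|%:E + `|c|%:E * `|h2 x - g x|%:E))).
  apply: ge0_le_integral => //.
  - apply/measurable_EFinP; apply: measurableT_comp => //; apply: measurable_funB.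
      by apply: measurable_funD => //; exact: measurable_funM.
    by apply: measurable_funD => //; exact: measurable_funM.
  - by apply: emeasurable_funD => //; exact: measurable_funeM.
  - move=> x _; rewrite -EFinM -EFinD lee_fin -normrM.
    rewrite (_ : h1 x + c * h2 x - _ = (h1 x - f x) + c * (h2 x - g x))%R; last by ring.
    exact: ler_normD.
rewrite ge0_integralD//; last exact: measurable_funeM.
rewrite ge0_integralZl_EFin//.
rewrite [e]splitr EFinD leeD//.
apply: le_trans (lee_wpmul2l _ H2) _; first by rewrite lee_fin.
rewrite -EFinM lee_fin mulrCA ler_piMr ?(ltW e20)//.
by rewrite ler_pdivrMr ?mul1r ?lerDl// ltr_wpDl.
Qed.

Lemma L1_approx_cst (c : R) : L1_approx (fun=> c).
Proof.
move=> e e0; exists (fun=> c).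
  by split; [move=> x; exact: cst_continuous|exists `|c|%R].
by rewrite (eq_integral (cst 0)) ?integral0 ?lee_fin ?ltW// => x _; rewrite subrr normr0.
Qed.

(** Urysohn functions for the complement of [U] and the set of the points at
    distance at least [n.+1%:R^-1] from it. *)
Lemma open_approx_fun (U : set V) : open U ->
  exists h : nat -> V -> R, [/\ forall n, continuous (h n),
    forall n x, (0 <= h n x <= 1)%R, forall n x, ~ U x -> h n x = 0%R &
    forall x, U x -> \forall n \near \oo, h n x = 1%R].
Proof.
move=> oU.
pose A (n : nat) : set V := [set x | forall y, (`|x - y| < n.+1%:R^-1)%R -> U y].
have sep n : exists f : V -> R, [/\ continuous f, range f `<=` `[0%R, 1%R],
    f @` A n `<=` [set 0%R] & f @` (~` U) `<=` [set 1%R]].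
  apply/uniform_separatorP/uniform_separatorW.
  have n0 : (0 < n.+1%:R^-1 :> R)%R by rewrite invr_gt0.
  exists [set xy | ball xy.1 n.+1%:R^-1 xy.2]%R.
    exact: (entourage_ball V (PosNum n0)).
  apply/seteqP; split=> // -[x y] [[/= Ax Uy]]; rewrite -ball_normE /= => xy.
  exact/Uy/Ax.
pose f n := projT1 (cid (sep n)).
have Hf n := projT2 (cid (sep n)); rewrite -/(f _) in Hf.
exists (fun n x => 1 - f n x)%R; split.
- move=> n; have [cf _ _ _] := Hf n; apply: cont_add; first exact: cont_cst.
  by apply: cont_map cf => r; exact: opp_continuous.
- move=> n x; have [_ rf _ _] := Hf n.
  have := rf (f n x) (ex_intro2 _ _ x I erefl).
  by rewrite /= in_itv /= => /andP[? ?]; rewrite subr_ge0 gerBl; apply/andP.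
- move=> n x nU; have [_ _ _ f1] := Hf n.
  by rewrite (f1 (f n x)) ?subrr//; exists x.
- move=> x Ux.
  have /nbhs_ballP[r /= r0 Hr] : nbhs x U by apply: open_nbhs_nbhs.
  near=> n; have [_ _ f0 _] := Hf n.
  rewrite (f0 (f n x)) ?subr0//; exists x => // y xy; apply: Hr; rewrite -ball_normE /=.
  apply: lt_trans xy _; near: n; exact: near_infty_natSinv_lt (PosNum r0).
Unshelve. all: by end_near. Qed.

Lemma cvge0_near (u : (\bar R)^nat) (e : R) : u n @[n --> \oo] --> 0 ->
  (0 < e)%R -> \forall n \near \oo, u n <= e%:E.
Proof.
move=> /fine_cvgP[fu cu] e0.
have hu := (@cvgrPdist_le _ _ _ _ _ _ _).1 cu e e0.
near=> n.
have un : u n \is a fin_num by near: n; exact: fu.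
rewrite -(fineK un) lee_fin; apply: le_trans (ler_norm _) _.
by rewrite -normrN -sub0r; near: n; exact: hu.
Unshelve. all: by end_near. Qed.

Lemma L1_approx_open (U : set V) : open U -> L1_approx (\1_(U : set T)).
Proof.
move=> oU e e0.
have [h [ch h01 h0 h1]] := open_approx_fun oU.
have mh n : measurable_fun [set: T] (h n : T -> R) by exact: borel_continuous.
have mU : measurable_fun [set: T] (\1_(U : set T) : T -> R).
  by apply: measurable_indic; exact: borel_open.
have Ch n : Cb (h n).
  split => //; exists 1%R => x; have /andP[a0 a1] := h01 n x.
  by rewrite ger0_norm.
have mhU n : measurable_fun [set: T] (fun x => `|h n x - \1_(U : set T) x|%:E).
  by apply/measurable_EFinP; apply: measurableT_comp => //; exact: measurable_funB.
have [] := @dominated_convergence _ T R P setT measurableT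
   (fun n x => `|h n x - \1_(U : set T) x|%:E) (cst 0) (cst 1) mhU (measurable_cst _).
- apply: aeW => x _.
  have [Ux|nUx] := pselect (U x).
    apply: (cvg_near_cst); have := h1 x Ux; apply: filterS => n ->.
    by rewrite indicE mem_set// subrr normr0.
  apply: cvg_near_cst; apply: nearW => n; rewrite h0// indicE memNset// subrr normr0//.
- apply: (@finite_measure_integrable_cst _ _ _ P setT 1%R measurableT).
- apply: aeW => x n _ /=; rewrite lee_fin normr_id.
  have /andP[a0 a1] := h01 n x; rewrite indicE.
  by case: (x \in _) => /=; rewrite ?subr0 ler_norml; apply/andP; split; lra.
move=> _ _; rewrite /= integral0 => cv.
have [N _ HN] := cvge0_near cv e0.
by exists (h N) => //; apply: (HN N) => /=.
Qed.

End Density.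

(** * Density of bounded continuous functions in L^p *)

Section Clip.
Variable R : realType.

Definition clip (M r : R) := Num.max (- M) (Num.min r M).

Lemma clip_cases (M r : R) : 0 <= M ->
  [\/ r <= - M /\ clip M r = - M, - M <= r <= M /\ clip M r = r |
      M <= r /\ clip M r = M].
Proof.
move=> M0; rewrite /clip; have [h|/ltW h] := leP M r.
  by constructor 3; split => //; rewrite max_r//; lra.
have [h'|/ltW h'] := leP r (- M); first by constructor 1.
by constructor 2; rewrite h h'.
Qed.

Lemma clip_norm (M r : R) : 0 <= M -> `|clip M r| <= M.
Proof.
by move=> M0; rewrite ler_norml; have [[_ ->]|[/andP[? ?] ->]|[_ ->]] := clip_cases r M0;
  apply/andP; split; lra.
Qed.

Lemma clip_dist (M r : R) : 0 <= M -> `|clip M r - r| <= `|r|.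
Proof.
move=> M0; have a1 := ler_norm r; have a2 := ler_norm (- r); have a3 := normr_ge0 r.
rewrite normrN in a2; rewrite ler_norml.
by have [[? ->]|[/andP[? ?] ->]|[? ->]] := clip_cases r M0; apply/andP; split; lra.
Qed.

Lemma clip_id (M r : R) : `|r| <= M -> clip M r = r.
Proof. by rewrite ler_norml => /andP[h1 h2]; rewrite /clip min_l// max_r. Qed.

Lemma clip_lip (M r r' : R) : 0 <= M -> `|clip M r - clip M r'| <= `|r - r'|.
Proof.
move=> M0; have a1 := ler_norm (r - r'); have a2 := ler_norm (r' - r).
rewrite distrC in a2; have a3 := normr_ge0 (r - r'); rewrite ler_norml.
by have [[? ->]|[/andP[? ?] ->]|[? ->]] := clip_cases r M0;
   have [[? ->]|[/andP[? ?] ->]|[? ->]] := clip_cases r' M0; apply/andP; split; lra.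
Qed.

End Clip.

Section LpDensity.
Import HBSimple.
Variables (R : realType) (d : nat).
Local Notation V := 'rV[R]_d.
Local Notation T := (borelV R d).
Variable P : probability T R.
Local Open Scope ereal_scope.

(** Dynkin's theorem, with the open sets as generating pi-system. *)
Lemma L1_approx_indic (A : set T) : measurable A -> L1_approx P (\1_A).
Proof.
move=> mA.
apply: (@dynkin_induction _ T (@open V) (fun A => L1_approx P (\1_A))) => //.
- by move=> U W; exact: openI.
- have -> : \1_[set: T] = (fun=> 1%R) :> (T -> R) by apply/funext => x; rewrite indicE in_setT.
  exact: L1_approx_cst.
- exact: L1_approx_open.
- move=> S mS aS.
  have -> : \1_(~` S) = (fun x => 1 + (-1) * \1_S x)%R :> (T -> R).
    apply/funext => x; rewrite !indicE in_setC; case: (x \in S) => /=; ring.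
  apply: L1_approx_lin => //; exact: L1_approx_cst.
- move=> F mF tF aF.
  pose D n := \big[setU/set0]_(i < n) F i.
  have mD n : measurable (D n) by apply: bigsetU_measurable.
  have DS n x : \1_(D n.+1) x = (\1_(D n) x + 1 * \1_(F n) x)%R :> R.
    rewrite /D big_ord_recr /= mul1r !indicE in_setU.
    have [Dx|] := boolP (x \in _); last by rewrite add0r.
    rewrite (_ : (x \in F n) = false) ?addr0//; apply/negbTE/negP; rewrite inE => Fx.
    move: Dx; rewrite inE -bigcup_mkord => -[k /= kn Fk].
    have kE := tF k n I I (ex_intro _ x (conj Fk Fx)).
    by move: kn; rewrite kE ltnn.
  have aD n : L1_approx P (\1_(D n)).
    elim: n => [|n IHn].
      rewrite /D big_ord0 (_ : \1_set0 = (fun=> 0%R) :> (T -> R)); first exact: L1_approx_cst.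
      by apply/funext => x; rewrite indicE in_set0.
    have -> : \1_(D n.+1) = (fun x => \1_(D n) x + 1 * \1_(F n) x)%R :> (T -> R).
      by apply/funext => x; exact: DS.
    exact: L1_approx_lin.
  have mU : measurable (\bigcup_k F k) by exact: bigcup_measurable.
  apply: L1_approx_trans => // e e0.
  have mhU n : measurable_fun [set: T] (fun x => `|\1_(D n) x - \1_(\bigcup_k F k) x|%:E : \bar R).
    by apply/measurable_EFinP; apply: measurableT_comp => //; exact: measurable_funB.
  have [] := @dominated_convergence _ T R P setT measurableT
   (fun n x => `|\1_(D n) x - \1_(\bigcup_k F k) x|%:E) (cst 0) (cst 1) mhU (measurable_cst _).
  - apply: aeW => x _.
    have [[k _ Fk]|nUx] := pselect ((\bigcup_k F k) x).
      apply: cvg_near_cst; exists k.+1 => // n /= kn.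
      rewrite !indicE mem_set; last by rewrite /D -bigcup_mkord; exists k.
      by rewrite mem_set ?subrr ?normr0//; exists k.
    apply: cvg_near_cst; apply: nearW => n; rewrite !indicE memNset.
      by rewrite memNset// subrr normr0.
    by rewrite /D -bigcup_mkord => -[k _ Fk]; apply: nUx; exists k.
  - apply: (@finite_measure_integrable_cst _ _ _ P setT 1%R measurableT).
  - apply: aeW => x n _ /=; rewrite lee_fin normr_id !indicE.
    by do 2 case: (x \in _) => /=; rewrite ler_norml; apply/andP; split; lra.
  move=> _ _; rewrite /= integral0 => cv.
  have [N _ HN] := cvge0_near cv e0.
  exists (\1_(D N)); split=> //; exact: (HN N (leqnn N)).
Qed.

Lemma L1_approx_integrable (f : T -> R) : P.-integrable [set: T] (EFin \o f) ->
  L1_approx P f.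
Proof.
move=> intf.
have mf : measurable_fun [set: T] f by move/measurable_int: intf => /measurable_EFinP.
apply: L1_approx_trans => // e e0.
have [g [_ _ cv]] := @approximation_sfun_integrable _ T R P setT measurableT _ intf.
have [N _ HN] := cvge0_near cv e0.
exists (fun x => g N x); split => //; last first.
  have := HN N (leqnn N); under eq_integral do rewrite -EFinB abse_EFin distrC.
  by [].
rewrite (_ : (fun x => g N x) = (fun x => \sum_(y <- finmap.enum_fset (fset_set (range (g N))))
   y * \1_(g N @^-1` [set y]) x)%R); last first.
  by apply/funext => x; rewrite fimfunE fsbig_finite.
elim: (finmap.enum_fset _) => [|y s IHs].
  by under eq_fun do rewrite big_nil; exact: L1_approx_cst.
under eq_fun do rewrite big_cons addrC.
apply: L1_approx_lin => //.
  by apply: measurable_sum => z; apply: measurable_funM.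
exact: L1_approx_indic.
Qed.

Lemma Lnorm_le (p e : R) (f : T -> R) : (0 < p)%R -> (0 <= e)%R ->
  \int[P]_x (`|f x| `^ p)%:E <= (e `^ p)%:E -> 'N[P]_p%:E[EFin \o f] <= e%:E.
Proof.
move=> p0 e0 h; rewrite unlock.
have -> : e%:E = (e `^ p)%:E `^ p^-1.
  by rewrite poweR_EFin -powRrM mulfV ?gt_eqF// powRr1.
apply: gt0_ler_poweR => //; first by rewrite invr_ge0 ltW.
- by rewrite in_itv /= leey andbT integral_ge0// => x _; exact: poweR_ge0.
- by rewrite in_itv /= leey andbT lee_fin powR_ge0.
Qed.

(** Dominated convergence as the level of the truncation tends to infinity. *)
Lemma truncation_density (p : R) (f : T -> R) (e : R) : (1 <= p)%R ->
  f \in Lfun P p%:E -> (0 < e)%R -> exists2 M : R, (0 < M)%R &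
  'N[P]_p%:E[EFin \o (fun x => clip M (f x) - f x)%R] <= e%:E.
Proof.
move=> p1 fp e0.
have p0 : (0 < p)%R by apply: lt_le_trans p1.
have mf : measurable_fun [set: T] f by move: fp; rewrite inE => /andP[]; rewrite inE.
have intf := Lfun_integrable p1 fp.
pose g n x := (clip n.+1%:R (f x) - f x)%R.
have mg n : measurable_fun [set: T] (g n).
  apply: measurable_funB => //; apply: measurable_maxr => //.
  exact: measurable_minr.
have gle n x : (`|g n x| <= `|f x|)%R by exact: clip_dist.
have [] := @dominated_convergence _ T R P setT measurableT
   (fun n x => (`|g n x| `^ p)%:E) (cst 0) (fun x => (`|f x| `^ p)%:E) _ (measurable_cst _) _ intf _.
- move=> n; apply/measurable_EFinP.
  apply: (@measurableT_comp _ _ _ _ _ _ (@powR R ^~ p)) => //.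
  exact: measurableT_comp.
- apply: aeW => x _; apply: cvg_near_cst.
  near=> n.
  have fn : (`|f x| <= n.+1%:R)%R.
    apply: (@le_trans _ _ n%:R); last by rewrite ler_nat.
    by near: n; exact: nbhs_infty_ger.
  rewrite (_ : g n x = 0%R) ?normr0 ?powR0 ?gt_eqF//.
  by rewrite /g clip_id// subrr.
- apply: aeW => x n _ /=; rewrite lee_fin ger0_norm ?powR_ge0//.
  by apply: ge0_ler_powR; rewrite ?nnegrE// ltW.
move=> _ _; rewrite /= integral0 => cv.
have ep : (0 < e `^ p)%R by rewrite powR_gt0.
have [N _ HN] := cvge0_near cv ep.
exists N.+1%:R => //; apply: Lnorm_le => //; first exact: ltW.
exact: (HN N (leqnn N)).
Unshelve. all: by end_near. Qed.

(** After truncation at level [M] an [L^1] approximation suffices, because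
    [|u| ^ p <= (2 * M) ^ (p - 1) * |u|] for a difference [u] of two functions
    bounded by [M]. *)
Lemma Lp_density (p : R) (f : T -> R) (e : R) : (1 <= p)%R ->
  f \in Lfun P p%:E -> (0 < e)%R ->
  exists2 h : V -> R, Cb h & 'N[P]_p%:E[EFin \o ((h : T -> R) \- f)%R] <= e%:E.
Proof.
move=> p1 fp e0.
have p0 : (0 < p)%R by apply: lt_le_trans p1.
have e20 : (0 < e / 2)%R by rewrite divr_gt0.
have mf : measurable_fun [set: T] f by move: fp; rewrite inE => /andP[]; rewrite inE.
have [M M0 HM] := truncation_density p1 fp e20.
have M0' := ltW M0.
have cclip : continuous (clip M).
  move=> r; apply: (@continuous_max _ _ (cst (- M)%R) (fun r => Num.min r M) r).
    exact: cvg_cst.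
  by apply: (@continuous_min _ _ id (cst M) r); [exact: cvg_id|exact: cvg_cst].
have mclip : measurable_fun [set: R] (clip M) by exact: continuous_measurable_fun.
have mcf : measurable_fun [set: T] (clip M \o f) by exact: measurableT_comp.
have icf : P.-integrable [set: T] (EFin \o (clip M \o f)).
  apply: measurable_bounded_integrable => //.
  - exact: fin_num_fun_lty.
  - exists M; split; first exact: num_real.
    by move=> N MN x _; apply: le_trans (clip_norm _ M0') (ltW MN).
have M2 : (0 < (2 * M) `^ (p - 1))%R by rewrite powR_gt0// mulr_gt0.
have del0 : (0 < (e / 2) `^ p / (2 * M) `^ (p - 1))%R by rewrite divr_gt0// powR_gt0.
have [h [ch _] hf] := L1_approx_integrable icf del0.
have mh : measurable_fun [set: T] (h : T -> R) by exact: borel_continuous.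
have mch : measurable_fun [set: T] (fun x : T => clip M (h x)) by exact: (measurableT_comp mclip mh).
exists (clip M \o h).
  split; last by exists M => x; exact: clip_norm.
  exact: (cont_map cclip ch).
have -> : (((clip M \o h : V -> R) : T -> R) \- f)%R =
    ((fun x : T => clip M (h x) - clip M (f x)) \+ (fun x : T => clip M (f x) - f x))%R.
  by apply/funext => x /=; rewrite addrA subrK.
apply: le_trans (minkowski_EFin _ _ _ p1) _.
- exact: measurable_funB.
- exact: measurable_funB.
rewrite [e]splitr EFinD leeD//.
apply: Lnorm_le => //; first exact: ltW.
have -> : ((e / 2) `^ p)%:E = ((2 * M) `^ (p - 1))%:E * ((e / 2) `^ p / (2 * M) `^ (p - 1))%:E.
  by rewrite -EFinM mulrCA mulfV ?mulr1// gt_eqF.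
apply: le_trans (lee_wpmul2l _ hf); last by rewrite lee_fin ltW.
rewrite -ge0_integralZl_EFin//; last 2 first.
- by apply/measurable_EFinP; apply: measurableT_comp => //; exact: measurable_funB.
- exact: ltW.
apply: ge0_le_integral => //.
- apply/measurable_EFinP.
  apply: (@measurableT_comp _ _ _ _ _ _ (@powR R ^~ p)) => //.
  by apply: measurableT_comp => //; exact: measurable_funB.
- apply: measurable_funeM; apply/measurable_EFinP.
  by apply: measurableT_comp => //; exact: measurable_funB.
move=> x _; rewrite -EFinM lee_fin.
set z := `|clip M (h x) - clip M (f x)|%R.
have z0 : (0 <= z)%R by exact: normr_ge0.
have z2 : (z <= 2 * M)%R.
  by apply: le_trans (ler_normB _ _) _; rewrite mulr2n mulrDl mul1r lerD// clip_norm.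
have zc : (z <= `|h x - clip M (f x)|)%R by rewrite /z -{1}(clip_id (clip_norm (f x) M0')); exact: clip_lip.
have -> : (z `^ p = z `^ (p - 1) * z)%R.
  have [->|zn0] := eqVneq z 0%R; first by rewrite powR0 ?mulr0// gt_eqF.
  by rewrite -{3}(powRr1 z0) -powRD ?subrK// zn0 implybT.
apply: ler_pM; rewrite ?powR_ge0//.
by apply: ge0_ler_powR; rewrite ?nnegrE ?subr_ge0// mulr_ge0// ltW.
Unshelve. all: by end_near. Qed.

End LpDensity.

(** * Pointwise bounds by Gaussian weights *)

Lemma cont_pairl (X Y : topologicalType) (y : Y) : continuous (fun x : X => (x, y)).
Proof. by move=> x; exact: cvg_pair (@cvg_id _ (nbhs x)) (@cst_continuous _ _ y x). Qed.

Lemma integral_prob_cst (dd : measure_display) (X : measurableType dd)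
    (R : realType) (P : probability X R) (c : R) : (\int[P]_x c%:E = c%:E)%E.
Proof.
rewrite -[RHS]mule1 -(probability_setT P).
exact: (integral_cst P measurableT c%:E).
Qed.

Section GaussianToSuper.
Variables (R : realType) (d : nat).
Local Notation V := 'rV[R]_d.
Local Notation T := (borelV R d).
Variables (I : set R) (Q : R -> 'M[R]_d) (b : R -> V -> V).
Variables (eta0 Lambda a : R) (phi : V -> R) (gphi : V -> V)
  (Hphi : V -> 'M[R]_d).
Hypothesis DS : dissipative_setting I Q b eta0 Lambda a phi gphi Hphi.
Variables (theta : R) (G : R -> R -> (V -> R) -> V -> R).
Hypothesis G_evol : evolution_operator I Q b theta G.
Variable mu : R -> probability T R.
Hypothesis mu_evol : evolution_system_of_measures I G mu.

Lemma continuous_enorm : continuous (@enorm R d).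
Proof.
apply: (@cont_map _ _ (@Num.sqrt R)); first exact: sqrt_continuous.
have -> : (fun x : V => dotv x x) =
    (fun z : V * V => dotv (z.1 - z.2) (z.1 - z.2)) \o (fun x => (x, 0)).
  by apply/funext => x /=; rewrite subr0.
by move=> x; apply: continuous_comp; [exact: cont_pairl|exact: continuous_dotvv].
Qed.

Lemma gauss_weight_continuous (lambda : R) : continuous (@gauss_weight R d lambda).
Proof.
apply: (@cont_map _ _ (@expR R)); first exact: continuous_expR.
apply: cont_mul; first exact: cont_cst.
apply: (@cont_map _ _ (fun y : R => y ^+ 2)); last exact: continuous_enorm.
exact: exprn_continuous.
Qed.

Lemma measurable_gauss_weight (lambda : R) :
  measurable_fun [set: T] (gauss_weight lambda : T -> R).
Proof. by apply: borel_continuous; apply: gauss_weight_continuous. Qed.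

Lemma measurable_eball (r : R) : measurable (@eball R d r : set T).
Proof.
apply: borel_open.
by have /continuousP/(_ [set y | y < r]) := continuous_enorm; apply; exact: open_lt.
Qed.

Lemma Cb_abs (f : V -> R) : Cb f -> Cb (fun x => `|f x|).
Proof.
move=> [cf [M HM]]; split; first by apply: cont_map cf; exact: norm_continuous.
by exists M => x; rewrite normr_id.
Qed.

Lemma sqdist_le (x y : V) (r : R) : enorm y < r ->
  dotv (x - y) (x - y) <= 2 * (enorm x ^+ 2 + r ^+ 2).
Proof.
move=> yr; have r0 : 0 <= r by rewrite ltW// (le_lt_trans (enorm_ge0 y)).
have : dotv y y <= r ^+ 2.
  by rewrite -enorm_sqr lerXn2r ?nnegrE ?enorm_ge0// ltW.
have := dotvv_ge0 (x + y); rewrite enorm_sqr.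
rewrite !(dotvDl, dotvDr, dotvNl, dotvNr) (dotvC y x); lra.
Qed.

Definition kappa (p tau : R) := (4 * eta0 * (1 - p^-1) * tau)^-1.

Lemma kappa_gt0 p tau : 1 < p -> 0 < tau -> 0 < kappa p tau.
Proof.
move=> p1 t0; rewrite invr_gt0 mulr_gt0// mulr_gt0 ?subr_gt0 ?invf_lt1//.
  by rewrite mulr_gt0// (ds_eta0 DS).
by rewrite (lt_trans ltr01).
Qed.

(** The bound that the Harnack inequality gives at [x] when its second point is
    averaged over a ball of radius [r] and measure at least [1/2]: [ln 2] comes from
    the measure, and [2 * (|x|^2 + r^2)] dominates [|x - y|^2] on the ball. *)
Definition weight (p r tau : R) (x : V) : R :=
  expR (p^-1 * (ln 2 + 2 * kappa p tau * (enorm x ^+ 2 + r ^+ 2))).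

Lemma integral_fin_Cb s (f : V -> R) : Cb f ->
  (\int[mu s]_x ((f : T -> R) x)%:E \is a fin_num)%E.
Proof.
by move=> Cf; apply: integrable_fin_num => //; exact: Cb_integrable.
Qed.

(** The Harnack inequality is integrated in its second point over the ball; by
    invariance the integral of [G t s e^(p h)] against [mu t] is the one of
    [e^(p h)] against [mu s]. *)
Lemma exp_pointwise_bound s t (h : V -> R) (p r : R) x : I s -> I t -> s < t ->
  1 < p -> Cb h -> (2^-1%:E <= mu t (@eball R d r))%E ->
  ((G t s (fun x => expR (h x)) x)%:E <=
    'N[mu s]_p%:E[EFin \o (fun y : T => expR (h y))] * (weight p r (t - s) x)%:E)%E.
Proof.
move=> Is It st p1 Ch mur.
have p0 : 0 < p by exact: lt_trans p1.
have Cph : Cb (fun x => p * h x).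
  by have := Cb_affine p 0 Ch; under eq_fun do rewrite addr0.
set A := G t s (fun x => expR (h x)) x.
have A0 : 0 < A by apply: (G_exp_gt0 DS G_evol) => //; exact: ltW.
pose B := G t s (fun x => expR (p * h x)).
have B0 y : 0 < B y by apply: (G_exp_gt0 DS G_evol) => //; exact: ltW.
have CB : Cb B by apply: (sol_Cb G_evol) => //; [exact: Cb_exp|exact: ltW].
pose q := 2 * kappa p (t - s) * (enorm x ^+ 2 + r ^+ 2).
have hB y : eball r y -> expR (p * ln A - q) <= B y.
  move=> yr; have := harnack DS G_evol x y Is Ch st p1; rewrite -/A -/(B) addr0 => h1.
  rewrite -[leRHS]lnK ?posrE// ler_expR.
  have : ln A <= p^-1 * (ln (B y) + kappa p (t - s) * dotv (x - y) (x - y)).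
    by rewrite -ler_expR lnK ?posrE.
  rewrite ler_pdivlMl// => h2; rewrite lerBlDr; apply: le_trans h2 _.
  rewrite lerD2l /q -mulrA mulrCA ler_pM2l ?kappa_gt0 ?subr_gt0//.
  exact: sqdist_le.
have Iexp : (\int[mu s]_x ((expR (p * h x))%:E) = \int[mu t]_x (B x)%:E)%E.
  by rewrite (mu_evol Is It st (Cb_exp Cph)).
have low : ((expR (p * ln A - q) / 2)%:E <= \int[mu t]_x (B x)%:E)%E.
  apply: (@le_trans _ _ (\int[mu t]_(x in @eball R d r) (B x)%:E)%E); last first.
    apply: ge0_subset_integral => //; first exact: measurable_eball.
    - by apply/measurable_EFinP; apply: borel_continuous; case: CB.
    - by move=> y _; rewrite lee_fin ltW.
  apply: (@le_trans _ _ (\int[mu t]_(x in @eball R d r) (cst (expR (p * ln A - q))%:E x))%E).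
    rewrite integral_cst; last exact: measurable_eball.
    by rewrite EFinM lee_wpmul2l// lee_fin expR_ge0.
  apply: ge0_le_integral => //; first exact: measurable_eball.
  - by move=> y _; rewrite lee_fin expR_ge0.
  - apply: measurable_funTS; apply/measurable_EFinP; apply: borel_continuous; case: CB => //.
rewrite -Iexp in low.
have fin : (\int[mu s]_x ((expR (p * h x))%:E) \is a fin_num)%E.
  exact: (integral_fin_Cb s (Cb_exp Cph)).
set J := fine (\int[mu s]_x ((expR (p * h x))%:E))%E.
have JE : (\int[mu s]_x ((expR (p * h x))%:E) = J%:E)%E by rewrite fineK.
have NE : ('N[mu s]_p%:E[EFin \o (fun y : T => expR (h y))] = (J `^ p^-1)%:E)%E.
  rewrite unlock -poweR_EFin -JE; congr (_ `^ _)%E; apply: eq_integral => y _ /=.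
  by rewrite ger0_norm ?expR_ge0// -expRM mulrC.
rewrite JE lee_fin in low.
have J0 : 0 < J by apply: lt_le_trans low; rewrite divr_gt0// expR_gt0.
rewrite NE -EFinM lee_fin -[leLHS]lnK ?posrE// /weight /powR gt_eqF// -expRD ler_expR.
rewrite -mulrDr ler_pdivlMl// -/q.
move: low; rewrite ler_pdivrMr// -ler_ln ?posrE ?expR_gt0 ?mulr_gt0// expRK lnM ?posrE//.
lra.
Qed.

Lemma Lp_Cb s p (f : V -> R) : 1 <= p -> Cb f -> Lp mu p s f.
Proof.
move=> p1 [cf [M HM]].
have M0 : 0 <= M by apply: le_trans (normr_ge0 _) (HM 0).
have p0 : 0 < p by exact: lt_le_trans p1.
have mf : measurable_fun [set: T] (f : T -> R) by exact: borel_continuous.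
rewrite /Lp inE; apply/andP; split; rewrite inE//=.
apply: (@le_lt_trans _ _ M%:E); last exact: ltry.
apply: Lnorm_le => //.
rewrite -[leRHS](integral_prob_cst (mu s)).
apply: ge0_le_integral => //.
- apply/measurable_EFinP; apply: (@measurableT_comp _ _ _ _ _ _ (@powR R ^~ p)) => //.
  exact: measurableT_comp.
- by move=> y _; rewrite lee_fin; apply: ge0_ler_powR; rewrite ?nnegrE// ltW.
Qed.

(** The previous bound applies to positive functions written as exponentials:
    [|f|] is dominated by [e^h] with [h = ln (|f| + e)], and [e] tends to 0. *)
Lemma pointwise_bound s t (f : V -> R) (p r : R) x : I s -> I t -> s < t ->
  1 < p -> Cb f -> (2^-1%:E <= mu t (@eball R d r))%E ->
  (`|G t s f x|%:E <= Lpnorm mu p s f * (weight p r (t - s) x)%:E)%E.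
Proof.
move=> Is It st p1 Cf mur.
have [cf [M HM]] := Cf.
have w0 : 0 < weight p r (t - s) x by exact: expR_gt0.
have mf : measurable_fun [set: T] (f : T -> R) by exact: borel_continuous.
have fLp : Lp mu p s f by exact: Lp_Cb (ltW p1) Cf.
have fin : Lpnorm mu p s f \is a fin_num.
  move: fLp; rewrite /Lp inE => /andP[_]; rewrite inE /finite_norm => h.
  by rewrite ge0_fin_numE// Lnorm_ge0.
have main (e : R) : 0 < e -> `|G t s f x| <= (fine (Lpnorm mu p s f) + e) * weight p r (t - s) x.
  move=> e0; pose h (y : V) := ln (`|f y| + e).
  have fe y : 0 < `|f y| + e by rewrite ltr_wpDl.
  have heE y : expR (h y) = `|f y| + e by rewrite /h lnK ?posrE.
  have Ch : Cb h.
    split.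
      move=> y; apply: (@continuous_comp _ _ _ (fun y => `|f y| + e) (@ln R)); last exact: continuous_ln.
      apply: (@cont_add _ _ (fun y => `|f y|) (fun=> e)); last exact: cont_cst.
      by case: (Cb_abs Cf).
    exists (`|ln e| + `|ln (M + e)|) => y.
    have l1 : ln e <= h y by rewrite /h ler_ln ?posrE// lerDr.
    have Me : 0 < M + e by apply: lt_le_trans (fe y) _; rewrite lerD2r.
    have l2 : h y <= ln (M + e) by rewrite /h ler_ln ?posrE// lerD2r.
    have l3 := ler_norm (ln (M + e)); have l4 := ler_norm (- ln e); rewrite normrN in l4.
    have l5 := normr_ge0 (ln (M + e)); have l6 := normr_ge0 (ln e).
    by rewrite ler_norml; apply/andP; split; lra.
  have := exp_pointwise_bound x Is It st p1 Ch mur.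
  have mono : `|G t s f x| <= G t s (fun y => expR (h y)) x.
    apply: le_trans (G_abs DS G_evol Is Cf (Cb_abs Cf) (ltW st) x) _.
    rewrite -[leRHS]addr0; apply: (G_mono DS G_evol) => //.
    - exact: Cb_abs.
    - exact: Cb_exp.
    - by move=> y; rewrite addr0 heE lerDl ltW.
    - exact: ltW.
  rewrite -lee_fin in mono; move=> /(le_trans mono) {}mono.
  rewrite -lee_fin; apply: le_trans mono _.
  rewrite EFinM; apply: lee_wpmul2r; first by rewrite lee_fin ltW.
  have -> : (EFin \o (fun y : T => expR (h y)) =
     EFin \o ((fun y : T => `|f y|) \+ (cst e))%R)%E.
    by apply/funext => y; rewrite /= heE.
  apply: le_trans (minkowski_EFin _ _ _ (ltW p1)) _ => //.
    exact: measurableT_comp.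
  rewrite EFinD fineK// leeD//.
    have -> : EFin \o (fun y : T => `|f y|) = (abse \o (EFin \o (f : T -> R)))%E by [].
    by rewrite Lnorm_abse.
  apply: Lnorm_le; rewrite ?(ltW e0) ?(lt_trans _ p1)//.
  under eq_integral do rewrite /= ger0_norm ?(ltW e0)//.
  by rewrite integral_prob_cst.
rewrite -(fineK fin) -EFinM lee_fin leNgt; apply/negP => h.
(* Half of the gap that a violation would leave. *)
pose e := (`|G t s f x| / weight p r (t - s) x - fine (Lpnorm mu p s f)) / 2.
have e0 : 0 < e by rewrite divr_gt0// subr_gt0 ltr_pdivlMr.
have := main e e0; rewrite -ler_pdivrMr// /e; move: e0; rewrite /e.
lra.
Qed.

End GaussianToSuper.

(** * Extension to L^p spaces *)

Section SuperFromGaussian.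
Variables (R : realType) (d : nat).
Local Notation V := 'rV[R]_d.
Local Notation T := (borelV R d).
Variables (I : set R) (Q : R -> 'M[R]_d) (b : R -> V -> V).
Variables (eta0 Lambda a : R) (phi : V -> R) (gphi : V -> V)
  (Hphi : V -> 'M[R]_d).
Hypothesis DS : dissipative_setting I Q b eta0 Lambda a phi gphi Hphi.
Variables (theta : R) (G : R -> R -> (V -> R) -> V -> R).
Hypothesis G_evol : evolution_operator I Q b theta G.
Variable mu : R -> probability T R.
Hypothesis mu_evol : evolution_system_of_measures I G mu.
Variable r : R.
Hypothesis mu_ball : forall t, I t -> (2^-1%:E <= mu t (@eball R d r))%E.
Variable Mg : R -> R.
Hypothesis Mg_bound : forall lambda t, 0 < lambda -> I t ->
  (\int[mu t]_x (gauss_weight lambda (x : V))%:E <= (Mg lambda)%:E)%E.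
Hypothesis Mg_gt0 : forall lambda, 0 < lambda -> 0 < Mg lambda.

Let w p tau (x : V) := weight eta0 p r tau x.

(** A bound for the [L^q] norm of [weight] in terms of a bound [Mg] of the Gaussian
    integrals. *)
Definition super_const (p q tau : R) : R :=
  expR (p^-1 * (ln 2 + 2 * kappa eta0 p tau * r ^+ 2)) *
  (Mg (2 * kappa eta0 p tau * (q / p))) `^ q^-1.

Lemma weight_continuous p tau : continuous (w p tau).
Proof.
apply: (@cont_map _ _ (@expR R)); first exact: continuous_expR.
apply: cont_mul; first exact: cont_cst.
apply: cont_add; first exact: cont_cst.
apply: cont_mul; first exact: cont_cst.
apply: cont_add; last exact: cont_cst.
apply: (@cont_map _ _ (fun y : R => y ^+ 2)); last exact: continuous_enorm.
exact: exprn_continuous.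
Qed.

Lemma weight_Lnorm p q tau t : 1 < p -> 0 < q -> 0 < tau -> I t ->
  ('N[mu t]_q%:E[EFin \o (w p tau : T -> R)] <= (super_const p q tau)%:E)%E.
Proof.
move=> p1 q0 tau0 It.
have k0 := kappa_gt0 DS p1 tau0.
have p0 : 0 < p by exact: lt_trans p1.
have l0 : 0 < 2 * kappa eta0 p tau * (q / p) by apply: mulr_gt0; [exact: mulr_gt0|exact: divr_gt0].
have M0 := Mg_gt0 l0.
apply: Lnorm_le => //; first by rewrite mulr_ge0 ?expR_ge0 ?powR_ge0.
pose c := expR (p^-1 * (ln 2 + 2 * kappa eta0 p tau * r ^+ 2)) `^ q.
have -> : super_const p q tau `^ q = c * Mg (2 * kappa eta0 p tau * (q / p)).
  rewrite /super_const powRM ?expR_ge0 ?powR_ge0// -powRrM mulVf ?gt_eqF// powRr1//.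
  exact: ltW.
rewrite (eq_integral (fun x : T => c%:E * (gauss_weight (2 * kappa eta0 p tau * (q / p)) (x : V))%:E)%E); last first.
  move=> x _; rewrite -EFinM; congr (_%:E).
  rewrite ger0_norm ?expR_ge0// /w /weight /c /gauss_weight -!expRM -expRD; congr expR.
  by field; rewrite gt_eqF.
rewrite ge0_integralZl_EFin//; last 3 first.
- by move=> x _; rewrite lee_fin expR_ge0.
- by apply/measurable_EFinP; exact: measurable_gauss_weight.
- exact: powR_ge0.
by rewrite EFinM lee_wpmul2l// ?lee_fin ?powR_ge0// Mg_bound.
Qed.

Lemma weight_gt0 p tau x : 0 < w p tau x.
Proof. exact: expR_gt0. Qed.

(** The pointwise bound makes [G t s] continuous from [L^p] to a weighted uniform
    norm, which is why its extension to [L^p] is again given by functions. *)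
Lemma difference_bound s t p h1 h2 x : I s -> I t -> s < t -> 1 < p ->
  Cb h1 -> Cb h2 ->
  (`|G t s h1 x - G t s h2 x|%:E <=
    Lpnorm mu p s (h1 \- h2)%R * (w p (t - s) x)%:E)%E.
Proof.
move=> Is It st p1 C1 C2.
have C12 : Cb (fun x => `|h1 x - h2 x|).
  apply: Cb_abs; have := Cb_lin (-1) C1 C2.
  by under eq_fun do rewrite mulN1r.
have le1 : `|G t s h1 x - G t s h2 x| <= G t s (fun x => `|h1 x - h2 x|) x.
  rewrite ler_norml lerNl; apply/andP; split.
    have := @G_combo _ _ _ _ _ _ _ _ _ _ _ DS _ _ G_evol s t h1 h2 _ (-1) 1 0 Is C1 C2 C12 _ (ltW st) x.
    rewrite addr0 mulN1r mul1r opprB addrC; apply=> y.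
    by rewrite addr0 mulN1r mul1r addrC -[leRHS]normrN opprB ler_norm.
  have := @G_combo _ _ _ _ _ _ _ _ _ _ _ DS _ _ G_evol s t h1 h2 _ 1 (-1) 0 Is C1 C2 C12 _ (ltW st) x.
  rewrite addr0 mulN1r mul1r; apply=> y.
  by rewrite addr0 mulN1r mul1r ler_norm.
have := pointwise_bound DS G_evol mu_evol x Is It st p1 C12 (mu_ball It).
have -> : Lpnorm mu p s (fun x => `|h1 x - h2 x|) = Lpnorm mu p s (h1 \- h2)%R.
  rewrite /Lpnorm.
  have -> : EFin \o (fun y : T => `|h1 y - h2 y|) = (abse \o (EFin \o ((h1 \- h2)%R : T -> R)))%E by [].
  by rewrite Lnorm_abse.
apply: le_trans; rewrite lee_fin.
by apply: le_trans le1 _; exact: ler_norm.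
Qed.

Lemma Lpnorm_triangle s p (f g h : V -> R) : 1 <= p ->
  measurable_fun [set: T] (f : T -> R) -> measurable_fun [set: T] (g : T -> R) ->
  measurable_fun [set: T] (h : T -> R) ->
  (Lpnorm mu p s (f \- h)%R <= Lpnorm mu p s (f \- g)%R + Lpnorm mu p s (h \- g)%R)%E.
Proof.
move=> p1 mf mg mh; rewrite /Lpnorm.
have -> : ((f \- h)%R : T -> R) = (((f \- g) : T -> R) \+ ((g \- h) : T -> R))%R.
  by apply/funext => x /=; rewrite addrA subrK.
apply: le_trans (minkowski_EFin _ _ _ p1) _; try exact: measurable_funB.
rewrite leeD2l//.
have -> : EFin \o ((g \- h)%R : T -> R) = (\- (EFin \o ((h \- g)%R : T -> R)))%E.
  by apply/funext => x /=; rewrite opprB.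
by rewrite oppe_Lnorm.
Qed.

(** The limit is the infimum of the upper envelopes [u m + c m * W]; each lower
    envelope [u n - c n * W] stays below it. *)
Lemma pointwise_limit (u : nat -> V -> R) (c : nat -> R) (W : V -> R) :
  (forall n m x, `|u n x - u m x| <= (c n + c m) * W x) ->
  exists g : V -> R, forall n x, `|u n x - g x| <= c n * W x.
Proof.
move=> H.
have ux n m x : u n x - c n * W x <= u m x + c m * W x.
  by have := H n m x; rewrite ler_norml => /andP[_]; lra.
pose S x := [set u m x + c m * W x | m in [set: nat]].
have S0 x : S x !=set0 by exists (u 0%N x + c 0%N * W x); exists 0%N.
have lbS x n : lbound (S x) (u n x - c n * W x) by move=> _ [m _ <-].
exists (fun x => inf (S x)) => n x.
have h1 : inf (S x) <= u n x + c n * W x.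
  by apply: ge_inf; [exists (u 0%N x - c 0%N * W x)|exists n].
have h2 : u n x - c n * W x <= inf (S x) by apply: lb_le_inf.
by rewrite ler_norml; apply/andP; split; lra.
Qed.

Lemma Lnorm_mono_ae (P : probability T R) (p c : R) (f g : T -> R) : 0 < p -> 0 <= c ->
  measurable_fun [set: T] f -> measurable_fun [set: T] g ->
  {ae P, forall x, `|f x| <= c * `|g x|} ->
  ('N[P]_p%:E[EFin \o f] <= c%:E * 'N[P]_p%:E[EFin \o g])%E.
Proof.
move=> p0 c0 mf mg fg.
have mpow (h : T -> R) : measurable_fun [set: T] h ->
    measurable_fun [set: T] (fun x => (`|h x| `^ p)%:E).
  move=> mh; apply/measurable_EFinP; apply: (@measurableT_comp _ _ _ _ _ _ (@powR R ^~ p)) => //.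
  exact: measurableT_comp.
have le1 : (\int[P]_x (`|f x| `^ p)%:E <= (c `^ p)%:E * \int[P]_x (`|g x| `^ p)%:E)%E.
  rewrite -ge0_integralZl_EFin ?powR_ge0//; last exact: mpow.
  apply: ae_ge0_le_integral => //.
  - exact: mpow.
  - by move=> x _; rewrite mule_ge0// lee_fin powR_ge0.
  - by apply: measurable_funeM; exact: mpow.
  - apply: filterS fg => x h _; rewrite -EFinM lee_fin -powRM//.
    by apply: ge0_ler_powR; rewrite ?nnegrE ?mulr_ge0// ltW.
rewrite unlock /=.
have -> : (c%:E = (c `^ p)%:E `^ p^-1)%E.
  by rewrite poweR_EFin -powRrM mulfV ?gt_eqF// powRr1.
rewrite -poweRM ?lee_fin ?powR_ge0//; last by apply: integral_ge0 => x _; rewrite lee_fin powR_ge0.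
apply: gt0_ler_poweR => //; first by rewrite invr_ge0 ltW.
- by rewrite in_itv /= leey andbT integral_ge0// => x _; rewrite lee_fin powR_ge0.
- rewrite in_itv /= leey andbT mule_ge0 ?lee_fin ?powR_ge0//.
  by apply: integral_ge0 => x _; rewrite lee_fin powR_ge0.
Qed.

Lemma cvg0_squeeze (u : (\bar R)^nat) (c : R) : (forall n, 0 <= u n)%E ->
  (forall n, u n <= (n.+1%:R^-1 * c)%:E)%E -> u n @[n --> \oo] --> 0%E.
Proof.
move=> u0 uc; apply: (@squeeze_cvge _ _ _ _ (cst 0%E) _ (fun n => (n.+1%:R^-1 * c)%:E)).
- by apply: nearW => n; rewrite u0 uc.
- exact: cvg_cst.
- apply: cvg_EFin; first exact: nearW.
  rewrite -(mul0r c); apply: cvgMl; exact: cvg_harmonic.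
Qed.

(** The images of approximating functions converge uniformly with respect to
    the weight, which belongs to every [L^k]: the same limit represents the
    extension in [L^p] and lies in [L^q]. *)
Lemma extension_exists s t p q (f : V -> R) : I s -> I t -> s < t -> 1 < p -> p < q ->
  Lp mu p s f -> exists2 g, Lp_extension G mu p t s f g & Lp mu q t g.
Proof.
move=> Is It st p1 pq fp.
have p0 : 0 < p by exact: lt_trans p1.
have q0 : 0 < q by exact: lt_trans pq.
have q1 : 1 < q by exact: lt_trans pq.
have tau0 : 0 < t - s by rewrite subr_gt0.
have mf : measurable_fun [set: T] (f : T -> R).
  by move: fp; rewrite /Lp inE => /andP[]; rewrite inE.
have approx (n : nat) : exists hn : V -> R, Cb hn /\
    (Lpnorm mu p s (hn \- f)%R <= (n.+1%:R^-1)%:E)%E.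
  have n0 : 0 < n.+1%:R^-1 :> R by rewrite invr_gt0.
  by have [hn Cn Hn] := Lp_density (ltW p1) fp n0; exists hn.
have [h Hh] := boolp.choice approx.
have Ch n := (Hh n).1; have hf n := (Hh n).2.
have mh n : measurable_fun [set: T] (h n : T -> R).
  by apply: borel_continuous; case: (Ch n).
have CG n : Cb (G t s (h n)) by apply: (sol_Cb G_evol) => //; exact: ltW.
have [g Hg] : exists g : V -> R, forall n x,
    `|G t s (h n) x - g x| <= n.+1%:R^-1 * w p (t - s) x.
  apply: pointwise_limit => n m x.
  rewrite -lee_fin; apply: le_trans (difference_bound x Is It st p1 (Ch n) (Ch m)) _.
  rewrite EFinM; apply: lee_wpmul2r; first by rewrite lee_fin ltW// weight_gt0.
  apply: le_trans (Lpnorm_triangle s (ltW p1) (mh n) mf (mh m)) _.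
  by rewrite EFinD leeD.
have mG n : measurable_fun [set: T] (G t s (h n) : T -> R).
  by apply: borel_continuous; case: (CG n).
have mw : measurable_fun [set: T] (w p (t - s) : T -> R).
  by apply: borel_continuous; apply: weight_continuous.
have mg : measurable_fun [set: T] (g : T -> R).
  apply: (measurable_fun_cvg mG) => x _.
  apply/cvgrPdist_le => e e0.
  have : (fun n => n.+1%:R^-1 * w p (t - s) x) @ \oo --> (0 : R).
    rewrite -(mul0r (w p (t - s) x)); apply: cvgMl; exact: cvg_harmonic.
  move=> /cvgrPdist_le/(_ e e0); apply: filterS => n; rewrite sub0r normrN => hn.
  rewrite distrC; apply: le_trans (Hg n x) _; apply: le_trans hn; exact: ler_norm.
have wq k : 0 < k -> Lpnorm mu k t (w p (t - s)) \is a fin_num.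
  move=> k0; rewrite ge0_fin_numE ?Lnorm_ge0//.
  by apply: le_lt_trans (weight_Lnorm p1 k0 tau0 It) _; exact: ltry.
have Gg n k : 0 < k -> (Lpnorm mu k t (G t s (h n) \- g)%R <=
    (n.+1%:R^-1)%:E * Lpnorm mu k t (w p (t - s)))%E.
  move=> k0; apply: Lnorm_mono_ae => //.
    exact: measurable_funB.
  by apply: aeW => x; rewrite (gtr0_norm (weight_gt0 _ _ _)); exact: Hg.
have gk k : 1 <= k -> Lp mu k t g.
  move=> k1; have k0 : 0 < k by exact: lt_le_trans k1.
  rewrite /Lp inE; apply/andP; split; rewrite inE//=.
  have -> : (g : T -> R) = ((G t s (h 0%N) : T -> R) \+ (fun x => -1 * (G t s (h 0%N) x - g x)))%R.
    by apply/funext => x /=; ring.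
  apply: le_lt_trans (minkowski_EFin _ _ _ k1) _ => //.
    by apply: measurable_funM => //; exact: measurable_funB.
  apply: lte_add_pinfty.
    by have := Lp_Cb mu t k1 (CG 0%N); rewrite /Lp inE => /andP[_]; rewrite inE.
  have -> : EFin \o (fun x : T => -1 * (G t s (h 0%N) x - g x)) =
     (\- (EFin \o ((G t s (h 0%N) \- g)%R : T -> R)))%E.
    by apply/funext => x /=; rewrite mulN1r.
  rewrite oppe_Lnorm; apply: le_lt_trans (Gg 0%N k k0) _.
  by rewrite -(fineK (wq k k0)) -EFinM ltry.
exists g; last exact/gk/ltW.
split => //; first exact/gk/ltW.
exists h; split => //.
  apply: (@cvg0_squeeze _ 1) => n; first exact: Lnorm_ge0.
  by rewrite mulr1.
apply: (@cvg0_squeeze _ (fine (Lpnorm mu p t (w p (t - s))))) => n; first exact: Lnorm_ge0.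
by rewrite EFinM fineK ?wq// Gg.
Qed.

(** Any representative [g] of the image inherits the pointwise bound almost
    everywhere: the excess [psi] of [|g|] over [(1 + e)] times the weight is at
    most [|G t s (h n) - g|] for large [n], whose [L^p] norm tends to 0. *)
Lemma opnorm_bound s t p q : I s -> I t -> s < t -> 1 < p -> p < q ->
  (opnorm G mu p q t s <= (super_const p q (t - s))%:E)%E.
Proof.
move=> Is It st p1 pq.
have p0 : 0 < p by exact: lt_trans p1.
have q0 : 0 < q by exact: lt_trans pq.
have tau0 : 0 < t - s by rewrite subr_gt0.
apply: ge_ereal_sup => _ [g [f f1 [fp gp [h [Ch hf Gg]]]] <-].
have mf : measurable_fun [set: T] (f : T -> R).
  by move: fp; rewrite /Lp inE => /andP[]; rewrite inE.
have mg : measurable_fun [set: T] (g : T -> R).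
  by move: gp; rewrite /Lp inE => /andP[]; rewrite inE.
have mw : measurable_fun [set: T] (w p (t - s) : T -> R).
  by apply: borel_continuous; apply: weight_continuous.
have mh n : measurable_fun [set: T] (h n : T -> R).
  by apply: borel_continuous; case: (Ch n).
have mG n : measurable_fun [set: T] (G t s (h n) : T -> R).
  apply: borel_continuous; apply: (sol_continuous G_evol) => //; exact: ltW.
have main (e : R) : 0 < e -> (Lpnorm mu q t g <= ((1 + e) * super_const p q (t - s))%:E)%E.
  move=> e0; have e1 : 0 <= 1 + e by rewrite addr_ge0// ltW.
  rewrite EFinM; apply: le_trans (lee_wpmul2l _ (weight_Lnorm p1 q0 tau0 It)); last by rewrite lee_fin.
  apply: Lnorm_mono_ae => //.
  pose psi (x : T) := Num.max (`|g x| - (1 + e) * w p (t - s) x) 0.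
  have mpsi : measurable_fun [set: T] psi.
    apply: measurable_maxr => //; apply: measurable_funB; first exact: measurableT_comp.
    exact: measurable_funM.
  have hN : \forall n \near \oo, (Lpnorm mu p s (h n) <= (1 + e)%:E)%E.
    have := cvge0_near hf e0; apply: filterS => n hn.
    rewrite /Lpnorm.
    have -> : (h n : T -> R) = ((f : T -> R) \+ ((h n \- f)%R : T -> R))%R.
      by apply/funext => x /=; rewrite addrC subrK.
    apply: le_trans (minkowski_EFin _ _ _ (ltW p1)) _ => //.
      exact: measurable_funB.
    by rewrite EFinD leeD.
  have psi_le : \forall n \near \oo,
      ('N[mu t]_p%:E[EFin \o psi] <= Lpnorm mu p t (G t s (h n) \- g)%R)%E.
    apply: filterS hN => n hn; rewrite -[leRHS]mul1e.
    apply: Lnorm_mono_ae => //; first exact: measurable_funB.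
    apply: aeW => x; rewrite mul1r /= ger0_norm ?le_max ?lexx ?orbT// /psi.
    rewrite ge_max normr_ge0 andbT lerBlDr.
    have := pointwise_bound DS G_evol mu_evol x Is It st p1 (Ch n) (mu_ball It).
    have w0 : (0 <= (w p (t - s) x)%:E)%E by rewrite lee_fin ltW// weight_gt0.
    move=> /(fun h1 => le_trans h1 (lee_wpmul2r w0 hn)).
    rewrite -EFinM lee_fin => h1.
    have := ler_normB (G t s (h n) x) (G t s (h n) x - g x); rewrite subKr.
    by move=> /le_trans; apply; rewrite addrC; apply: lerD.
  have psi0 : ('N[mu t]_p%:E[EFin \o psi] = 0)%E.
    apply/eqP; rewrite eq_le Lnorm_ge0 andbT; apply/lee_addgt0Pr => e' e'0; rewrite add0e.
    have [N _ HN] := filterI psi_le (cvge0_near Gg e'0).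
    by have [h1 h2] := HN N (leqnn N); apply: le_trans h1 h2.
  have := Lnorm_eq0_eq0 _ _ psi0; rewrite lte_fin => /(_ _ p0).
  have mpsi' : measurable_fun [set: T] (EFin \o psi) by exact/measurable_EFinP.
  move=> /(_ mpsi'); apply: filterS => x /(_ Logic.I) /= [] /eqP.
  rewrite (gtr0_norm (weight_gt0 _ _ _)) eq_le /psi => /andP[+ _].
  by rewrite ge_max lexx andbT subr_le0.
apply/lee_addgt0Pr => e e0.
have C0 : 0 < super_const p q (t - s).
  apply: mulr_gt0; first exact: expR_gt0.
  apply: powR_gt0; apply: Mg_gt0; apply: mulr_gt0; last exact: divr_gt0.
  by apply: mulr_gt0 => //; exact: (kappa_gt0 DS).
have := main (e / super_const p q (t - s)); rewrite divr_gt0// => /(_ isT).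
by rewrite mulrDl mul1r divfK ?gt_eqF// -EFinD.
Qed.

End SuperFromGaussian.

(** * Gaussian integrability implies supercontractivity *)

Section GaussianImpliesSuper.
Variables (R : realType) (d : nat).
Local Notation V := 'rV[R]_d.
Local Notation T := (borelV R d).
Variables (I : set R) (Q : R -> 'M[R]_d) (b : R -> V -> V).
Variables (eta0 Lambda a : R) (phi : V -> R) (gphi : V -> V)
  (Hphi : V -> 'M[R]_d).
Hypothesis DS : dissipative_setting I Q b eta0 Lambda a phi gphi Hphi.
Variables (theta : R) (G : R -> R -> (V -> R) -> V -> R).
Hypothesis G_evol : evolution_operator I Q b theta G.
Variable mu : R -> probability T R.
Hypothesis mu_evol : evolution_system_of_measures I G mu.
Hypothesis mu_tight : tight_family I mu.

Lemma Lpnorm1_gauss s (lambda : R) : Lpnorm mu 1 s (gauss_weight lambda) =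
  (\int[mu s]_x (gauss_weight lambda (x : V))%:E)%E.
Proof.
rewrite /Lpnorm Lnorm1; apply: eq_integral => x _.
by rewrite /= ger0_norm ?expR_ge0.
Qed.

(** The required behaviour of the constant, strictly decreasing and infinite at
    0, is that of the exponential factor of [super_const]; the factor [Mg] is
    nondecreasing in its argument and at least 1. *)
Lemma super_of_gaussian : I !=set0 ->
  (forall lambda : R, 0 < lambda ->
     (ereal_sup [set Lpnorm mu 1 s (gauss_weight lambda) | s in I] < +oo)%E) ->
  supercontractive I G mu.
Proof.
move=> [s0 Is0] fin_sup.
pose S (lambda : R) := ereal_sup [set Lpnorm mu 1 s (gauss_weight lambda) | s in I].
pose Mg (lambda : R) := fine (S lambda).
have S_ge lambda t : I t -> (\int[mu t]_x (gauss_weight lambda (x : V))%:E <= S lambda)%E.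
  by move=> It; rewrite -Lpnorm1_gauss; apply: ereal_sup_ubound; exists t.
have S_ge1 lambda : 0 < lambda -> (1 <= S lambda)%E.
  move=> l0; apply: le_trans (S_ge lambda s0 Is0).
  rewrite -[leLHS](integral_prob_cst (mu s0) 1).
  apply: ge0_le_integral => //.
  - by apply/measurable_EFinP; exact: measurable_gauss_weight.
  - move=> x _; rewrite lee_fin -expR0 ler_expR.
    by rewrite mulr_ge0 ?sqr_ge0// ltW.
have MgE lambda : 0 < lambda -> (Mg lambda)%:E = S lambda.
  move=> l0; rewrite fineK// ge0_fin_numE; first exact: fin_sup.
  by apply: le_trans (S_ge1 _ l0).
have Mg_bound lambda t : 0 < lambda -> I t ->
    (\int[mu t]_x (gauss_weight lambda (x : V))%:E <= (Mg lambda)%:E)%E.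
  by move=> l0 It; rewrite MgE// S_ge.
have Mg_ge1 lambda : 0 < lambda -> 1 <= Mg lambda.
  by move=> l0; rewrite -lee_fin MgE// S_ge1.
have Mg_gt0 lambda : 0 < lambda -> 0 < Mg lambda.
  by move=> l0; apply: lt_le_trans (Mg_ge1 _ l0).
have Mg_mono l l' : 0 < l -> l <= l' -> Mg l <= Mg l'.
  move=> l0 ll; have l'0 := lt_le_trans l0 ll.
  rewrite -lee_fin !MgE//; apply: ge_ereal_sup => _ [t It <-].
  apply: le_trans (S_ge l' t It); rewrite Lpnorm1_gauss.
  apply: ge0_le_integral => //.
  - by move=> x _; rewrite lee_fin expR_ge0.
  - by apply/measurable_EFinP; exact: measurable_gauss_weight.
  - by apply/measurable_EFinP; exact: measurable_gauss_weight.
  - by move=> x _; rewrite lee_fin ler_expR ler_wpM2r// sqr_ge0.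
have half0 : (0 : R) < 2^-1 by rewrite invr_gt0.
have [r [r0 Hr]] := mu_tight half0.
have mu_ball t : I t -> (2^-1%:E <= mu t (@eball R d r))%E.
  move=> It; apply: le_trans (Hr t It); rewrite lee_fin.
  by lra.
move=> p q p1 pq.
have p0 : 0 < p by exact: lt_trans p1.
have q0 : 0 < q by exact: lt_trans pq.
split.
  move=> t s Is It st f fp.
  exact: (extension_exists DS G_evol mu_evol mu_ball Mg_bound Mg_gt0 Is It st p1 pq fp).
pose C := super_const eta0 r Mg p q.
have k0 tau : 0 < tau -> 0 < kappa eta0 p tau by exact: (kappa_gt0 DS).
have qp0 : 0 < q / p by exact: divr_gt0.
have arg0 tau : 0 < tau -> 0 < 2 * kappa eta0 p tau * (q / p).
  by move=> t0; apply: mulr_gt0 => //; apply: mulr_gt0 => //; exact: k0.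
have c0 : 0 < 4 * eta0 * (1 - p^-1).
  by rewrite mulr_gt0 ?subr_gt0 ?invf_lt1// mulr_gt0// (ds_eta0 DS).
have kE tau : kappa eta0 p tau = (4 * eta0 * (1 - p^-1))^-1 / tau by rewrite /kappa invfM.
exists C; split.
- move=> tau t0; apply: mulr_gt0; first exact: expR_gt0.
  by apply: powR_gt0; apply: Mg_gt0; exact: arg0.
- move=> t1 t2 t10 t12; have t20 := lt_trans t10 t12.
  have kk : kappa eta0 p t2 < kappa eta0 p t1.
    by rewrite !kE ltr_pM2l ?invr_gt0// ltf_pV2 ?posrE.
  have B20 : 0 < Mg (2 * kappa eta0 p t2 * (q / p)) `^ q^-1.
    by apply: powR_gt0; apply: Mg_gt0; exact: arg0.
  apply: (@lt_le_trans _ _ (expR (p^-1 * (ln 2 + 2 * kappa eta0 p t1 * r ^+ 2)) *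
      Mg (2 * kappa eta0 p t2 * (q / p)) `^ q^-1)).
    rewrite /C /super_const ltr_pM2r// ltr_expR ltr_pM2l ?invr_gt0// ltrD2l.
    by rewrite ltr_pM2r ?exprn_gt0// ltr_pM2l.
  apply: ler_wpM2l; first exact: expR_ge0.
  apply: ge0_ler_powR.
  - by rewrite invr_ge0 ltW.
  - by rewrite nnegrE ltW// Mg_gt0// arg0.
  - by rewrite nnegrE ltW// Mg_gt0// arg0.
  - by apply: Mg_mono; [exact: arg0|rewrite ler_pM2r// ler_pM2l// ltW].
- (* [C tau >= D / tau], from [1 + u <= expR u]. *)
  pose D := p^-1 * (2 * (4 * eta0 * (1 - p^-1))^-1 * r ^+ 2).
  have D0 : 0 < D by rewrite /D !mulr_gt0 ?invr_gt0 ?exprn_gt0.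
  have CD tau : 0 < tau -> D / tau <= C tau.
    move=> t0; have B1 : 1 <= Mg (2 * kappa eta0 p tau * (q / p)) `^ q^-1.
      apply: (@le_trans _ _ (1 `^ q^-1)); first by rewrite powR1.
      apply: ge0_ler_powR; rewrite ?nnegrE//.
      - by rewrite invr_ge0 ltW.
      - by rewrite ltW// Mg_gt0// arg0.
      - by rewrite Mg_ge1// arg0.
    apply: (@le_trans _ _ (expR (p^-1 * (ln 2 + 2 * kappa eta0 p tau * r ^+ 2)))); last first.
      by apply: ler_peMr; first exact: expR_ge0.
    apply: le_trans (expR_ge1Dx _).
    have l2 : 0 <= p^-1 * ln 2 by rewrite mulr_ge0 ?ln_ge0 ?invr_ge0 ?ltW// ?ltr1n.
    have -> : D / tau = p^-1 * (2 * kappa eta0 p tau * r ^+ 2).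
      by rewrite /D kE; ring.
    rewrite mulrDr; lra.
  apply/cvgryPge => A; near=> tau.
  have t0 : 0 < tau by near: tau; exact: nbhs_right_gt.
  apply: le_trans (CD _ t0); rewrite ler_pdivlMr//.
  have A1 : 0 < `|A| + 1 by rewrite ltr_wpDl.
  apply: (@le_trans _ _ ((`|A| + 1) * tau)).
    rewrite ler_pM2r//; apply: le_trans (ler_norm A) _; by rewrite lerDl.
  rewrite mulrC -ler_pdivlMr// ltW//.
  by near: tau; apply: nbhs_right_lt; rewrite divr_gt0.
- move=> t s Is It st.
  exact: (opnorm_bound DS G_evol mu_evol mu_ball Mg_bound Mg_gt0 Is It st p1 pq).
Unshelve. all: by end_near. Qed.

End GaussianImpliesSuper.

(** * A recursion for exponential moments *)

Section SuperImpliesGaussian.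
Variables (R : realType) (d : nat).
Local Notation V := 'rV[R]_d.
Local Notation T := (borelV R d).
Variables (I : set R) (Q : R -> 'M[R]_d) (b : R -> V -> V).
Variables (eta0 Lambda a : R) (phi : V -> R) (gphi : V -> V)
  (Hphi : V -> 'M[R]_d).
Hypothesis DS : dissipative_setting I Q b eta0 Lambda a phi gphi Hphi.
Variables (theta : R) (G : R -> R -> (V -> R) -> V -> R).
Hypothesis G_evol : evolution_operator I Q b theta G.
Variable mu : R -> probability T R.
Hypothesis mu_evol : evolution_system_of_measures I G mu.

Definition mean (s : R) (f : V -> R) : R :=
  fine (\int[mu s]_x ((f : T -> R) x)%:E)%E.

Lemma meanE s f : Cb f -> (\int[mu s]_x ((f : T -> R) x)%:E = (mean s f)%:E)%E.
Proof.
by move=> Cf; rewrite fineK//; apply: integrable_fin_num => //; exact: Cb_integrable.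
Qed.

Lemma mean_mono s f g : Cb f -> Cb g -> (forall x, f x <= g x) ->
  mean s f <= mean s g.
Proof.
move=> Cf Cg fg; rewrite -lee_fin -!meanE//; apply: le_integral => //.
- exact: Cb_integrable.
- exact: Cb_integrable.
- by move=> x _; rewrite lee_fin.
Qed.

Lemma mean_cst s c : mean s (fun=> c) = c.
Proof. by rewrite /mean integral_prob_cst. Qed.

Lemma Cb_cst (c : R) : Cb (fun _ : V => c).
Proof. by split; [exact: cont_cst|exists `|c|]. Qed.

Lemma Cb_scale (c : R) (f : V -> R) : Cb f -> Cb (fun x => c * f x).
Proof. by move=> Cf; have := Cb_affine c 0 Cf; under eq_fun do rewrite addr0. Qed.

Lemma mean_scale s c f : Cb f -> mean s (fun x => c * f x) = c * mean s f.
Proof.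
move=> Cf; apply: EFin_inj; rewrite -meanE; last exact: Cb_scale.
rewrite EFinM -meanE// -integralZl//; exact: Cb_integrable.
Qed.

Lemma mean_exp_gt0 s h : Cb h -> 0 < mean s (fun x => expR (h x)).
Proof.
move=> Ch; have [_ [M HM]] := Ch.
apply: (@lt_le_trans _ _ (expR (- M))); first exact: expR_gt0.
rewrite -[leLHS](mean_cst s); apply: mean_mono; [exact: Cb_cst|exact: Cb_exp|].
by move=> x; rewrite ler_expR; have := HM x; rewrite ler_norml => /andP[].
Qed.

Lemma Cb_extension s t p f : I s -> s <= t -> 1 <= p -> Cb f ->
  Lp_extension G mu p t s f (G t s f).
Proof.
move=> Is st p1 Cf; have p0 : 0 < p by exact: lt_le_trans p1.
have zero r (u : V -> R) : Lpnorm mu p r (u \- u)%R = 0%E.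
  rewrite /Lpnorm (_ : EFin \o _ = cst 0%E); first by rewrite Lnorm0// eqe gt_eqF.
  by apply/funext => x /=; rewrite subrr.
split; [exact: Lp_Cb|apply: Lp_Cb => //; exact: (sol_Cb G_evol)|].
by exists (fun=> f); split => //; rewrite zero; exact: cvg_cst.
Qed.

(** Take [f = e^(h/4 + k)] with [k] chosen so that [f] has norm 1 in [L^2 (mu s)].
    The reverse Jensen inequality bounds [G t s e^h] by the exponential of
    [G t s h], the Jensen inequality bounds the latter by the fourth power of
    [G t s f], and the [L^2]-[L^4] bound controls the integral of that power. *)
Lemma exp_step s t h L c : I s -> I t -> s < t -> Cb h -> 0 < L ->
  (forall x y, h x - h y <= L * enorm (x - y)) -> 0 <= c ->
  (opnorm G mu 2 4 t s <= c%:E)%E ->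
  mean s (fun x => expR (h x)) <= expR (Lambda * L ^+ 2 * (t - s)) * c ^+ 4 *
    mean s (fun x => expR (2^-1 * h x)) ^+ 2.
Proof.
move=> Is It st Ch L0 lip c0 op.
have Ch2 : Cb (fun x => 2^-1 * h x) by exact: Cb_scale.
set J := mean s (fun x => expR (2^-1 * h x)).
have J0 : 0 < J by exact: mean_exp_gt0.
have JE : J = expR (ln J) by rewrite lnK ?posrE.
(* With this [k] the square of [expR (4^-1 * h + k)] has integral 1. *)
pose k := - (2^-1 * ln J).
pose h' x := 4^-1 * h x + k.
have Ch' : Cb h' by exact: Cb_affine.
pose f x := expR (h' x).
have Cf : Cb f by exact: Cb_exp.
have CG : Cb (G t s f) by apply: (sol_Cb G_evol) => //; exact: ltW.
have CGh : Cb (G t s h) by apply: (sol_Cb G_evol) => //; exact: ltW.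
have Gf0 x : 0 < G t s f x by apply: (G_exp_gt0 DS G_evol) => //; exact: ltW.
have f1 : (Lpnorm mu 2 s f <= 1)%E.
  apply: Lnorm_le => //; rewrite powR1.
  rewrite (eq_integral (fun x : T => (expR (2 * k) * expR (2^-1 * h (x : V)))%:E)); last first.
    move=> x _; congr (_%:E); rewrite ger0_norm ?expR_ge0// /f -expRM -expRD.
    by congr expR; rewrite /h'; field.
  rewrite (meanE s (f := fun x => expR (2 * k) * expR (2^-1 * h x))); last first.
    by apply: Cb_scale; exact: Cb_exp.
  rewrite mean_scale; last exact: Cb_exp.
  rewrite -/J lee_fin [X in _ * X]JE -expRD /k.
  by rewrite (_ : _ + _ = 0) ?expR0//; field.
have N4 : (Lpnorm mu 4 t (G t s f) <= c%:E)%E.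
  apply: le_trans op; apply: ereal_sup_ubound; exists (G t s f) => //.
  by exists f => //; apply: Cb_extension => //; [exact: ltW|rewrite ler1n].
have jensen x : expR (G t s h x + 4 * k) <= G t s f x ^+ 4.
  have := G_exp_jensen DS G_evol Is Ch Ch' (fun x => lexx _) (ltW st) x.
  rewrite -/f => h1.
  have {}h1 : expR (4^-1 * G t s h x + k) <= G t s f x.
    by rewrite -[leRHS]lnK ?posrE// ler_expR.
  have -> : G t s h x + 4 * k = 4%:R * (4^-1 * G t s h x + k) by field.
  by rewrite expRM_natl lerXn2r ?nnegrE ?expR_ge0// ltW.
have C4 : Cb (fun x => G t s f x ^+ 4).
  have [cG [M HM]] := CG; split.
    by apply: (@cont_map _ _ (fun y : R => y ^+ 4)) => //; exact: exprn_continuous.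
  by exists (M ^+ 4) => x; rewrite normrX lerXn2r ?nnegrE// (le_trans _ (HM x)).
have int4 : mean t (fun x => G t s f x ^+ 4) <= c ^+ 4.
  rewrite -lee_fin -meanE//.
  have p4 : ('N[mu t]_4%:E[EFin \o (G t s f : T -> R)] `^ 4 <= c%:E `^ 4)%E.
    apply: gt0_ler_poweR => //.
    - by rewrite in_itv /= leey andbT Lnorm_ge0.
    - by rewrite in_itv /= leey andbT lee_fin.
  rewrite poweR_Lnorm ?gt_eqF// in p4.
  rewrite poweR_EFin powR_mulrn// in p4.
  apply: le_trans p4; rewrite le_eqVlt; apply/orP; left; apply/eqP; apply: eq_integral => x _ /=.
  by rewrite ger0_norm ?ltW// powR_mulrn// ltW.
have step1 : mean s (fun x => expR (h x)) = mean t (G t s (fun x => expR (h x))).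
  by rewrite /mean (mu_evol Is It st (Cb_exp Ch)).
pose e1 := Lambda * L ^+ 2 * (t - s) - 4 * k.
rewrite step1; apply: (@le_trans _ _ (expR e1 * mean t (fun x => G t s f x ^+ 4))).
  rewrite -mean_scale//; apply: mean_mono.
  - by apply: (sol_Cb G_evol) => //; [exact: Cb_exp|exact: ltW].
  - exact: Cb_scale.
  - move=> x; have u0 := G_exp_gt0 DS G_evol x Is Ch (ltW st).
    have := G_exp_upper DS G_evol x Is Ch (ltW st) L0 lip.
    rewrite -ler_expR lnK ?posrE// => /le_trans; apply.
    apply: (@le_trans _ _ (expR e1 * expR (G t s h x + 4 * k))).
      by rewrite -expRD ler_expR /e1; lra.
    by rewrite ler_pM2l ?expR_gt0.
apply: (@le_trans _ _ (expR e1 * c ^+ 4)); first by rewrite ler_pM2l ?expR_gt0.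
have -> : expR e1 = expR (Lambda * L ^+ 2 * (t - s)) * J ^+ 2.
  rewrite /e1 expRD; congr (_ * _); rewrite [X in X ^+ 2]JE.
  by rewrite -expRM_natl; congr expR; rewrite /k; field.
by rewrite le_eqVlt mulrAC eqxx.
Qed.

End SuperImpliesGaussian.

(** * Exponential moments of the norm *)

Section TruncatedNorm.
Variables (R : realType) (d : nat).
Local Notation V := 'rV[R]_d.

Lemma cauchy_schwarz (x y : V) : dotv x y <= enorm x * enorm y.
Proof.
have x0 := enorm_ge0 x; have y0 := enorm_ge0 y.
have [/eqP|xy0] := eqVneq (enorm x * enorm y) 0.
  rewrite mulf_eq0 => /orP[] /eqP z0; rewrite z0 ?mul0r ?mulr0.
    have [->|/dotvv_gt0] := eqVneq x 0; first by rewrite dotv0l.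
    by rewrite -enorm_sqr z0 expr0n ltxx.
  have [->|/dotvv_gt0] := eqVneq y 0; first by rewrite dotv0r.
  by rewrite -enorm_sqr z0 expr0n ltxx.
have p0 : 0 < enorm x * enorm y by rewrite lt_neqAle eq_sym xy0 mulr_ge0.
have := dotvv_ge0 (enorm y *: x - enorm x *: y).
rewrite !(dotvDl, dotvDr, dotvNl, dotvNr, dotvZl, dotvZr) -!enorm_sqr (dotvC y x).
move=> h; have : 0 <= 2 * (enorm x * enorm y) * (enorm x * enorm y - dotv x y).
  by apply: le_trans h _; rewrite le_eqVlt; apply/orP; left; apply/eqP; ring.
by rewrite pmulr_rge0 ?subr_ge0// mulr_gt0.
Qed.

Lemma enorm_triangle (x y : V) : enorm x - enorm y <= enorm (x - y).
Proof.
rewrite lerBlDr -(@ler_pXn2r R 2)// ?nnegrE ?addr_ge0 ?enorm_ge0//.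
rewrite sqrrD !enorm_sqr -{1 2}(subrK y x).
move: (x - y) => z; rewrite dotvDl !dotvDr (dotvC y z).
have := cauchy_schwarz z y; lra.
Qed.

(** Truncation keeps the functions in [Cb]; all the bounds below are uniform in
    the level [N], which finally tends to infinity. *)
Definition trunc_norm (N : R) (x : V) : R := Num.min (enorm x) N.

Lemma trunc_norm_ge0 N x : 0 <= N -> 0 <= trunc_norm N x.
Proof. by move=> N0; rewrite le_min enorm_ge0. Qed.

Lemma trunc_norm_le N x : trunc_norm N x <= N.
Proof. by rewrite ge_min lexx orbT. Qed.

Lemma trunc_norm_le_enorm N x : trunc_norm N x <= enorm x.
Proof. by rewrite ge_min lexx. Qed.

Lemma Cb_trunc_norm N : 0 <= N -> Cb (trunc_norm N).
Proof.
move=> N0; split.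
  apply: (@cont_map _ _ (fun y : R => Num.min y N)); last exact: continuous_enorm.
  by move=> r; apply: (@continuous_min _ _ id (cst N) r); [exact: cvg_id|exact: cvg_cst].
by exists N => x; rewrite ger0_norm ?trunc_norm_le// trunc_norm_ge0.
Qed.

Lemma trunc_norm_lip N x y : trunc_norm N x - trunc_norm N y <= enorm (x - y).
Proof.
have := enorm_triangle x y; have := enorm_ge0 (x - y); rewrite /trunc_norm.
by have [?|/ltW ?] := leP (enorm x) N; have [?|/ltW ?] := leP (enorm y) N; lra.
Qed.

Lemma trunc_norm_mono N N' x : N <= N' -> trunc_norm N x <= trunc_norm N' x.
Proof. by move=> NN; rewrite le_min ge_min lexx /= ge_min NN orbT. Qed.

End TruncatedNorm.

Section GaussianBound.
Variables (R : realType) (d : nat).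
Local Notation V := 'rV[R]_d.
Local Notation T := (borelV R d).
Variables (I : set R) (Q : R -> 'M[R]_d) (b : R -> V -> V).
Variables (eta0 Lambda a : R) (phi : V -> R) (gphi : V -> V)
  (Hphi : V -> 'M[R]_d).
Hypothesis DS : dissipative_setting I Q b eta0 Lambda a phi gphi Hphi.
Variables (theta : R) (G : R -> R -> (V -> R) -> V -> R).
Hypothesis G_evol : evolution_operator I Q b theta G.
Variable mu : R -> probability T R.
Hypothesis mu_evol : evolution_system_of_measures I G mu.
Hypothesis mu_tight : tight_family I mu.
Variable C : R -> R.
Hypothesis C_gt0 : forall tau, 0 < tau -> 0 < C tau.
Hypothesis C_op : forall t s, I s -> I t -> s < t ->
  (opnorm G mu 2 4 t s <= (C (t - s))%:E)%E.

Let F (s N lambda : R) := mean mu s (fun x => expR (lambda * trunc_norm N x)).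

Let Cb_l (N lambda : R) : 0 <= N -> Cb (fun x : V => lambda * trunc_norm N x).
Proof. by move=> N0; apply: Cb_scale; exact: Cb_trunc_norm. Qed.

Lemma mgf_step s N lambda tau : I s -> 0 <= N -> 0 < lambda -> 0 < tau ->
  F s N lambda <= expR (Lambda * lambda ^+ 2 * tau) * C tau ^+ 4 *
    F s N (lambda / 2) ^+ 2.
Proof.
move=> Is N0 l0 t0.
have It : I (s + tau) by apply: (ds_up DS Is); rewrite lerDl ltW.
have st : s < s + tau by rewrite ltrDl.
have tE : s + tau - s = tau by rewrite addrAC subrr add0r.
have := @exp_step _ _ _ _ _ _ _ _ _ _ _ DS _ _ G_evol mu mu_evol s (s + tau)
   (fun x => lambda * trunc_norm N x) lambda (C tau) Is It st (Cb_l lambda N0) l0.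
rewrite tE (_ : (fun x => expR (2^-1 * _)) = (fun x => expR (lambda / 2 * trunc_norm N x))); last first.
  by apply/funext => x; congr expR; ring.
apply.
- by move=> x y; rewrite -mulrBr ler_pM2l// trunc_norm_lip.
- by rewrite ltW// C_gt0.
- by rewrite -{2}tE; exact: C_op.
Qed.

Lemma mean_add s f g : Cb f -> Cb g ->
  mean mu s (fun x => f x + g x) = mean mu s f + mean mu s g.
Proof.
move=> Cf Cg; apply: EFin_inj; rewrite EFinD -!meanE//; last first.
  by have := Cb_lin 1 Cf Cg; under eq_fun do rewrite mul1r.
by rewrite -integralD//; exact: Cb_integrable.
Qed.

(** The recursion [mgf_step] bounds [F 1] by [A * F (1/2) ^ 2] only. Tightness
    closes it: outside of a ball of radius [r] and small complement the
    Cauchy-Schwarz inequality gives [F (1/2) <= e^(r/2) + sg * sqrt (F 1)], and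
    the last term is absorbed once [sg] is small compared with [A]. *)
Lemma mgf_one_bound : exists2 B, 1 <= B & forall s N, I s -> 0 <= N -> F s N 1 <= B.
Proof.
pose A := Num.max 1 (expR (Lambda * 1 ^+ 2 * 1) * C 1 ^+ 4).
have A1 : 1 <= A by rewrite le_max lexx.
have A0 : 0 < A by exact: lt_le_trans A1.
(* Chosen so that [2 * A * sg ^ 2 <= 1/2]. *)
pose sg := (2 * A)^-1.
have sg0 : 0 < sg by rewrite invr_gt0 mulr_gt0.
have [r [r0 Hr]] := mu_tight (exprn_gt0 2 sg0).
exists (4 * A * expR r).
  apply: (@le_trans _ _ (1 * 1)); first by rewrite mulr1.
  apply: ler_pM => //; first lra.
  by rewrite -expR0 ler_expR ltW.
move=> s N Is N0.
have F0 : 0 < F s N 1 by apply: mean_exp_gt0; exact: Cb_l.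
pose y := Num.sqrt (F s N 1).
have y0 : 0 < y by rewrite sqrtr_gt0.
have yy : y ^+ 2 = F s N 1 by rewrite sqr_sqrtr// ltW.
have half : F s N (1 / 2) <= expR (r / 2) + sg * y.
  pose Bc : set T := ~` (@eball R d r).
  have mB : measurable (@eball R d r : set T) by exact: measurable_eball.
  have mBc : measurable Bc by exact: measurableC.
  have muBc : (mu s Bc <= (sg ^+ 2)%:E)%E.
    rewrite probability_setC// leeBlDr ?fin_num_measure// -leeBlDl//.
    exact: Hr.
  (* The weight that balances the two terms of [z <= ep / 2 * z ^ 2 + (2 * ep)^-1]
     after integration. *)
  pose ep := sg / y.
  have ep0 : 0 < ep by exact: divr_gt0.
  have pt (x : V) : expR (1 / 2 * trunc_norm N x) <=
     expR (r / 2) + ep / 2 * expR (1 * trunc_norm N x) + (2 * ep)^-1 * \1_Bc (x : T).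
    have [xB|xB] := pselect (@eball R d r x).
      have -> : \1_Bc (x : T) = 0 :> R by rewrite indicE memNset.
      rewrite mulr0 addr0; apply: (@le_trans _ _ (expR (r / 2))).
        rewrite ler_expR div1r mulrC ler_pM2r ?invr_gt0//.
        exact: le_trans (trunc_norm_le_enorm N x) (ltW xB).
      by rewrite lerDl mulr_ge0 ?expR_ge0// ltW// divr_gt0.
    have -> : \1_Bc (x : T) = 1 :> R by rewrite indicE mem_set.
    have -> : expR (1 * trunc_norm N x) = expR (1 / 2 * trunc_norm N x) ^+ 2.
      by rewrite -expRM_natl; congr expR; field.
    move: (expR (1 / 2 * _)) => z; rewrite mulr1.
    have : 0 <= (2 * ep)^-1 * (ep * z - 1) ^+ 2 by rewrite mulr_ge0 ?sqr_ge0// invr_ge0 ltW// mulr_gt0.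
    have -> : (2 * ep)^-1 * (ep * z - 1) ^+ 2 = ep / 2 * z ^+ 2 - z + (2 * ep)^-1.
      by field; rewrite gt_eqF.
    have := expR_ge0 (r / 2); lra.
  have Ce1 : Cb (fun x : V => expR (1 * trunc_norm N x)) by apply: Cb_exp; exact: Cb_l.
  have Ce2 : Cb (fun x : V => expR (1 / 2 * trunc_norm N x)) by apply: Cb_exp; exact: Cb_l.
  have Cs : Cb (fun x : V => expR (r / 2) + ep / 2 * expR (1 * trunc_norm N x)).
    by apply: Cb_lin => //; exact: Cb_cst.
  have le1 : ((F s N (1 / 2))%:E <= (expR (r / 2) + ep / 2 * F s N 1)%:E + ((2 * ep)^-1)%:E * mu s Bc)%E.
    rewrite /F -(meanE mu s Ce2).
    have -> : (expR (r / 2) + ep / 2 * mean mu s (fun x => expR (1 * trunc_norm N x)))%:E =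
       (\int[mu s]_x ((expR (r / 2) + ep / 2 * expR (1 * trunc_norm N (x : V)))%:E))%E.
      rewrite (meanE mu s Cs) mean_add ?mean_scale ?mean_cst//; first exact: Cb_cst.
      exact: Cb_scale.
    have -> : mu s Bc = (\int[mu s]_x (\1_Bc x)%:E)%E by rewrite integral_indic// setIT.
    have mind : measurable_fun [set: T] (fun x : T => (\1_Bc x)%:E : \bar R).
      by apply/measurable_EFinP; exact: measurable_indic.
    have mC (u : V -> R) : Cb u -> measurable_fun [set: T] (fun x : T => (u x)%:E : \bar R).
      by move=> Cu; apply: (measurable_int (mu s)); exact: Cb_integrable.
    have ep2 : 0 <= (2 * ep)^-1 by rewrite invr_ge0 ltW// mulr_gt0.
    rewrite -ge0_integralZl_EFin//.
    have s0 (x : V) : 0 <= expR (r / 2) + ep / 2 * expR (1 * trunc_norm N x).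
      by rewrite addr_ge0 ?expR_ge0// mulr_ge0 ?expR_ge0// ltW// divr_gt0.
    rewrite -ge0_integralD//; last 4 first.
    - by move=> x _; rewrite lee_fin s0.
    - exact: mC.
    - by move=> x _; rewrite -EFinM lee_fin mulr_ge0.
    - exact: measurable_funeM.
    apply: ge0_le_integral => //.
    - exact: mC.
    - by apply: emeasurable_funD; [exact: mC|exact: measurable_funeM].
    - by move=> x _; rewrite -EFinM -EFinD lee_fin pt.
  rewrite -lee_fin; apply: le_trans le1 _.
  apply: (@le_trans _ _ ((expR (r / 2) + ep / 2 * F s N 1)%:E + ((2 * ep)^-1)%:E * (sg ^+ 2)%:E)%E).
    by rewrite leeD2l// lee_wpmul2l// lee_fin invr_ge0 ltW// mulr_gt0.
  rewrite -EFinM -EFinD lee_fin -yy /ep le_eqVlt; apply/orP; left; apply/eqP.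
  by field; rewrite !gt_eqF.
have F20 : 0 <= F s N (1 / 2) by rewrite ltW// mean_exp_gt0//; exact: Cb_l.
have st := mgf_step Is N0 ltr01 ltr01.
have : F s N 1 <= A * (expR (r / 2) + sg * y) ^+ 2.
  apply: le_trans st _; apply: ler_pM.
  - by rewrite mulr_ge0 ?expR_ge0// exprn_ge0// ltW// C_gt0.
  - exact: sqr_ge0.
  - by rewrite le_max lexx orbT.
  - apply: lerXn2r => //; rewrite nnegrE; apply: addr_ge0; first exact: expR_ge0.
    by rewrite mulr_ge0// ltW.
have e2 : expR (r / 2) ^+ 2 = expR r by rewrite -expRM_natl; congr expR; field.
have sq : (expR (r / 2) + sg * y) ^+ 2 <= 2 * expR r + 2 * sg ^+ 2 * F s N 1.
  rewrite -e2 -yy; have := sqr_ge0 (expR (r / 2) - sg * y); rewrite !sqrrD exprMn.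
  lra.
move=> h1; have h2 := le_trans h1 (ler_wpM2l (ltW A0) sq).
have sgE : A * (2 * sg ^+ 2) <= 2^-1.
  rewrite /sg exprVn; have -> : A * (2 * (2 * A) ^- 2) = 2^-1 * A^-1 by field; rewrite gt_eqF.
  by rewrite ler_piMr// invf_le1.
have h3 : A * (2 * sg ^+ 2) * F s N 1 <= 2^-1 * F s N 1 by rewrite ler_wpM2r// ltW.
lra.
Qed.

(** [lambda] is halved until it lies between 1/2 and 1. The quadratic term
    [2 * Lambda * tau * lambda ^ 2] is the fixed point of
    [q = Lambda * tau * lambda ^ 2 + 2 * q / 4], and the constant [- K] in the
    induction hypothesis absorbs the factor [C tau ^ 4] of each step. *)
Lemma mgf_bound tau : 0 < tau -> exists2 D, 0 <= D &
  forall s N lambda, I s -> 0 <= N -> 2^-1 <= lambda ->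
    F s N lambda <= expR (2 * Lambda * tau * lambda ^+ 2 + D * lambda).
Proof.
move=> t0.
have [B B1 HB] := mgf_one_bound.
pose A := Num.max 1 (C tau ^+ 4).
have A1 : 1 <= A by rewrite le_max lexx.
pose be := ln B; pose K := ln A.
have be0 : 0 <= be by exact: ln_ge0.
have K0 : 0 <= K by exact: ln_ge0.
have BE : expR be = B by rewrite lnK ?posrE// (lt_le_trans ltr01).
have AE : expR K = A by rewrite lnK ?posrE// (lt_le_trans ltr01).
have Lam0 := ds_Lambda DS.
exists (2 * (be + K)) => [|s N lambda Is N0]; first by rewrite mulr_ge0// addr_ge0.
suff main n l : 2^-1 <= l -> l <= 2 ^+ n ->
    F s N l <= expR (2 * Lambda * tau * l ^+ 2 + 2 * (be + K) * l - K).
  move=> l2.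
  have [n ln] : exists n, lambda <= 2 ^+ n.
    exists (Num.truncn lambda).+1; apply/ltW.
    have l0 : 0 <= lambda by apply: le_trans l2; rewrite invr_ge0.
    apply: (@lt_le_trans _ _ (Num.truncn lambda).+1%:R).
      by rewrite Num.Theory.truncnS_gt.
    by rewrite -natrX ler_nat ltnW// ltn_expl.
  apply: le_trans (main n lambda l2 ln) _; rewrite ler_expR; lra.
elim: n l => [|n IHn] l l2 ln.
  apply: (@le_trans _ _ B).
    apply: le_trans (HB s N Is N0); apply: mean_mono.
    - by apply: Cb_exp; exact: Cb_l.
    - by apply: Cb_exp; exact: Cb_l.
    - by move=> x; rewrite ler_expR ler_wpM2r// trunc_norm_ge0.
  rewrite -BE ler_expR.
  have : 0 <= 2 * Lambda * tau * l ^+ 2 by rewrite mulr_ge0 ?sqr_ge0// ltW// !mulr_gt0.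
  have : 0 <= (be + K) * (2 * l - 1).
    apply: mulr_ge0; first exact: addr_ge0.
    by rewrite subr_ge0 -ler_pdivrMl// mulr1.
  lra.
have [l1|l1] := leP l 1.
  apply: IHn => //; apply: le_trans l1 _; rewrite -natrX ler1n expn_gt0//.
have l0 : 0 < l by exact: lt_trans l1.
apply: le_trans (mgf_step Is N0 l0 t0) _.
have hl : F s N (l / 2) <= expR (2 * Lambda * tau * (l / 2) ^+ 2 + 2 * (be + K) * (l / 2) - K).
  apply: IHn; first by rewrite ler_pdivlMr// mulVf// ltW.
  by rewrite ler_pdivrMr// -exprSr.
have F20 : 0 <= F s N (l / 2) by rewrite ltW// mean_exp_gt0//; exact: Cb_l.
apply: (@le_trans _ _ (expR (Lambda * l ^+ 2 * tau) * expR K *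
   expR (2 * Lambda * tau * (l / 2) ^+ 2 + 2 * (be + K) * (l / 2) - K) ^+ 2)).
  apply: ler_pM.
  - by rewrite mulr_ge0 ?expR_ge0// exprn_ge0// ltW// C_gt0.
  - exact: sqr_ge0.
  - by rewrite ler_pM2l ?expR_gt0// AE le_max lexx orbT.
  - by rewrite lerXn2r ?nnegrE ?expR_ge0.
rewrite -expRM_natl -!expRD ler_expR le_eqVlt; apply/orP; left; apply/eqP.
by field.
Qed.

End GaussianBound.

(** * Supercontractivity implies Gaussian integrability *)

Section SuperImpliesGaussianWeight.
Variables (R : realType) (d : nat).
Local Notation V := 'rV[R]_d.
Local Notation T := (borelV R d).

Lemma sum_expRN_le1 m : \sum_(k < m) expR (- k.+1%:R : R) <= 1.
Proof.
suff : \sum_(k < m) expR (- k.+1%:R : R) <= 1 - 2^-1 ^+ m.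
  by move=> /le_trans; apply; rewrite lerBlDr lerDl exprn_ge0// invr_ge0.
elim: m => [|m IHm]; first by rewrite big_ord0 expr0 subrr.
rewrite big_ord_recr /=; apply: (le_trans (lerD IHm (_ : _ <= 2^-1 ^+ m.+1))); last first.
  by rewrite exprS; lra.
rewrite expRN exprVn lef_pV2 ?posrE ?expR_gt0 ?exprn_gt0//.
rewrite -[leRHS]/(expR (m.+1)%:R) -[(m.+1)%:R]mulr1 expRM_natl.
by apply: lerXn2r; rewrite ?nnegrE ?expR_ge0//; exact: expR_ge1Dx.
Qed.

(** Completing the square: [alpha * r ^ 2 - (j * r - j ^ 2 / (4 * alpha))] equals
    [(j - 2 * alpha * r) ^ 2 / (4 * alpha)], which is at most [1 / (4 * alpha)] for
    the integer [j] that follows [2 * alpha * r]. *)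
Lemma gauss_by_exponentials (alpha r : R) m : 0 < alpha -> 0 <= r ->
  2 * alpha * r < m%:R ->
  expR (alpha * r ^+ 2) <= expR (4 * alpha)^-1 *
    \sum_(k < m) expR (k.+1%:R * r - k.+1%:R ^+ 2 / (4 * alpha)).
Proof.
move=> a0 r0 rm; pose z := 2 * alpha * r.
have z0 : 0 <= z by rewrite mulr_ge0// mulr_ge0// ltW.
pose k := Num.truncn z.
have kz : k%:R <= z by have /andP[] := Num.Theory.truncn_itv z0.
have zk : z < k.+1%:R by have /andP[] := Num.Theory.truncn_itv z0.
have km : (k < m)%N by rewrite -(@ltr_nat R); exact: le_lt_trans kz rm.
rewrite (bigD1 (Ordinal km))//= mulrDr.
apply: (@le_trans _ _ (expR (4 * alpha)^-1 * expR (k.+1%:R * r - k.+1%:R ^+ 2 / (4 * alpha)))).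
  rewrite -expRD ler_expR -subr_ge0.
  have -> : (4 * alpha)^-1 + (k.+1%:R * r - k.+1%:R ^+ 2 / (4 * alpha)) - alpha * r ^+ 2 =
      (1 - (k.+1%:R - z) ^+ 2) / (4 * alpha) by rewrite /z; field; rewrite gt_eqF.
  rewrite divr_ge0//; last by rewrite mulr_ge0// ltW.
  have k0 : 0 <= k.+1%:R - z by rewrite subr_ge0 ltW.
  by rewrite subr_ge0 expr_le1// -natr1; lra.
rewrite lerDl mulr_ge0 ?expR_ge0// sumr_ge0// => i _; exact: expR_ge0.
Qed.

Variables (I : set R) (Q : R -> 'M[R]_d) (b : R -> V -> V).
Variables (eta0 Lambda a : R) (phi : V -> R) (gphi : V -> V)
  (Hphi : V -> 'M[R]_d).
Hypothesis DS : dissipative_setting I Q b eta0 Lambda a phi gphi Hphi.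
Variables (theta : R) (G : R -> R -> (V -> R) -> V -> R).
Hypothesis G_evol : evolution_operator I Q b theta G.
Variable mu : R -> probability T R.
Hypothesis mu_evol : evolution_system_of_measures I G mu.
Hypothesis mu_tight : tight_family I mu.

Lemma mean_sum s m (f : nat -> V -> R) : (forall k, Cb (f k)) ->
  Cb (fun x => \sum_(k < m) f k x) /\
  mean mu s (fun x => \sum_(k < m) f k x) = \sum_(k < m) mean mu s (f k).
Proof.
move=> Cf; elim: m => [|m [C1 E1]].
  under eq_fun do rewrite big_ord0.
  by rewrite big_ord0 mean_cst; split => //; exact: Cb_cst.
under eq_fun do rewrite big_ord_recr /=.
rewrite big_ord_recr /= -E1 mean_add//; split => //.
by have := Cb_lin 1 C1 (Cf m); under eq_fun do rewrite mul1r.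
Qed.

(** With [2 * Lambda * tau = 1 / (8 * alpha)] the term of index [j] of the
    preceding sum has mean at most
    [exp (D * j - j ^ 2 / (8 * alpha)) <= exp (2 * alpha * (D + 1) ^ 2 - j)], and
    these are summable uniformly in the truncation level. *)
Lemma gauss_integral_bound : supercontractive I G mu ->
  forall alpha : R, 0 < alpha -> exists B : R, forall s, I s ->
    (\int[mu s]_x (gauss_weight alpha (x : V))%:E <= B%:E)%E.
Proof.
move=> super alpha a0.
have [||_ [C [C0 _ _ Cop]]] := super 2 4; [lra|lra|].
have L0 := ds_Lambda DS.
pose tau := (16 * alpha * Lambda)^-1.
have t0 : 0 < tau by rewrite invr_gt0 !mulr_gt0.
have [D D0 HD] := mgf_bound DS G_evol mu_evol mu_tight C0 Cop t0.
pose B := expR (4 * alpha)^-1 * expR (2 * alpha * (D + 1) ^+ 2).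
have Ctr (n : nat) (k : R) : Cb (fun x : V => k * trunc_norm n%:R x).
  by apply: Cb_scale; exact: Cb_trunc_norm.
have Csq (n : nat) : Cb (fun x : V => expR (alpha * trunc_norm n%:R x ^+ 2)).
  apply: Cb_exp; apply: Cb_scale; have [ct _] := @Cb_trunc_norm R d n%:R (ler0n _ _).
  split.
    by apply: (@cont_map _ _ (fun y : R => y ^+ 2)) => //; exact: exprn_continuous.
  exists (n%:R ^+ 2) => x; rewrite normrX lerXn2r ?nnegrE//.
  by rewrite ger0_norm ?trunc_norm_le// trunc_norm_ge0.
have key (n : nat) s : I s -> mean mu s (fun x => expR (alpha * trunc_norm n%:R x ^+ 2)) <= B.
  move=> Is.
  have [m nm] : exists m : nat, 2 * alpha * n%:R < m%:R.
    exists (Num.truncn (2 * alpha * n%:R)).+1.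
    by rewrite Num.Theory.truncnS_gt.
  (* The coefficients of [gauss_by_exponentials]. *)
  pose e (k : nat) := expR (- (k.+1%:R ^+ 2 / (4 * alpha))).
  pose f (k : nat) (x : V) := e k * expR (k.+1%:R * trunc_norm n%:R x).
  have Cf k : Cb (f k) by apply: Cb_scale; apply: Cb_exp.
  have [CF EF] := mean_sum s m Cf.
  apply: (@le_trans _ _ (expR (4 * alpha)^-1 * mean mu s (fun x => \sum_(k < m) f k x))).
    rewrite -mean_scale//; apply: mean_mono => //; first exact: Cb_scale.
    move=> x; apply: le_trans (gauss_by_exponentials (m := m) a0 _ _) _.
    - exact: trunc_norm_ge0.
    - apply: le_lt_trans nm; rewrite ler_wpM2l ?trunc_norm_le//.
      by rewrite mulr_ge0// ltW.
    - rewrite ler_pM2l ?expR_gt0//; apply: ler_sum => k _.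
      by rewrite /f /e -expRD addrC.
  rewrite ler_pM2l ?expR_gt0// EF.
  apply: (@le_trans _ _ (expR (2 * alpha * (D + 1) ^+ 2) * \sum_(k < m) expR (- k.+1%:R))); last first.
    by rewrite -[leRHS]mulr1 ler_pM2l ?expR_gt0// sum_expRN_le1.
  rewrite mulr_sumr; apply: ler_sum => k _.
  rewrite mean_scale; last exact: Cb_exp.
  have k1 : 2^-1 <= k.+1%:R :> R.
    by apply: (@le_trans _ _ 1); [rewrite invf_le1 ?ler1n|rewrite ler1n].
  apply: le_trans (ler_wpM2l (expR_ge0 _) (HD s n%:R k.+1%:R Is (ler0n _ _) k1)) _.
  rewrite -!expRD ler_expR -subr_ge0.
  move: (k.+1%:R) => j.
  rewrite (_ : _ - _ = (j - 4 * alpha * (D + 1)) ^+ 2 / (8 * alpha)).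
    by rewrite divr_ge0 ?sqr_ge0// mulr_ge0// ltW.
  by rewrite /tau; field; rewrite !gt_eqF.
exists B => s Is.
pose g (n : nat) (x : T) : \bar R := (expR (alpha * trunc_norm n%:R (x : V) ^+ 2))%:E.
have mg n : measurable_fun [set: T] (g n).
  by apply: (measurable_int (mu s)); exact: Cb_integrable.
have gle n : (\int[mu s]_x g n x <= B%:E)%E.
  by rewrite (meanE mu s (Csq n)) lee_fin key.
have nd (x : T) : [set: T] x -> nondecreasing_seq (g ^~ x).
  move=> _ n m nm; rewrite lee_fin ler_expR ler_pM2l// lerXn2r ?nnegrE ?trunc_norm_ge0//.
  by apply: trunc_norm_mono; rewrite ler_nat.
have g0 n (x : T) : [set: T] x -> (0 <= g n x)%E by move=> _; rewrite lee_fin expR_ge0.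
have lim (x : T) : (gauss_weight alpha (x : V))%:E = limn (g ^~ x).
  apply/esym/lim_near_cst => //; exists (Num.truncn (enorm (x : V))).+1 => // n /= xn.
  rewrite /g /gauss_weight /trunc_norm min_l//; apply/ltW.
  apply: (@lt_le_trans _ _ (Num.truncn (enorm (x : V))).+1%:R); last by rewrite ler_nat.
  by rewrite Num.Theory.truncnS_gt.
rewrite (eq_integral _ _ (fun x _ => lim x)).
have cvgI := cvg_monotone_convergence (mu := mu s) measurableT mg g0 nd.
rewrite -(cvg_lim _ cvgI)//; apply: lime_le.
  by apply/cvg_ex; eexists; exact: cvgI.
by apply: nearW => n; exact: gle.
Qed.

Lemma gaussian_of_super : supercontractive I G mu ->
  (forall lambda s : R, 0 < lambda -> I s -> Lp mu 1 s (gauss_weight lambda)) /\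
  (forall lambda : R, 0 < lambda ->
     (ereal_sup [set Lpnorm mu 1 s (gauss_weight lambda) | s in I] < +oo)%E).
Proof.
move=> super; split=> lambda.
  move=> s l0 Is; have [B HB] := gauss_integral_bound super l0.
  rewrite /Lp inE; apply/andP; split; rewrite inE /=; first exact: measurable_gauss_weight.
  apply: (@le_lt_trans _ _ B%:E); last exact: ltry.
  by rewrite -/(Lpnorm mu 1 s _) Lpnorm1_gauss HB.
move=> l0; have [B HB] := gauss_integral_bound super l0.
apply: (@le_lt_trans _ _ B%:E); last exact: ltry.
apply: ge_ereal_sup => _ [s Is <-]; by rewrite Lpnorm1_gauss HB.
Qed.

End SuperImpliesGaussianWeight.

(** * The equivalence *)

Theorem theorem3p7 (R : realType) (d : nat) (d_gt0 : (0 < d)%N)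
    (iota : R) (I : set R) (I_halfline : I = `]iota, +oo[%classic)
    (theta : R) (Q : R -> 'M[R]_d) (b : R -> 'rV[R]_d -> 'rV[R]_d)
    (hyp : standing_assumptions I Q b theta)
    (G : R -> R -> ('rV[R]_d -> R) -> 'rV[R]_d -> R)
    (G_evol : evolution_operator I Q b theta G)
    (mu : R -> probability (borelV R d) R)
    (mu_tight : tight_family I mu)
    (mu_evol : evolution_system_of_measures I G mu) :
  supercontractive I G mu <->
  (forall lambda s : R, 0 < lambda -> I s ->
     Lp mu 1 s (gauss_weight lambda)) /\
  (forall lambda : R, 0 < lambda ->
     (ereal_sup [set Lpnorm mu 1 s (gauss_weight lambda) | s in I] < +oo)%E).
Proof.
have IE t : I t = (iota < t) :> Prop.
  by rewrite I_halfline /= in_itv /= andbT.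
have up s t : I s -> s <= t -> I t by rewrite !IE; exact: lt_le_trans.
have [eta0 [Lambda [a [phi [gphi [Hphi DS]]]]]] := standing_setting up hyp.
split; first exact: (gaussian_of_super DS G_evol mu_evol mu_tight).
move=> [_ fin_sup]; apply: (super_of_gaussian DS G_evol mu_evol mu_tight) => //.
by exists (iota + 1); rewrite IE ltrDl.
Qed.
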